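(* Let $\Gamma=\langle\xi,\eta\rangle$ be a Kleinian group that is free on $\xi,\eta$, geometrically infinite, and contains no parabolic elements. Let $k\ge2$ and $z_0\in\mathbb{H}^3$. Then there is a family of Borel measures $\{\nu_\psi\}_{\psi\in\Psi^k}$ on $S_\infty$ such that (i) $A_{z_0}=\sum_{\psi\in\Psi^k}\nu_\psi$, and (ii) for every group-theoretical relation $(\gamma,\psi)$ of level $k$, $$\int_{S_\infty}(\lambda_{\gamma,z_0})^2\,d\nu_\psi \;=\;1-\sum_{\psi'\in S(\gamma,\psi)}\nu_{\psi'}(S_\infty).$$
   Context: $S_\infty\cong S^2$ is the sphere at infinity of $\mathbb{H}^3$. $A_{z_0}$ is the area measure on $S_\infty$ based at $z_0$ (the round measure obtained by identifying $S_\infty$ with the unit tangent sphere at $z_0$), normalized so that $A_{z_0}(S_\infty)=1$. For an isometry $\gamma$, $(\lambda_{\gamma,z_0})^2$ denotes the conformal expansion factor of the action of $\gamma$ on $S_\infty$, measured in the round metric centered at $z_0$ (so $\lambda_{\gamma,z_0}^2$ is the Jacobian of $\gamma$ with respect to $A_{z_0}$). $\Psi^k$ is the set of reduced words of length exactly $k$ in $\xi^{\pm1},\eta^{\pm1}$; $|w|$ is reduced length. A group-theoretical relation of level $k$ is a pair $(\gamma,\psi)$ with $\gamma\in\Gamma\setminus\{1\}$, $|\gamma|\le k$, $\psi\in\Psi^k$, and $|\gamma\psi|\le k$. For such a pair, $S(\gamma,\psi)\subset\Psi^k$ is defined as follows: if $\gamma\psi=1$, $S(\gamma,\psi)$ is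 the set of words in $\Psi^k$ whose first letter equals the first letter of the reduced word $\gamma$; if $\gamma\psi\neq1$, $S(\gamma,\psi)$ is the set of words in $\Psi^k$ that do not have the reduced word $\gamma\psi$ as an initial subword. *)

(* Defs.v *)
From HB Require Import structures.
From mathcomp Require Import all_boot all_order all_algebra.
From mathcomp Require Import all_classical all_reals all_analysis.
Import Order.TTheory GRing.Theory Num.Theory numFieldNormedType.Exports.

Set Implicit Arguments.
Unset Strict Implicit.
Unset Printing Implicit Defensive.

Local Open Scope classical_set_scope.
Local Open Scope ring_scope.

(* A letter is (generator, inverted?): generator false = xi, true = eta;
   so (false,false) = xi, (false,true) = xi^-1, (true,false) = eta,
   (true,true) = eta^-1. *)
Definition letter := (bool * bool)%type.

Definition linv (a : letter) : letter := (a.1, ~~ a.2).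

Definition reduced (w : seq letter) : bool :=
  sorted (fun a b : letter => b != linv a) w.

Fixpoint freered (w : seq letter) : seq letter :=
  match w with
  | [::] => [::]
  | a :: w' =>
      match freered w' with
      | b :: t' => if b == linv a then t' else a :: b :: t'
      | [::] => [:: a]
      end
  end.

(* A group-theoretical relation of level k: gamma is a nontrivial element
   (given by its reduced word g, which is unique since Gamma is free on
   xi, eta), |gamma| <= k, psi in Psi^k, and |gamma psi| <= k. *)
Definition relation_k (k : nat) (g : seq letter) (p : k.-tuple letter) : bool :=
  [&& reduced g, g != [::], (size g <= k)%N, reduced p
    & (size (freered (g ++ p)) <= k)%N].

Definition Sset (k : nat) (g : seq letter) (p p' : k.-tuple letter) : bool :=
  reduced p' &&
  (if freered (g ++ p) == [::] then ohead p' == ohead g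
   else ~~ prefix (freered (g ++ p)) p').

Section Geometry.
Variable R : realType.

Definition i0 : 'I_4 := @Ordinal 4 0 isT.
Definition i1 : 'I_4 := @Ordinal 4 1 isT.
Definition i2 : 'I_4 := @Ordinal 4 2 isT.
Definition i3 : 'I_4 := @Ordinal 4 3 isT.

Definition Jm : 'M[R]_4 :=
  \matrix_(i, j) (if i == j then (if i == i3 then -1 else 1) else 0).

Definition lorentz (M : 'M[R]_4) : bool :=
  [&& M^T *m Jm *m M == Jm, \det M == 1 & 0 < M i3 i3].

Definition letter_mx (xi eta : 'M[R]_4) (a : letter) : 'M[R]_4 :=
  let g := if a.1 then eta else xi in if a.2 then invmx g else g.

Definition word_mx (xi eta : 'M[R]_4) (w : seq letter) : 'M[R]_4 :=
  foldr (fun a M => letter_mx xi eta a *m M) 1%:M w.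

Definition Gamma (xi eta : 'M[R]_4) : set 'M[R]_4 :=
  [set M | exists w : seq letter, M = word_mx xi eta w].

Definition discrete_group (G : set 'M[R]_4) : Prop :=
  exists eps : R, 0 < eps /\
    forall g, G g -> g <> 1%:M ->
      exists i j, eps <= `|g i j - (1%:M : 'M[R]_4) i j|.

(* Kleinian group: discrete subgroup of SO^+(3,1) (~ PSL(2,C)) *)
Definition kleinian (xi eta : 'M[R]_4) : Prop :=
  lorentz xi /\ lorentz eta /\ discrete_group (Gamma xi eta).

Definition free_on (xi eta : 'M[R]_4) : Prop :=
  forall w : seq letter, reduced w -> w <> [::] -> word_mx xi eta w <> 1%:M.

Definition H3 : set 'cV[R]_4 :=
  [set x | (x^T *m Jm *m x) 0 0 = -1 /\ 0 < x i3 0].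

Definition origin : 'cV[R]_4 := \col_i (i == i3)%:R.

Definition dot (p q : (R * R * R)%type) : R :=
  p.1.1 * q.1.1 + p.1.2 * q.1.2 + p.2 * q.2.
Definition enorm (p : (R * R * R)%type) : R := Num.sqrt (dot p p).
Definition psub (p q : (R * R * R)%type) : (R * R * R)%type :=
  ((p.1.1 - q.1.1, p.1.2 - q.1.2), p.2 - q.2).
Definition pscale (c : R) (p : (R * R * R)%type) : (R * R * R)%type :=
  ((c * p.1.1, c * p.1.2), c * p.2).

(* sphere at infinity S_infty = S^2 *)
Definition S2 : set (R * R * R)%type := [set p | dot p p = 1].
(* open unit ball = Klein model of H^3 *)
Definition kball : set (R * R * R)%type := [set p | dot p p < 1].

Definition vec1 (p : (R * R * R)%type) : 'cV[R]_4 :=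
  \col_i (nth 0 [:: p.1.1; p.1.2; p.2; 1] i).
Definition kproj (v : 'cV[R]_4) : (R * R * R)%type :=
  ((v i0 0 / v i3 0, v i1 0 / v i3 0), v i2 0 / v i3 0).

(* projective action of M on the closed Klein ball (in particular the
   boundary action on S_infty and the action on H^3 in Klein coords) *)
Definition bd (M : 'M[R]_4) (p : (R * R * R)%type) : (R * R * R)%type :=
  kproj (M *m vec1 p).

Definition limit_set (G : set 'M[R]_4) : set (R * R * R)%type :=
  [set p | S2 p /\ forall e : R, 0 < e ->
     exists g, G g /\ enorm (psub (kproj (g *m origin)) p) < e].

Definition conv (A : set (R * R * R)%type) : set (R * R * R)%type :=
  [set x | exists (n : nat) (c : 'I_n -> R) (s : 'I_n -> (R * R * R)%type),
     (forall i, 0 <= c i) /\ \sum_i c i = 1 /\ (forall i, A (s i)) /\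
     x = ((\sum_i c i * (s i).1.1, \sum_i c i * (s i).1.2),
          \sum_i c i * (s i).2)].

(* hyperbolic convex hull of the limit set (Klein model: geodesics are
   straight segments, so it is the Euclidean hull inside the ball) *)
Definition hull_limit (G : set 'M[R]_4) : set (R * R * R)%type :=
  conv (limit_set G) `&` kball.

(* geometrically finite (for groups without parabolics) = convex
   cocompact: Gamma \ CH(Lambda) is compact, i.e. CH(Lambda) is covered
   by the Gamma-translates of a compact subset K of H^3. *)
Definition geom_finite (G : set 'M[R]_4) : Prop :=
  exists K : set (R * R * R)%type, compact K /\ K `<=` kball /\
    forall x, hull_limit G x -> exists g y, G g /\ K y /\ x = bd g y.

Definition geom_infinite (G : set 'M[R]_4) : Prop := ~ geom_finite G.

Definition parabolic (g : 'M[R]_4) : Prop :=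
  g <> 1%:M /\ (forall x, H3 x -> g *m x <> x) /\
  exists p, (S2 p /\ bd g p = p) /\
            forall q, S2 q -> bd g q = q -> q = p.

Definition no_parabolic (G : set 'M[R]_4) : Prop :=
  forall g, G g -> ~ parabolic g.

(* the canonical boost (pure Lorentz transformation) sending origin to z *)
Definition boost (z : 'cV[R]_4) : 'M[R]_4 :=
  \matrix_(i, j)
    if (i < 3)%N && (j < 3)%N then (i == j)%:R + z i 0 * z j 0 / (1 + z i3 0)
    else if (i < 3)%N then z i 0
    else if (j < 3)%N then z j 0
    else z i3 0.

Definition leb3 :=
  (((@lebesgue_measure R) \x (@lebesgue_measure R)) \x (@lebesgue_measure R))%E.

(* normalized round (area) measure on S^2 = unit tangent sphere at the
   origin, defined through cones: sigma(E) = vol(cone over E)/vol(ball) *)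
Definition cone (E : set (R * R * R)%type) : set (R * R * R)%type :=
  [set x | 0 < enorm x <= 1 /\ E (pscale (enorm x)^-1 x)].

Definition sigma0 (E : set (R * R * R)%type) : \bar R :=
  (leb3 (cone E) * ((fine (leb3 [set x | enorm x <= 1]))^-1)%:E)%E.

(* A_{z0}: the unit tangent sphere at z0 is identified with the one at the
   origin through the isometry (boost z0), so A_{z0} is the push-forward of
   sigma0 by the boundary action of boost z0. Normalized: A_{z0}(S2)=1. *)
Definition Az (z : 'cV[R]_4) (E : set (R * R * R)%type) : \bar R :=
  sigma0 (bd (boost z) @^-1` E).

(* round (angular) metric on S_infty centered at z *)
Definition rho (z : 'cV[R]_4) (p q : (R * R * R)%type) : R :=
  acos (dot (bd (invmx (boost z)) p) (bd (invmx (boost z)) q)).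

(* lambda_{gamma,z}(p): conformal expansion factor of gamma at p, in the
   round metric centered at z *)
Definition lam (g : 'M[R]_4) (z : 'cV[R]_4) (p : (R * R * R)%type) : R :=
  lim ((fun q => rho z (bd g q) (bd g p) / rho z q p)
         @ within (fun q => S2 q /\ q <> p) (nbhs p)).

End Geometry.

Arguments S2 {R}.
Arguments kball {R}.
Arguments H3 {R}.
Arguments origin {R}.
Arguments Jm {R}.

(* Main.v *)
Require Import Defs.
From HB Require Import structures.
From mathcomp Require Import all_boot all_order all_algebra.
From mathcomp Require Import all_classical all_reals all_analysis.
From mathcomp Require Import measurable_realfun ring lra zify.
From mathcomp Require finmap.
Import Order.TTheory GRing.Theory Num.Theory numFieldNormedType.Exports.
Local Open Scope classical_set_scope.
Local Open Scope ring_scope.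
Set Implicit Arguments.
Unset Strict Implicit.
Unset Printing Implicit Defensive.

(** Write the action in the Lorentz model, conjugated so that [z0] is the origin.
    For a boundary point [x], weight a reduced word [w] by the power [-64] of the
    Lorentz product of [w z0] with a point of the geodesic ray from [z0] to [x];
    discreteness makes the total weight finite.  Normalising, cutting the free group
    into the [k]-cylinders seen from the words extended by [xi^oo], and averaging
    along the ray over many logarithmic scales gives nonnegative functions [f_psi]
    on the sphere that sum to [1] and are almost equivariant: since [gamma] maps rays
    to curves asymptotic to rays, translating by [gamma] only shifts the average.
    For a relation [(gamma, psi)] the cylinder identity
      [f_psi + \sum_(psi' in S(gamma, psi)) f_psi' \o gamma = 1]
    thus holds up to an arbitrarily small error.  Multiplying by the Jacobian
    [lambda_gamma ^ 2] and integrating against the area measure gives the identity (ii)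
    for the measures [f_psi A] up to that error, and an ultralimit removes the error. *)

(** The translation identity is exact at the points [N g *m Yp t x]. The defect is that such a point
    lies near, and not on, the ray towards [bd (N g) x], with its parameter multiplied by
    [kap (N g) x ^+ 2], which varies with [x]. On the geometric scale [tau0 * q ^+ j] this factor is
    an index shift bounded uniformly in [x], so an average over [n] indices moves by [O(1/n)] only.
    The exponent 64 comes from a count: the 16 rounded entries of [g33 * g] determine an element [g]
    of a discrete group, and a factor [g33 ^- 4] makes the sum over each entry converge. Area is
    defined by volumes of cones, so its transformation law is found on the light cone. Identified
    with R^3 by its space coordinates, this cone carries the Lorentz invariant measure
    [dx dy dz / enorm]; elimination by rotations and a boost reduces the invariance to one-variable
    substitutions, and homogeneity turns it into the Jacobian [kap ^- 2] on the sphere. An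
    ultrafilter gives limits on all Borel sets at once, and domination by area keeps them countably
    additive. *)

(** * Measures given by a density *)

Section density.
Local Open Scope ereal_scope.
Context d (T : measurableType d) (R : realType) (mu : {measure set T -> \bar R}).
Variables (g : T -> R).
Hypotheses (mg : measurable_fun setT g) (g0 : forall x, (0 <= g x)%R).

(** The proofs [mg] and [g0] are arguments so that the measure structure, which depends on them, can
    be inferred from the term. *)
Definition density (mg : measurable_fun [set: T] g)
  (g0 : forall x, (0 <= g x)%R) : set T -> \bar R :=
  fun A => \int[mu]_(x in A) (g x)%:E.

Let density0 : density mg g0 set0 = 0.
Proof. by rewrite /density integral_set0. Qed.

Let density_ge0 A : 0 <= density mg g0 A.
Proof. by apply: integral_ge0 => x _; rewrite lee_fin. Qed.

Let density_sigma_additive : semi_sigma_additive (density mg g0).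
Proof.
by apply: semi_sigma_additive_nng_induced;
  [exact/measurable_EFinP|move=> x; rewrite lee_fin].
Qed.

HB.instance Definition _ := isMeasure.Build _ _ _ (density mg g0)
  density0 density_ge0 density_sigma_additive.

Import HBNNSimple.

(** Both sides are monotone limits along simple functions, for which the identity reduces to the
    value of the density measure on level sets. *)
Lemma ge0_integral_density (f : T -> \bar R) :
  measurable_fun setT f -> (forall x, 0 <= f x) ->
  \int[density mg g0]_x f x = \int[mu]_x (f x * (g x)%:E).
Proof.
move=> mf f0.
pose f_ := nnsfun_approx measurableT mf.
transitivity (limn (fun n => \int[density mg g0]_x (f_ n x)%:E)).
  rewrite -monotone_convergence//.
  - apply: eq_integral => y _; apply/esym/cvg_lim => //.
    exact: cvg_nnsfun_approx.
  - by move=> n; exact/measurable_EFinP/measurable_funP.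
  - by move=> n y _; rewrite lee_fin.
  - by move=> y _ m n mn; rewrite lee_fin; exact/lefP/nd_nnsfun_approx.
rewrite [X in limn X](_ : _ = (fun n => \int[mu]_x (f_ n x * g x)%:E)).
  rewrite -monotone_convergence//; last 3 first.
    - move=> n; apply/measurable_EFinP; apply: measurable_funM => //.
    - by move=> n x _ /=; rewrite lee_fin mulr_ge0.
    - move=> x _ m n mn; rewrite lee_fin ler_wpM2r//.
      exact/lefP/nd_nnsfun_approx.
  apply: eq_integral => x _ /=; apply/cvg_lim => //.
  under eq_fun do rewrite EFinM.
  apply: cvgeZr => //; exact: cvg_nnsfun_approx.
apply/funext => n.
have mfn r : measurable (f_ n @^-1` [set r]) by [].
transitivity (\sum_(k \in range (f_ n))
    \int[mu]_x (k * \1_(f_ n @^-1` [set k]) x * g x)%:E).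
  under eq_integral do rewrite fimfunE -fsumEFin//.
  rewrite ge0_integral_fsum//; last 2 first.
  - by move=> y; exact/measurable_EFinP/measurable_funM.
  - by move=> y x _; rewrite nnfun_muleindic_ge0.
  apply: eq_fsbigr => r _; rewrite integralZl_indic_nnsfun// integral_indic//=.
  rewrite setIT /density.
  have [r0|r0] := ltP r 0%R.
    rewrite preimage_nnfun0// integral_set0 mule0.
    by rewrite integral0_eq// => x _; rewrite indic0 mulr0 mul0r.
  rewrite integral_mkcond -ge0_integralZl//; last 2 first.
  - apply/(measurable_restrictT _ (mfn r)).
    by apply: measurable_funTS; exact/measurable_EFinP.
  - by move=> x _; rewrite erestrict_ge0// => y _; rewrite lee_fin.
  apply: eq_integral => x _; rewrite patchE indicE.
  by case: (x \in _); rewrite /= ?mulr1 ?mulr0 ?mul0r ?mule0 ?EFinM.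
rewrite -ge0_integral_fsum//.
- apply: eq_integral => x _; rewrite fsumEFin// -mulr_fsuml.
  by rewrite -fimfunE.
- move=> r; apply/measurable_EFinP; apply: measurable_funM => //.
  exact: measurable_funM.
- move=> r x _; rewrite EFinM; apply: mule_ge0; last by rewrite lee_fin.
  exact: nnfun_muleindic_ge0.
Qed.

End density.

(** * One-variable substitution for Lebesgue measure *)

Section lebesgue_line.
Local Open Scope ereal_scope.
Context {R : realType}.
Local Notation mu := (@lebesgue_measure R).
Local Notation mR := (measurableTypeR R).

(** The push-forward under [F] of the measure with density [F'] gives []a, b]] the mass
    [F (Finv b) - F (Finv a) = b - a] by the fundamental theorem of calculus, so uniqueness
    identifies it with Lebesgue measure. *)
Lemma ge0_integral_subst (F Finv F' : R -> R) (f : mR -> \bar R) :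
  cancel F Finv -> cancel Finv F -> {homo F : x y / (x < y)%R} ->
  (forall x, is_derive x (1%R : R) F (F' x)) ->
  continuous F' -> (forall x, 0 <= F' x)%R ->
  measurable_fun setT f -> (forall x, 0 <= f x) ->
  \int[mu]_x (f (F x) * (F' x)%:E) = \int[mu]_x f x.
Proof.
move=> FK FinvK Fi dF cF' F'0 mf f0.
have cF : continuous F.
  by move=> x; apply/differentiable_continuous/derivable1_diffP; case: (dF x).
have mF : measurable_fun [set: mR] (F : mR -> mR) by exact: continuous_measurable_fun.
have mF' : measurable_fun [set: mR] F' by exact: continuous_measurable_fun.
pose nu : {measure set mR -> \bar R} := density mu mF' F'0.
have mfF : measurable_fun [set: mR] (f \o F) := measurableT_comp mf mF.
transitivity (\int[nu]_x (f \o F) x).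
  by apply/esym/(ge0_integral_density mu mF' F'0 mfF) => x; exact: f0.
rewrite -[LHS]/(\int[nu]_(x in F @^-1` setT) (f \o F) x).
rewrite -(ge0_integral_pushforward mF nu)//.
apply: eq_measure_integral => A mA _.
apply/esym/lebesgue_measure_unique => //= _ [[a b]] _ <-.
rewrite /pushforward /nu/= /density.
have -> : F @^-1` `]a, b]%classic = `]Finv a, Finv b]%classic.
  have Fle : {mono F : x y / (x <= y)%R} by exact/le_mono.
  by apply/seteqP; split => x /=; rewrite !in_itv/= -(Fle x (Finv b)) -(leW_mono Fle (Finv a) x) !FinvK.
have Finvi : {homo Finv : x y / (x < y)%R}.
  have Fle : {mono F : x y / (x <= y)%R} by exact/le_mono.
  by move=> x y xy; rewrite -(leW_mono Fle) !FinvK.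
rewrite lebesgue_measure_itv/= lte_fin; case: ifPn => ab; last first.
  rewrite set_itv_ge ?integral_set0// bnd_simp -leNgt.
  by have [<-//|] := eqVneq a b; move: ab; rewrite -leNgt le_eqVlt => /orP[/eqP->//|/Finvi/ltW//].
rewrite integral_itv_obnd_cbnd; last first.
  by apply: measurable_funTS; exact/measurable_EFinP.
rewrite (@continuous_FTC2 _ _ F) ?FinvK//.
- exact: Finvi.
- exact: continuous_subspaceT.
- split=> [x _| |]; first by case: (dF x).
  + by apply: cvg_at_right_filter; exact: cF.
  + by apply: cvg_at_left_filter; exact: cF.
- by move=> x _; rewrite derive1E; case: (dF x).
Qed.

Lemma ge0_integral_translate (c : R) (f : mR -> \bar R) :
  measurable_fun setT f -> (forall x, 0 <= f x) ->
  \int[mu]_x f (x + c)%R = \int[mu]_x f x.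
Proof.
move=> mf f0.
transitivity (\int[mu]_x (f (x + c)%R * 1%:E)).
  by apply: eq_integral => x _; rewrite mule1.
apply: (@ge0_integral_subst (fun x => x + c)%R (fun x => x - c)%R (cst 1%R) f) => //.
- by move=> x; rewrite addrK.
- by move=> x; rewrite subrK.
- by move=> x y; rewrite ltrD2r.
- by move=> x; rewrite -[cst 1%R x]addr0; apply: is_deriveD.
- by move=> x; exact: cvg_cst.
Qed.

Lemma ge0_integral_scale (c : R) (f : mR -> \bar R) : (0 < c)%R ->
  measurable_fun setT f -> (forall x, 0 <= f x) ->
  \int[mu]_x (f (c * x)%R * c%:E) = \int[mu]_x f x.
Proof.
move=> c0 mf f0; have c1 : c != 0%R by rewrite gt_eqF.
apply: (@ge0_integral_subst (fun x => c * x)%R (fun x => c^-1 * x)%R (cst c) f) => //.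
- by move=> x; rewrite mulKf.
- by move=> x; rewrite mulVKf.
- by move=> x y; rewrite ltr_pM2l.
- by move=> x; rewrite -[cst c x]mulr1; apply: is_deriveZ.
- by move=> x; exact: cvg_cst.
- by move=> x; exact: ltW.
Qed.

Lemma ge0_integral_opp (f : mR -> \bar R) :
  measurable_fun setT f -> (forall x, 0 <= f x) ->
  \int[mu]_x f (- x)%R = \int[mu]_x f x.
Proof.
move=> mf f0.
have mN : measurable_fun [set: mR] (-%R : mR -> mR) by exact: oppr_measurable.
rewrite -[LHS]/(\int[mu]_(x in (-%R : mR -> mR) @^-1` setT) (f \o -%R) x).
rewrite -(ge0_integral_pushforward mN mu)//.
by apply: eq_measure_integral => A mA _; exact: lebesgue_measureN.
Qed.

End lebesgue_line.

(** * Volume in R^3 under shears, rotations, dilations and boosts *)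

Section leb3.
Local Open Scope ereal_scope.
Context {R : realType}.
Local Notation mu := (@lebesgue_measure R).
Local Notation mR := (measurableTypeR R).
Local Notation mR3 := (mR * mR * mR)%type.
(** The planar factor of [leb3] gets a name to carry the sigma-finite structure that Tonelli's
    theorem asks for. *)
Definition leb2 : set (mR * mR) -> \bar R := product_measure1 mu mu.

HB.instance Definition _ := Measure.on leb2.

Let leb2_sigma_finite : sigma_finite setT leb2.
Proof.
have /sigma_finiteP[F [TF ndF Foo]] := sigma_finiteT mu.
exists (fun n => F n `*` F n).
  rewrite -setXTT TF predeqE => -[x y]; split.
    move=> [/= [n _ Fnx] [k _ Fky]]; exists (maxn n k) => //; split.
    - by move: x Fnx; exact/subsetPset/ndF/leq_maxl.
    - by move: y Fky; exact/subsetPset/ndF/leq_maxr.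
  by move=> [n _ []/= ? ?]; split; exists n.
move=> k; have [? ?] := Foo k.
split; first exact: measurableX.
by rewrite /leb2 product_measure1E// lte_mul_pinfty// ge0_fin_numE.
Qed.

HB.instance Definition _ := Measure_isSigmaFinite.Build _ _ _ leb2
  leb2_sigma_finite.

Implicit Types f g h : mR3 -> \bar R.

Lemma leb3_fubini3 f : measurable_fun setT f -> (forall x, 0 <= f x) ->
  \int[@leb3 R]_x f x = \int[mu]_x \int[mu]_y \int[mu]_z f (x, y, z).
Proof.
move=> mf f0; transitivity (\int[leb2]_x fubini_F mu f x).
  exact: (@fubini_tonelli1 _ _ _ _ _ leb2 mu f mf f0).
have mF := @measurable_fun_fubini_tonelli_F _ _ _ _ _ mu f mf f0.
apply: (@fubini_tonelli1 _ _ _ _ _ mu mu (fubini_F mu f) mF).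
by move=> x; apply: integral_ge0.
Qed.

Let measurable_slice f (z : R) : measurable_fun setT f ->
  measurable_fun setT (fun x : mR * mR => f (x, z)).
Proof. by move=> mf; apply: (measurableT_comp mf); exact: measurable_fun_pair. Qed.

Lemma leb3_fubini2 f : measurable_fun setT f -> (forall x, 0 <= f x) ->
  \int[@leb3 R]_x f x = \int[mu]_z \int[mu]_x \int[mu]_y f (x, y, z).
Proof.
move=> mf f0; transitivity (\int[mu]_z fubini_G leb2 f z).
  exact: (@fubini_tonelli2 _ _ _ _ _ leb2 mu f mf f0).
apply: eq_integral => z _.
by apply: (@fubini_tonelli1 _ _ _ _ _ mu mu _ (measurable_slice z mf)).
Qed.

Lemma leb3_fubini1 f : measurable_fun setT f -> (forall x, 0 <= f x) ->
  \int[@leb3 R]_x f x = \int[mu]_z \int[mu]_y \int[mu]_x f (x, y, z).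
Proof.
move=> mf f0; transitivity (\int[mu]_z fubini_G leb2 f z).
  exact: (@fubini_tonelli2 _ _ _ _ _ leb2 mu f mf f0).
apply: eq_integral => z _.
by apply: (@fubini_tonelli2 _ _ _ _ _ mu mu _ (measurable_slice z mf)).
Qed.

(** The plane [x = 0] is null. Discarding it keeps the lines of integration away from the third
    axis, where [enorm] fails to be smooth. *)
Lemma leb3_ext3 f g : measurable_fun setT f -> (forall x, 0 <= f x) ->
  measurable_fun setT g -> (forall x, 0 <= g x) ->
  (forall x y, x != 0%R ->
    \int[mu]_z f (x, y, z) = \int[mu]_z g (x, y, z)) ->
  \int[@leb3 R]_x f x = \int[@leb3 R]_x g x.
Proof.
move=> mf f0 mg g0 fg.
have miter h : measurable_fun setT h -> (forall x, 0 <= h x) ->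
    measurable_fun setT (fun x => \int[mu]_y \int[mu]_z h (x, y, z)).
  move=> mh h0.
  have mh2 := @measurable_fun_fubini_tonelli_F _ _ _ _ _ mu h mh h0.
  refine (@measurable_fun_fubini_tonelli_F _ _ _ _ _ mu (fubini_F mu h) mh2 _).
  by move=> x; apply: integral_ge0.
apply: (etrans (leb3_fubini3 mf f0)); apply: (etrans _ (esym (leb3_fubini3 mg g0))).
have mD : measurable ([set: R] `\ (0%R : R)) by exact: measurableD.
have mDf h (mh : measurable_fun setT h) (h0 : forall x, 0 <= h x) :
    measurable_fun ([set: R] `\ (0%R : R)) (fun x => \int[mu]_y \int[mu]_z h (x, y, z)).
  by apply: measurable_funTS; exact: miter.
apply: (etrans (esym (integral_setD1 mD (mDf f mf f0)))).
apply: (etrans _ (integral_setD1 mD (mDf g mg g0))).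
apply: eq_integral => x; rewrite inE => -[_ /eqP x0].
by apply: eq_integral => y _; exact: fg.
Qed.

Definition leb3_invariant (L : mR3 -> mR3) := measurable_fun setT L /\
  forall f, measurable_fun setT f -> (forall x, 0 <= f x) ->
  \int[@leb3 R]_x f (L x) = \int[@leb3 R]_x f x.

Lemma leb3_invariant_comp L1 L2 : leb3_invariant L1 -> leb3_invariant L2 ->
  leb3_invariant (L1 \o L2).
Proof.
move=> [m1 i1] [m2 i2]; split; first exact: (measurableT_comp m1 m2).
move=> f mf f0; apply: (etrans (i2 (f \o L1) (measurableT_comp mf m1) (fun x => f0 (L1 x)))).
exact: i1.
Qed.

Let X1 (p : mR3) : R := p.1.1.
Let X2 (p : mR3) : R := p.1.2.
Let X3 (p : mR3) : R := p.2.

Let mX1 : measurable_fun setT X1.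
Proof. exact: (measurableT_comp measurable_fst measurable_fst). Qed.
Let mX2 : measurable_fun setT X2.
Proof. exact: (measurableT_comp measurable_snd measurable_fst). Qed.
Let mX3 : measurable_fun setT X3. Proof. exact: measurable_snd. Qed.

Lemma measurable_triple (a b c : mR3 -> R) : measurable_fun setT a ->
  measurable_fun setT b -> measurable_fun setT c ->
  measurable_fun setT (fun p => (a p, b p, c p) : mR3).
Proof.
move=> ma mb mc; apply: measurable_fun_pair => //; exact: measurable_fun_pair.
Qed.

Let measurable_section1 f (y z : R) : measurable_fun setT f ->
  measurable_fun setT (fun x : mR => f (x, y, z)).
Proof.
move=> mf; apply: (measurableT_comp mf).
by apply: measurable_fun_pair => //; apply: measurable_fun_pair.
Qed.

Let measurable_section2 f (x z : R) : measurable_fun setT f ->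
  measurable_fun setT (fun y : mR => f (x, y, z)).
Proof.
move=> mf; apply: (measurableT_comp mf).
by apply: measurable_fun_pair => //; apply: measurable_fun_pair.
Qed.

Let measurable_section3 f (x y : R) : measurable_fun setT f ->
  measurable_fun setT (fun z : mR => f (x, y, z)).
Proof.
by move=> mf; apply: (measurableT_comp mf); apply: measurable_fun_pair.
Qed.

Lemma leb3_invariant_shear12 (a : R) :
  leb3_invariant (fun p => (p.1.1 + a * p.1.2, p.1.2, p.2)%R).
Proof.
have mL : measurable_fun setT (fun p : mR3 => (p.1.1 + a * p.1.2, p.1.2, p.2)%R : mR3).
  apply: measurable_triple => //; apply: measurable_funD => //.
  exact: measurable_funM.
split=> // f mf f0; apply: (etrans (leb3_fubini1 (measurableT_comp mf mL) (fun x => f0 _))).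
apply: (etrans _ (esym (leb3_fubini1 mf f0))); apply: eq_integral => z _; apply: eq_integral => y _ /=.
by rewrite (@ge0_integral_translate _ _ (fun x => f (x, y, z)))//; exact: measurable_section1.
Qed.

Lemma leb3_invariant_shear21 (a : R) :
  leb3_invariant (fun p => (p.1.1, p.1.2 + a * p.1.1, p.2)%R).
Proof.
have mL : measurable_fun setT (fun p : mR3 => (p.1.1, p.1.2 + a * p.1.1, p.2)%R : mR3).
  apply: measurable_triple => //; apply: measurable_funD => //.
  exact: measurable_funM.
split=> // f mf f0; apply: (etrans (leb3_fubini2 (measurableT_comp mf mL) (fun x => f0 _))).
apply: (etrans _ (esym (leb3_fubini2 mf f0))); apply: eq_integral => z _; apply: eq_integral => x _ /=.
by rewrite (@ge0_integral_translate _ _ (fun y => f (x, y, z)))//; exact: measurable_section2.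
Qed.

Lemma leb3_invariant_shear23 (a : R) :
  leb3_invariant (fun p => (p.1.1, p.1.2 + a * p.2, p.2)%R).
Proof.
have mL : measurable_fun setT (fun p : mR3 => (p.1.1, p.1.2 + a * p.2, p.2)%R : mR3).
  apply: measurable_triple => //; apply: measurable_funD => //.
  exact: measurable_funM.
split=> // f mf f0; apply: (etrans (leb3_fubini2 (measurableT_comp mf mL) (fun x => f0 _))).
apply: (etrans _ (esym (leb3_fubini2 mf f0))); apply: eq_integral => z _; apply: eq_integral => x _ /=.
by rewrite (@ge0_integral_translate _ _ (fun y => f (x, y, z)))//; exact: measurable_section2.
Qed.

Lemma leb3_invariant_shear32 (a : R) :
  leb3_invariant (fun p => (p.1.1, p.1.2, p.2 + a * p.1.2)%R).
Proof.
have mL : measurable_fun setT (fun p : mR3 => (p.1.1, p.1.2, p.2 + a * p.1.2)%R : mR3).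
  apply: measurable_triple => //; apply: measurable_funD => //.
  exact: measurable_funM.
split=> // f mf f0; apply: (etrans (leb3_fubini3 (measurableT_comp mf mL) (fun x => f0 _))).
apply: (etrans _ (esym (leb3_fubini3 mf f0))); apply: eq_integral => x _; apply: eq_integral => y _ /=.
by rewrite (@ge0_integral_translate _ _ (fun z => f (x, y, z)))//; exact: measurable_section3.
Qed.

Lemma leb3_invariant_id : leb3_invariant id.
Proof. by split. Qed.

Lemma leb3_invariant_opp1 : leb3_invariant (fun p => (- p.1.1, p.1.2, p.2)%R).
Proof.
have mL : measurable_fun setT (fun p : mR3 => (- p.1.1, p.1.2, p.2)%R : mR3).
  by apply: measurable_triple => //; exact: measurable_funN.
split=> // f mf f0; apply: (etrans (leb3_fubini1 (measurableT_comp mf mL) (fun x => f0 _))).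
apply: (etrans _ (esym (leb3_fubini1 mf f0))); apply: eq_integral => z _; apply: eq_integral => y _ /=.
by rewrite (@ge0_integral_opp _ (fun x => f (x, y, z)))//; exact: measurable_section1.
Qed.

Lemma leb3_invariant_opp2 : leb3_invariant (fun p => (p.1.1, - p.1.2, p.2)%R).
Proof.
have mL : measurable_fun setT (fun p : mR3 => (p.1.1, - p.1.2, p.2)%R : mR3).
  by apply: measurable_triple => //; exact: measurable_funN.
split=> // f mf f0; apply: (etrans (leb3_fubini2 (measurableT_comp mf mL) (fun x => f0 _))).
apply: (etrans _ (esym (leb3_fubini2 mf f0))); apply: eq_integral => z _; apply: eq_integral => x _ /=.
by rewrite (@ge0_integral_opp _ (fun y => f (x, y, z)))//; exact: measurable_section2.
Qed.

Lemma leb3_invariant_opp3 : leb3_invariant (fun p => (p.1.1, p.1.2, - p.2)%R).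
Proof.
have mL : measurable_fun setT (fun p : mR3 => (p.1.1, p.1.2, - p.2)%R : mR3).
  by apply: measurable_triple => //; exact: measurable_funN.
split=> // f mf f0; apply: (etrans (leb3_fubini3 (measurableT_comp mf mL) (fun x => f0 _))).
apply: (etrans _ (esym (leb3_fubini3 mf f0))); apply: eq_integral => x _; apply: eq_integral => y _ /=.
by rewrite (@ge0_integral_opp _ (fun z => f (x, y, z)))//; exact: measurable_section3.
Qed.

(* A plane rotation is a product of three shears. *)
Lemma leb3_invariant_rot12 (c s : R) : (c ^+ 2 + s ^+ 2 = 1)%R -> (0 <= c)%R ->
  leb3_invariant
    (fun p => (c * p.1.1 - s * p.1.2, s * p.1.1 + c * p.1.2, p.2)%R).
Proof.
(* [t] is the tangent of half the angle; [0 <= c] keeps its denominator positive. *)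
move=> cs c0; pose t := (s / (1 + c))%R.
have c1 : (1 + c != 0)%R by rewrite gt_eqF// ltr_wpDr.
have := leb3_invariant_comp (leb3_invariant_shear12 (- t))
  (leb3_invariant_comp (leb3_invariant_shear21 s) (leb3_invariant_shear12 (- t))).
congr leb3_invariant; apply/funext => -[[x y] z] /=.
have ts : (t * s = 1 - c)%R.
  rewrite /t mulrAC -expr2; apply: (mulIf c1); rewrite mulfVK//.
  by have -> : (s ^+ 2 = 1 - c ^+ 2)%R; [rewrite -cs|]; ring.
have tc : (t * (1 + c) = s)%R by rewrite /t mulfVK.
congr (_, _, _).
  transitivity (x * (1 - t * s) - (t * (1 + c) + t * (1 - c - t * s)) * y)%R; first by ring.
  by rewrite ts tc; ring.
transitivity (s * x + y * (1 - t * s))%R; first by ring.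
by rewrite ts; ring.
Qed.

Lemma leb3_invariant_rot23 (c s : R) : (c ^+ 2 + s ^+ 2 = 1)%R -> (0 <= c)%R ->
  leb3_invariant
    (fun p => (p.1.1, c * p.1.2 - s * p.2, s * p.1.2 + c * p.2)%R).
Proof.
move=> cs c0; pose t := (s / (1 + c))%R.
have c1 : (1 + c != 0)%R by rewrite gt_eqF// ltr_wpDr.
have := leb3_invariant_comp (leb3_invariant_shear23 (- t))
  (leb3_invariant_comp (leb3_invariant_shear32 s) (leb3_invariant_shear23 (- t))).
congr leb3_invariant; apply/funext => -[[z x] y] /=.
have ts : (t * s = 1 - c)%R.
  rewrite /t mulrAC -expr2; apply: (mulIf c1); rewrite mulfVK//.
  by have -> : (s ^+ 2 = 1 - c ^+ 2)%R; [rewrite -cs|]; ring.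
have tc : (t * (1 + c) = s)%R by rewrite /t mulfVK.
congr (_, _, _).
  transitivity (x * (1 - t * s) - (t * (1 + c) + t * (1 - c - t * s)) * y)%R; first by ring.
  by rewrite ts tc; ring.
transitivity (s * x + y * (1 - t * s))%R; first by ring.
by rewrite ts; ring.
Qed.


Let leb3_mulr f (c : \bar R) : measurable_fun setT f -> (forall x, 0 <= f x) ->
  0 <= c -> \int[@leb3 R]_p f p * c = \int[@leb3 R]_p (f p * c).
Proof. by move=> mf f0 c0; apply/esym/ge0_integralZr. Qed.

Let leb3_scale1 (c : R) f : (0 < c)%R -> measurable_fun setT f ->
  (forall x, 0 <= f x) ->
  \int[@leb3 R]_p f (c * p.1.1, p.1.2, p.2)%R * c%:E = \int[@leb3 R]_x f x.
Proof.
move=> c0 mf f0.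
have mL : measurable_fun setT (fun p : mR3 => (c * p.1.1, p.1.2, p.2)%R : mR3).
  by apply: measurable_triple => //; exact: measurable_funM.
have mfL := measurableT_comp mf mL.
have cE : 0 <= c%:E by rewrite lee_fin ltW.
have mfLc : measurable_fun setT (fun p : mR3 => f (c * p.1.1, p.1.2, p.2)%R * c%:E).
  by apply: emeasurable_funM => //; exact: measurable_cst.
apply: (etrans (leb3_mulr mfL (fun x => f0 _) cE)).
apply: (etrans (leb3_fubini1 mfLc (fun x => mule_ge0 (f0 _) cE))).
apply: (etrans _ (esym (leb3_fubini1 mf f0))); apply: eq_integral => z _; apply: eq_integral => y _ /=.
by rewrite (@ge0_integral_scale _ _ (fun x => f (x, y, z)))//; exact: measurable_section1.
Qed.

Let leb3_scale2 (c : R) f : (0 < c)%R -> measurable_fun setT f ->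
  (forall x, 0 <= f x) ->
  \int[@leb3 R]_p f (p.1.1, c * p.1.2, p.2)%R * c%:E = \int[@leb3 R]_x f x.
Proof.
move=> c0 mf f0.
have mL : measurable_fun setT (fun p : mR3 => (p.1.1, c * p.1.2, p.2)%R : mR3).
  by apply: measurable_triple => //; exact: measurable_funM.
have mfL := measurableT_comp mf mL.
have cE : 0 <= c%:E by rewrite lee_fin ltW.
have mfLc : measurable_fun setT (fun p : mR3 => f (p.1.1, c * p.1.2, p.2)%R * c%:E).
  by apply: emeasurable_funM => //; exact: measurable_cst.
apply: (etrans (leb3_mulr mfL (fun x => f0 _) cE)).
apply: (etrans (leb3_fubini2 mfLc (fun x => mule_ge0 (f0 _) cE))).
apply: (etrans _ (esym (leb3_fubini2 mf f0))); apply: eq_integral => z _; apply: eq_integral => x _ /=.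
by rewrite (@ge0_integral_scale _ _ (fun y => f (x, y, z)))//; exact: measurable_section2.
Qed.

Let leb3_scale3 (c : R) f : (0 < c)%R -> measurable_fun setT f ->
  (forall x, 0 <= f x) ->
  \int[@leb3 R]_p f (p.1.1, p.1.2, c * p.2)%R * c%:E = \int[@leb3 R]_x f x.
Proof.
move=> c0 mf f0.
have mL : measurable_fun setT (fun p : mR3 => (p.1.1, p.1.2, c * p.2)%R : mR3).
  by apply: measurable_triple => //; exact: measurable_funM.
have mfL := measurableT_comp mf mL.
have cE : 0 <= c%:E by rewrite lee_fin ltW.
have mfLc : measurable_fun setT (fun p : mR3 => f (p.1.1, p.1.2, c * p.2)%R * c%:E).
  by apply: emeasurable_funM => //; exact: measurable_cst.
apply: (etrans (leb3_mulr mfL (fun x => f0 _) cE)).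
apply: (etrans (leb3_fubini3 mfLc (fun x => mule_ge0 (f0 _) cE))).
apply: (etrans _ (esym (leb3_fubini3 mf f0))); apply: eq_integral => x _; apply: eq_integral => y _ /=.
by rewrite (@ge0_integral_scale _ _ (fun z => f (x, y, z)))//; exact: measurable_section3.
Qed.

Lemma leb3_scale (c : R) f : (0 < c)%R -> measurable_fun setT f ->
  (forall x, 0 <= f x) ->
  \int[@leb3 R]_x f (pscale c x) * (c ^+ 3)%:E = \int[@leb3 R]_x f x.
Proof.
move=> c0 mf f0.
have m1 : measurable_fun setT (fun p : mR3 => f (c * p.1.1, p.1.2, p.2)%R).
  apply: (measurableT_comp mf).
  by apply: measurable_triple => //; exact: measurable_funM.
have m2 : measurable_fun setT (fun p : mR3 => f (c * p.1.1, c * p.1.2, p.2)%R).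
  apply: (measurableT_comp mf).
  by apply: measurable_triple => //; exact: measurable_funM.
rewrite -[RHS](leb3_scale1 c0 mf f0).
rewrite -[X in _ = X * _](leb3_scale2 c0 m1)//.
rewrite -[X in _ = X * _ * _](leb3_scale3 c0 m2)//.
by rewrite -!muleA -!EFinM.
Qed.

(** Inversion is [x] times a real power of [x ^+ 2]. The formula also holds at the origin, where the
    inverse is [0] by convention. *)
Lemma measurable_inv : measurable_fun [set: R] (@GRing.inv R).
Proof.
have -> : @GRing.inv R = (fun x => x * (x ^+ 2) `^ (-1))%R.
  apply/funext => x; rewrite powR_inv1 ?sqr_ge0//.
  have [->|x0] := eqVneq x 0%R; first by rewrite invr0 mul0r.
  by rewrite expr2 invfM mulrA divff// mul1r.
apply: measurable_funM => //.
exact: (measurableT_comp (@measurable_powR R (-1)%R) (@exprn_measurable R setT 2)).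
Qed.

Lemma measurable_sqrt : measurable_fun [set: R] (@Num.sqrt R).
Proof. by apply: continuous_measurable_fun; exact: sqrt_continuous. Qed.

Lemma measurable_enorm : measurable_fun [set: mR3] (@enorm R).
Proof.
apply: (measurableT_comp measurable_sqrt); rewrite /dot.
by do !apply: measurable_funD => //; exact: measurable_funM.
Qed.

Lemma measurable_enormV : measurable_fun [set: mR3] (fun x => (@enorm R x)^-1)%R.
Proof. exact: (measurableT_comp measurable_inv measurable_enorm). Qed.

Section boost.
Variables (ch sh : R).
Hypotheses (ch0 : (0 < ch)%R) (chsh : (ch ^+ 2 - sh ^+ 2 = 1)%R).

Let lt_sh : (`|sh| < ch)%R.
Proof.
rewrite -(@ltr_pXn2r _ 2) ?nnegrE// ?ltW// real_normK ?num_real//.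
by rewrite -subr_gt0 chsh.
Qed.

(** The third coordinate of a boosted null vector whose first two coordinates are fixed: [q] is the
    sum of their squares and the square root is the time coordinate. *)
Let boost1 (q t : R) := (ch * t + sh * Num.sqrt (q + t ^+ 2))%R.

Let boost1E (q t : R) : (0 < q)%R ->
  (Num.sqrt (q + boost1 q t ^+ 2) = ch * Num.sqrt (q + t ^+ 2) + sh * t)%R.
Proof.
move=> q0; set s := Num.sqrt (q + t ^+ 2)%R.
have qt0 : (0 <= q + t ^+ 2)%R by rewrite addr_ge0 ?sqr_ge0// ltW.
have s2 : (s ^+ 2 = q + t ^+ 2)%R by rewrite sqr_sqrtr.
have ts : (`|t| <= s)%R.
  rewrite -(@ler_pXn2r _ 2) ?nnegrE ?sqrtr_ge0// real_normK ?num_real// s2.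
  by rewrite lerDr ltW.
have pos : (0 <= ch * s + sh * t)%R.
  rewrite -lerBlDr sub0r (le_trans (ler_norm _))// normrN normrM.
  by rewrite ler_pM// ltW.
rewrite -[RHS]ger0_norm// -sqrtr_sqr; congr Num.sqrt.
rewrite /boost1 -/s.
transitivity (q + ch ^+ 2 * t ^+ 2 + (2 * ch * sh * s * t) + sh ^+ 2 * s ^+ 2)%R; first by ring.
transitivity ((ch ^+ 2 - sh ^+ 2) * s ^+ 2 - (ch ^+ 2 - sh ^+ 2) * t ^+ 2 + (ch ^+ 2 * t ^+ 2 + (2 * ch * sh * s * t) + sh ^+ 2 * s ^+ 2))%R; last by ring.
by rewrite chsh s2; ring.
Qed.

(** The derivative of [boost1 q] is the new time coordinate divided by the old one. Hence
    [dt / sqrt (q + t ^+ 2)], the rapidity element of a hyperbola, is preserved. *)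
Let boost1_int (q : R) (g : mR -> \bar R) : (0 < q)%R ->
  measurable_fun setT g -> (forall x, 0 <= g x) ->
  \int[mu]_t (g (boost1 q t) * ((Num.sqrt (q + t ^+ 2))^-1)%:E) =
  \int[mu]_t (g t * ((Num.sqrt (q + t ^+ 2))^-1)%:E).
Proof.
move=> q0 mg g0.
have qt0 t : (0 < q + t ^+ 2)%R by rewrite ltr_wpDr ?sqr_ge0.
have st0 t : (0 < Num.sqrt (q + t ^+ 2))%R by rewrite sqrtr_gt0.
pose F' t := (Num.sqrt (q + boost1 q t ^+ 2) / Num.sqrt (q + t ^+ 2))%R.
have F'E t : F' t = (ch + sh * (t / Num.sqrt (q + t ^+ 2)))%R.
  by rewrite /F' boost1E// mulrDl mulrA mulfK ?gt_eqF.
pose h t : \bar R := g t * ((Num.sqrt (q + t ^+ 2))^-1)%:E.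
have mh : measurable_fun setT h.
  apply: emeasurable_funM => //; apply/measurable_EFinP.
  apply: (measurableT_comp measurable_inv).
  apply: (measurableT_comp measurable_sqrt).
  by apply: measurable_funD => //; exact: exprn_measurable.
transitivity (\int[mu]_t (h (boost1 q t) * (F' t)%:E)).
  apply: eq_integral => t _; rewrite /h /F' -muleA -EFinM mulKf//.
  by rewrite gt_eqF.
have csq : continuous (fun t : R => Num.sqrt (q + t ^+ 2)).
  move=> x; apply: (@continuous_comp _ _ _ (fun t : R => q + t ^+ 2)%R); last exact: sqrt_continuous.
  by apply: cvgD; [exact: cvg_cst|exact: exprn_continuous].
(* The inverse is the boost with [- sh] in place of [sh]. *)
pose binv t := (ch * t - sh * Num.sqrt (q + t ^+ 2))%R.
have bK t : boost1 q (binv t) = t.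
  have E : (Num.sqrt (q + binv t ^+ 2) = ch * Num.sqrt (q + t ^+ 2) - sh * t)%R.
    have pos : (0 <= ch * Num.sqrt (q + t ^+ 2) - sh * t)%R.
      rewrite subr_ge0 (le_trans (ler_norm _))// normrM ler_pM ?(ltW lt_sh)//.
      rewrite -(@ler_pXn2r _ 2) ?nnegrE ?sqrtr_ge0// real_normK ?num_real//.
      by rewrite sqr_sqrtr ?(ltW (qt0 t))// lerDr ltW.
    rewrite -[RHS]ger0_norm// -sqrtr_sqr; congr Num.sqrt; rewrite /binv.
    set s := Num.sqrt _; have s2 : (s ^+ 2 = q + t ^+ 2)%R by rewrite sqr_sqrtr// ltW.
    transitivity (q + ch ^+ 2 * t ^+ 2 - (2 * ch * sh * s * t) + sh ^+ 2 * s ^+ 2)%R; first by ring.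
    transitivity ((ch ^+ 2 - sh ^+ 2) * s ^+ 2 - (ch ^+ 2 - sh ^+ 2) * t ^+ 2 + (ch ^+ 2 * t ^+ 2 - (2 * ch * sh * s * t) + sh ^+ 2 * s ^+ 2))%R; last by ring.
    by rewrite chsh s2; ring.
  rewrite /boost1 E /binv; transitivity ((ch ^+ 2 - sh ^+ 2) * t)%R; first by ring.
  by rewrite chsh mul1r.
have F'_gt0 t : (0 < F' t)%R by rewrite divr_gt0// sqrtr_gt0.
have dF (x : R) : is_derive x (1%R : R) (boost1 q) (F' x).
  rewrite F'E /boost1.
  have dsq : is_derive x (1%R : R) (fun t : R => (q + t ^+ 2)%R) (2 * x)%R.
    by apply: is_derive_eq; rewrite add0r /GRing.scale/= mulr1 mulrC; ring.
  have ds := @is_derive1_sqrt R _ (qt0 x).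
  have dc : is_derive x (1%R : R) (fun t : R => Num.sqrt (q + t ^+ 2)%R) (x / Num.sqrt (q + x ^+ 2))%R.
    rewrite (_ : (x / _ = (2 * Num.sqrt (q + x ^+ 2))^-1 * (2 * x))%R).
      exact: is_derive1_comp.
    by rewrite invfM mulrACA mulVf ?mul1r ?pnatr_eq0// mulrC.
  by apply: is_derive_eq; rewrite /GRing.scale/= mulr1.
apply: (@ge0_integral_subst _ (boost1 q) binv F' h) => //.
- move=> t; rewrite /binv boost1E// /boost1; transitivity ((ch ^+ 2 - sh ^+ 2) * t)%R; first by ring.
  by rewrite chsh mul1r.
- move=> x y xy.
  have d1 : {in `]x, y[, forall z, derivable (boost1 q) z (1%R : R)}.
    by move=> z _; case: (dF z).
  have d2 : {in `]x, y[, forall z, (0 < derive1 (boost1 q) z)%R}.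
    by move=> z _; rewrite derive1E; have [_ ->] := dF z.
  have cb : {within `[x, y], continuous (boost1 q)}.
    apply: continuous_subspaceT => z.
    by apply/differentiable_continuous/derivable1_diffP; case: (dF z).
  by apply: (gtr0_derive1_lt_cc d1 d2 cb) => //; rewrite in_itv/= lexx ltW.
- rewrite (_ : F' = (fun t => ch + sh * (t / Num.sqrt (q + t ^+ 2)))%R); last by apply/funext.
  move=> x; apply: cvgD; first exact: cvg_cst.
  apply: cvgM; first exact: cvg_cst; apply: cvgM; first exact: cvg_id.
  by apply: cvgV; [rewrite gt_eqF|exact: csq].
- by move=> t; exact: ltW.
- by move=> t; rewrite mule_ge0// lee_fin invr_ge0 ltW.
Qed.


Lemma leb3_boost f : measurable_fun setT f -> (forall x, 0 <= f x) ->
  \int[@leb3 R]_p (f (p.1.1, p.1.2, ch * p.2 + sh * enorm p)%R *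
                   ((enorm p)^-1)%:E) =
  \int[@leb3 R]_p (f p * ((enorm p)^-1)%:E).
Proof.
move=> mf f0.
have mL : measurable_fun setT
    (fun p : mR3 => (p.1.1, p.1.2, ch * p.2 + sh * enorm p)%R : mR3).
  apply: measurable_triple => //; apply: measurable_funD.
    exact: measurable_funM.
  by apply: measurable_funM => //; exact: measurable_enorm.
have mV : measurable_fun setT (fun p : mR3 => ((enorm p)^-1)%:E).
  by apply/measurable_EFinP; exact: measurable_enormV.
have V0 (p : mR3) : 0 <= ((enorm p)^-1)%:E by rewrite lee_fin invr_ge0 sqrtr_ge0.
apply: leb3_ext3.
- by apply: emeasurable_funM => //; exact: (measurableT_comp mf mL).
- by move=> x; rewrite mule_ge0.
- exact: emeasurable_funM.
- by move=> x; rewrite mule_ge0.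
move=> x y x0; pose q := (x * x + y * y)%R.
have q0 : (0 < q)%R by rewrite ltr_pwDl// -expr2 ?exprn_even_gt0// sqr_ge0.
have eE z : enorm ((x, y, z) : mR3) = Num.sqrt (q + z ^+ 2)%R.
  by rewrite /enorm /dot/= expr2.
under eq_integral do rewrite /= eE.
under [RHS]eq_integral do rewrite /= eE.
by rewrite (@boost1_int q (fun z => f (x, y, z)) q0)//; exact: measurable_section3.
Qed.

End boost.

End leb3.

(** * The Lorentz form and the orthochronous Lorentz group *)

Section lorentz_form.
Context {R : realType}.
Implicit Types (M N : 'M[R]_4) (u v : 'cV[R]_4).

Lemma sum4 (V : nmodType) (F : 'I_4 -> V) :
  \sum_i F i = F i0 + F i1 + F i2 + F i3.
Proof.
rewrite !big_ord_recr big_ord0 /= add0r.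
by do 3?[congr (_ + _)]; congr (F _); exact/val_inj.
Qed.

Lemma ord4P (P : 'I_4 -> Prop) : P i0 -> P i1 -> P i2 -> P i3 -> forall i, P i.
Proof.
move=> p0 p1 p2 p3 [[|[|[|[|//]]]] ilt].
- by rewrite (_ : Ordinal _ = i0)//; exact/val_inj.
- by rewrite (_ : Ordinal _ = i1)//; exact/val_inj.
- by rewrite (_ : Ordinal _ = i2)//; exact/val_inj.
- by rewrite (_ : Ordinal _ = i3)//; exact/val_inj.
Qed.

(** The Lorentz form with its sign reversed, so that it is positive on timelike vectors; on two
    points of the hyperboloid [H3] it is the hyperbolic cosine of their distance. *)
Definition pos u v : R :=
  u i3 0 * v i3 0 - (u i0 0 * v i0 0 + u i1 0 * v i1 0 + u i2 0 * v i2 0).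

Lemma JmE (i j : 'I_4) : (Jm : 'M[R]_4) i j =
  if i == j then (if i == i3 then -1 else 1) else 0.
Proof. by rewrite mxE. Qed.

Lemma pos_formE u v : (u^T *m Jm *m v) 0 0 = - pos u v.
Proof. by rewrite mxE sum4 !mxE !sum4 !mxE /= /pos; ring. Qed.

Lemma posC u v : pos u v = pos v u.
Proof. by rewrite /pos; ring. Qed.

Lemma posDl u u' v : pos (u + u') v = pos u v + pos u' v.
Proof. by rewrite /pos !mxE; ring. Qed.

Lemma posZl c u v : pos (c *: u) v = c * pos u v.
Proof. by rewrite /pos !mxE; ring. Qed.

Lemma posBl u u' v : pos (u - u') v = pos u v - pos u' v.
Proof. by rewrite /pos !mxE; ring. Qed.

Lemma posDr u v v' : pos u (v + v') = pos u v + pos u v'.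
Proof. by rewrite /pos !mxE; ring. Qed.

Lemma posZr c u v : pos u (c *: v) = c * pos u v.
Proof. by rewrite /pos !mxE; ring. Qed.

Lemma pos_origin v : pos origin v = v i3 0.
Proof. by rewrite /pos !mxE /=; ring. Qed.

Lemma mulmx4E M v i : (M *m v) i 0 =
  M i i0 * v i0 0 + M i i1 * v i1 0 + M i i2 * v i2 0 + M i i3 * v i3 0.
Proof. by rewrite mxE sum4. Qed.

Lemma mulmx44E M N i j : (M *m N) i j =
  M i i0 * N i0 j + M i i1 * N i1 j + M i i2 * N i2 j + M i i3 * N i3 j.
Proof. by rewrite mxE sum4. Qed.

Definition olor M := M^T *m Jm *m M = Jm /\ 0 < M i3 i3.

Lemma lorentz_olor M : lorentz M -> olor M.
Proof. by case/and3P => /eqP ? _ ?. Qed.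

Lemma Jm2 : (Jm : 'M[R]_4) *m Jm = 1%:M.
Proof.
by apply/matrixP; elim/ord4P; elim/ord4P; rewrite mulmx44E !mxE /=; ring.
Qed.

Lemma pos_olor M u v : olor M -> pos (M *m u) (M *m v) = pos u v.
Proof.
move=> [MJ _]; apply: oppr_inj; rewrite -!pos_formE trmx_mul !mulmxA.
transitivity ((u^T *m (M^T *m Jm *m M) *m v) 0 0); first by rewrite !mulmxA.
by rewrite MJ.
Qed.

Lemma olor_invE M : olor M -> Jm *m M^T *m Jm *m M = 1%:M.
Proof.
by move=> [MJ _]; rewrite -[RHS]Jm2 -[X in _ = _ *m X]MJ !mulmxA.
Qed.

Lemma olor_unit M : olor M -> M \in unitmx.
Proof. by move=> /olor_invE/mulmx1_unit[]. Qed.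

Lemma invmx_olor M : olor M -> invmx M = Jm *m M^T *m Jm.
Proof.
by move=> oM; rewrite -[RHS]mulmx1 -(mulmxV (olor_unit oM)) mulmxA olor_invE// mul1mx.
Qed.

Lemma pos_col3 M u : olor M -> pos (invmx M *m origin) u = pos origin (M *m u).
Proof.
move=> oM; rewrite -(pos_olor (M:=M))// mulmxA mulmxV ?olor_unit// mul1mx//.
Qed.

Definition timelike u := 0 < u i3 0 /\ 0 < pos u u.
Definition future u := 0 < u i3 0 /\ 0 <= pos u u.

Lemma timelike_future u : timelike u -> future u.
Proof. by move=> [? /ltW]. Qed.

(** Reversed Cauchy-Schwarz: the product of the space parts is at most the product of their norms,
    and these are bounded by the time coordinates, strictly for the timelike vector. *)
Lemma pos_gt0 u v : timelike u -> future v -> 0 < pos u v.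
Proof.
move=> [u3 uu] [v3 vv]; rewrite /pos subr_gt0.
move: uu vv; rewrite /pos subr_gt0 subr_ge0.
set a := u i0 0; set b := u i1 0; set c := u i2 0; set s := u i3 0.
set a' := v i0 0; set b' := v i1 0; set c' := v i2 0; set t := v i3 0.
move=> uu vv; rewrite (le_lt_trans (ler_norm _))//.
have st0 : 0 <= s * t by rewrite ltW// mulr_gt0.
rewrite -(@ltr_pXn2r _ 2) ?nnegrE// real_normK ?num_real//.
have st : 0 < s * s by rewrite mulr_gt0.
have tt : 0 < t * t by rewrite mulr_gt0.
apply: (@le_lt_trans _ _ ((a * a + b * b + c * c) * (a' * a' + b' * b' + c' * c'))).
  (* Lagrange's identity. *)
  rewrite -subr_ge0 [X in 0 <= X](_ : _ = (a * b' - b * a') ^+ 2 +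
    (a * c' - c * a') ^+ 2 + (b * c' - c * b') ^+ 2); last by ring.
  by rewrite !addr_ge0 ?sqr_ge0.
have n0 : 0 <= a * a + b * b + c * c by rewrite -!expr2 !addr_ge0 ?sqr_ge0.
apply: (@le_lt_trans _ _ ((a * a + b * b + c * c) * (t * t))).
  by rewrite ler_wpM2l.
by rewrite expr2 mulrACA ltr_pM2r.
Qed.

Lemma olor_invmx M : olor M -> olor (invmx M).
Proof.
move=> oM; have MV := mulmxV (olor_unit oM); split; last first.
  rewrite invmx_olor//= mulmx44E !mulmx44E !mxE /=.
  have [_ M3] := oM; lra.
have [MJ _] := oM.
rewrite -[X in _ *m X *m _]MJ !mulmxA -trmx_mul MV trmx1 mul1mx.
by rewrite -mulmxA MV mulmx1.
Qed.

Lemma timelike_col3 M : olor M -> timelike (M *m origin).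
Proof.
move=> oM; split; last by rewrite pos_olor// pos_origin mxE /= ltr01.
by rewrite mulmx4E !mxE /=; have [_] := oM; lra.
Qed.

Lemma olor_future M u : olor M -> future u -> future (M *m u).
Proof.
move=> oM fu; split; last by rewrite pos_olor//; case: fu.
rewrite -pos_origin -pos_col3//; apply: pos_gt0 => //.
exact/timelike_col3/olor_invmx.
Qed.

Lemma olor_timelike M u : olor M -> timelike u -> timelike (M *m u).
Proof.
move=> oM tu; split; last by rewrite pos_olor//; case: tu.
by have [] := olor_future oM (timelike_future tu).
Qed.

Lemma olor_mul M N : olor M -> olor N -> olor (M *m N).
Proof.
move=> oM oN; have [MJ _] := oM; have [NJ _] := oN; split.
  by rewrite trmx_mul !mulmxA -(mulmxA _ _ Jm) -(mulmxA _ _ M) MJ NJ.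
have [+ _] := olor_timelike oM (timelike_col3 oN).
rewrite mulmxA mulmx4E !mxE /=; lra.
Qed.

Lemma olor1 : olor 1%:M.
Proof. by split; [rewrite trmx1 mul1mx mulmx1|rewrite mxE /= ltr01]. Qed.

End lorentz_form.

(** * The invariant measure of the light cone *)

Section cone_action.
Context {R : realType}.
Local Notation mR := (measurableTypeR R).
Local Notation mR3 := (mR * mR * mR)%type.
Implicit Types (M N : 'M[R]_4) (v : 'cV[R]_4) (x p : (R * R * R)%type).

(** The future null vector with space part [x]: the light cone is parametrised by R^3, and [cact] is
    the Lorentz action read in this chart. *)
Definition nul x : 'cV[R]_4 := \col_i nth 0 [:: x.1.1; x.1.2; x.2; enorm x] i.

Definition spatial v : R * R * R := (v i0 0, v i1 0, v i2 0).

Definition cact M x := spatial (M *m nul x).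

Lemma enorm_ge0 x : 0 <= enorm x.
Proof. exact: sqrtr_ge0. Qed.

Lemma dot_ge0 x : 0 <= dot x x.
Proof. by rewrite /dot -!expr2 !addr_ge0 ?sqr_ge0. Qed.

Lemma sqr_enorm x : enorm x ^+ 2 = dot x x.
Proof. by rewrite sqr_sqrtr// dot_ge0. Qed.

Lemma pos_nul x : pos (nul x) (nul x) = 0.
Proof. by rewrite /pos !mxE /= -expr2 sqr_enorm /dot; ring. Qed.

Lemma nul_future x : 0 < enorm x -> future (nul x).
Proof. by move=> x0; split; rewrite ?mxE// pos_nul. Qed.

Lemma enorm_eq0 x : enorm x = 0 -> x = (0, 0, 0).
Proof.
move=> x0; have := sqr_enorm x; rewrite x0 expr0n /= /dot => /esym.
case: x x0 => [[a b] c] _ /=; rewrite -!expr2 => /eqP.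
rewrite !paddr_eq0 ?addr_ge0 ?sqr_ge0// !sqrf_eq0.
by case/andP => /andP[/eqP-> /eqP->] /eqP->.
Qed.

Lemma enorm_spatial v : 0 <= v i3 0 -> pos v v = 0 -> enorm (spatial v) = v i3 0.
Proof.
move=> v3 vv; rewrite -[RHS]ger0_norm// -sqrtr_sqr; congr Num.sqrt.
by rewrite /dot /=; move: vv; rewrite /pos; lra.
Qed.

Lemma nul_spatial v : 0 <= v i3 0 -> pos v v = 0 -> nul (spatial v) = v.
Proof.
move=> v3 vv; apply/matrixP => i j; rewrite ord1 {j}; move: i.
by elim/ord4P; rewrite mxE //=; exact: enorm_spatial.
Qed.

Lemma nul_cact M x : olor M -> nul (cact M x) = M *m nul x.
Proof.
move=> oM; apply: nul_spatial; last by rewrite pos_olor// pos_nul.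
have [x0|] := ltP 0 (enorm x).
  by rewrite ltW//; case: (olor_future oM (nul_future x0)).
move=> x0; have {}x0 : enorm x = 0 by apply/eqP; rewrite eq_le x0 enorm_ge0.
rewrite (_ : nul x = 0) ?mulmx0 ?mxE//; apply/matrixP => i j.
rewrite !mxE x0 (enorm_eq0 x0) /=.
by move: i; elim/ord4P.
Qed.

Lemma cact_mul M N x : olor N -> cact (M *m N) x = cact M (cact N x).
Proof. by move=> oN; rewrite [LHS]/cact -mulmxA -nul_cact. Qed.

Lemma cact1 x : cact 1%:M x = x.
Proof. by rewrite /cact mul1mx /spatial !mxE /=; case: x => -[]. Qed.

Lemma measurable_cact M : measurable_fun [set: mR3] (cact M : mR3 -> mR3).
Proof.
have mc (i : 'I_4) : measurable_fun [set: mR3] (fun x : mR3 => (M *m nul x) i 0).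
  rewrite (_ : (fun x => _) = (fun x : mR3 => M i i0 * x.1.1 + M i i1 * x.1.2 +
      M i i2 * x.2 + M i i3 * enorm x)); last first.
    by apply/funext => x; rewrite mulmx4E !mxE.
  have mX1 : measurable_fun setT (fun x : mR3 => x.1.1).
    exact: (measurableT_comp measurable_fst measurable_fst).
  have mX2 : measurable_fun setT (fun x : mR3 => x.1.2).
    exact: (measurableT_comp measurable_snd measurable_fst).
  have mX3 : measurable_fun setT (fun x : mR3 => x.2) by exact: measurable_snd.
  have mN := @measurable_enorm R.
  by do !apply: measurable_funD; apply: measurable_funM.
exact: measurable_triple.
Qed.

(** Invariance of [dx dy dz / enorm], the Lorentz invariant measure on the light cone. *)
Definition cone_invariant M := forall f : mR3 -> \bar R,
  measurable_fun setT f -> (forall x, 0 <= f x)%E ->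
  (\int[@leb3 R]_p (f (cact M p) * ((enorm p)^-1)%:E) =
   \int[@leb3 R]_p (f p * ((enorm p)^-1)%:E))%E.

(** Both invariances are tested on [f] composed with the action of [invmx N]. This is what allows an
    elimination by left multiplications. *)
Lemma cone_invariant_cancel N M : olor N -> olor M -> cone_invariant N ->
  cone_invariant (N *m M) -> cone_invariant M.
Proof.
move=> oN oM iN iNM f mf f0; pose F p := f (cact (invmx N) p).
have uN := olor_unit oN; have oV := olor_invmx oN.
have mF : measurable_fun setT F := measurableT_comp mf (measurable_cact (invmx N)).
have F0 p : (0 <= F p)%E by exact: f0.
have FE p : F (cact (N *m M) p) = f (cact M p).
  by rewrite /F -cact_mul ?mulmxA ?mulVmx// ?mul1mx//; exact: olor_mul.
have FE' p : F (cact N p) = f p.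
  by rewrite /F -cact_mul// mulVmx// cact1.
have e1 := iNM F mF F0; have e2 := iN F mF F0.
apply: (etrans _ (etrans e1 (etrans (esym e2) _))).
  by apply: eq_integral => p _; rewrite FE.
by apply: eq_integral => p _; rewrite FE'.
Qed.

Lemma cone_invariant_linear M (L : mR3 -> mR3) : leb3_invariant L ->
  (forall p, cact M p = L p) -> (forall p, enorm (L p) = enorm p) ->
  cone_invariant M.
Proof.
move=> [mL iL] ML eL f mf f0.
have mV : measurable_fun setT (fun p : mR3 => ((enorm p)^-1)%:E).
  by apply/measurable_EFinP; exact: measurable_enormV.
have mg : measurable_fun setT (fun p : mR3 => f p * ((enorm p)^-1)%:E)%E.
  exact: emeasurable_funM.
have g0 (p : mR3) : (0 <= f p * ((enorm p)^-1)%:E)%E.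
  by rewrite mule_ge0// lee_fin invr_ge0 enorm_ge0.
apply: (etrans _ (iL _ mg g0)).
by apply: eq_integral => p _; rewrite /= eL -ML.
Qed.

Definition mx4 (s : seq (seq R)) : 'M[R]_4 := \matrix_(i, j) nth 0 (nth [::] s i) j.

Definition rot12 (c s : R) := mx4 [:: [:: c; - s; 0; 0]; [:: s; c; 0; 0];
  [:: 0; 0; 1; 0]; [:: 0; 0; 0; 1]].
Definition rot23 (c s : R) := mx4 [:: [:: 1; 0; 0; 0]; [:: 0; c; - s; 0];
  [:: 0; s; c; 0]; [:: 0; 0; 0; 1]].
Definition boost3 (ch sh : R) := mx4 [:: [:: 1; 0; 0; 0]; [:: 0; 1; 0; 0];
  [:: 0; 0; ch; sh]; [:: 0; 0; sh; ch]].

Ltac solve_olor := split; [apply/matrixP; elim/ord4P; elim/ord4P;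
  rewrite mulmx44E !mulmx44E !mxE /=; lra | rewrite mxE /=; lra].

Lemma olor_rot12 c s : c ^+ 2 + s ^+ 2 = 1 -> olor (rot12 c s).
Proof. by move=> cs; solve_olor. Qed.

Lemma olor_rot23 c s : c ^+ 2 + s ^+ 2 = 1 -> olor (rot23 c s).
Proof. by move=> cs; solve_olor. Qed.

Lemma olor_boost3 ch sh : ch ^+ 2 - sh ^+ 2 = 1 -> 0 < ch -> olor (boost3 ch sh).
Proof. by move=> cs ch0; solve_olor. Qed.

Lemma cone_invariant_rot12 c s : c ^+ 2 + s ^+ 2 = 1 -> 0 <= c ->
  cone_invariant (rot12 c s).
Proof.
move=> cs c0; apply: (cone_invariant_linear (leb3_invariant_rot12 cs c0)) => p.
  by rewrite /cact /spatial !mulmx4E !mxE /=; congr (_, _, _); ring.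
rewrite /enorm /dot /=; congr Num.sqrt.
transitivity ((c ^+ 2 + s ^+ 2) * (p.1.1 * p.1.1 + p.1.2 * p.1.2) + p.2 * p.2); first by ring.
by rewrite cs mul1r.
Qed.

Lemma cone_invariant_rot23 c s : c ^+ 2 + s ^+ 2 = 1 -> 0 <= c ->
  cone_invariant (rot23 c s).
Proof.
move=> cs c0; apply: (cone_invariant_linear (leb3_invariant_rot23 cs c0)) => p.
  by rewrite /cact /spatial !mulmx4E !mxE /=; congr (_, _, _); ring.
rewrite /enorm /dot /=; congr Num.sqrt.
transitivity (p.1.1 * p.1.1 + (c ^+ 2 + s ^+ 2) * (p.1.2 * p.1.2 + p.2 * p.2)); first by ring.
by rewrite cs mul1r addrA.
Qed.

Lemma cone_invariant_boost3 ch sh : ch ^+ 2 - sh ^+ 2 = 1 -> 0 < ch ->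
  cone_invariant (boost3 ch sh).
Proof.
move=> cs ch0 f mf f0; have e := leb3_boost ch0 cs mf f0.
have cE p : cact (boost3 ch sh) p = (p.1.1, p.1.2, ch * p.2 + sh * enorm p).
  by rewrite /cact /spatial !mulmx4E !mxE /=; congr (_, _, _); ring.
apply: (etrans _ e).
by apply: eq_integral => p _; rewrite cE.
Qed.

(** The sign of the pair [(c, s)] is free when one entry is to be cleared; it is used to get
    [0 <= c], on which the factorisation of a rotation into shears relies. *)
Lemma givens (a b : R) : exists cs : R * R,
  [/\ cs.1 ^+ 2 + cs.2 ^+ 2 = 1, 0 <= cs.1 & cs.1 * a - cs.2 * b = 0].
Proof.
wlog b0 : a b / 0 <= b.
  move=> H; have [/H//|b0] := leP 0 b.
  have [] := H a (- b); first by rewrite oppr_ge0 ltW.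
  move=> [c s] /= [cs c0 e]; exists (c, - s) => /=; split => //; lra.
have [ab0|ab0] := eqVneq (a ^+ 2 + b ^+ 2) 0.
  exists (1, 0) => /=; split; [lra|lra|].
  by move: ab0 => /eqP; rewrite paddr_eq0 ?sqr_ge0// !sqrf_eq0 => /andP[/eqP-> /eqP->]; lra.
have abp : 0 < a ^+ 2 + b ^+ 2 by rewrite lt0r ab0 addr_ge0 ?sqr_ge0.
pose r := Num.sqrt (a ^+ 2 + b ^+ 2); have r0 : 0 < r by rewrite sqrtr_gt0.
have r2 : r ^+ 2 = a ^+ 2 + b ^+ 2 by rewrite sqr_sqrtr// ltW.
exists (b / r, a / r) => /=; split.
- by rewrite !expr_div_n -mulrDl addrC -r2 divff// expf_neq0// gt_eqF.
- by rewrite divr_ge0// ltW.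
- by rewrite -!mulrA [r^-1 * a]mulrC [r^-1 * b]mulrC; ring.
Qed.

(** Lorentz orthogonality of the columns, read from the last column backwards, kills the other
    off-diagonal entries and makes the diagonal entries [1] or [-1]. The action is then a product of
    coordinate reflections. *)
Lemma diag_cone_invariant M : olor M ->
  M i0 i3 = 0 -> M i1 i3 = 0 -> M i2 i3 = 0 ->
  M i0 i2 = 0 -> M i1 i2 = 0 -> M i0 i1 = 0 -> cone_invariant M.
Proof.
move=> oM m03 m13 m23 m02 m12 m01.
have E i j : (M^T *m Jm *m M) i j =
    M i0 i * M i0 j + M i1 i * M i1 j + M i2 i * M i2 j - M i3 i * M i3 j.
  by rewrite mulmx44E !mulmx44E !mxE /=; ring.
have [MJ m33] := oM.
have {}E i j : M i0 i * M i0 j + M i1 i * M i1 j + M i2 i * M i2 j - M i3 i * M i3 j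
   = (Jm : 'M[R]_4) i j by rewrite -MJ E.
have sq1 (a : R) : a * a = 1 -> {a = 1} + {a = -1}.
  move=> aa; case: (eqVneq a 1) => [|a1]; [by left|right].
  have : (a - 1) * (a + 1) = 0 by lra.
  by move=> /eqP; rewrite mulf_eq0 subr_eq0 (negbTE a1) /= addr_eq0 => /eqP.
have {}m33 : M i3 i3 = 1.
  have := E i3 i3; rewrite m03 m13 m23 !mxE /= => e.
  have /sq1[//|mN] : M i3 i3 * M i3 i3 = 1 by lra.
  by move: m33; rewrite mN; lra.
have m3 j : j != i3 -> M i3 j = 0.
  by move=> j3; have := E j i3; rewrite m03 m13 m23 m33 JmE (negbTE j3); lra.
have m30 : M i3 i0 = 0 by exact: m3.
have m31 : M i3 i1 = 0 by exact: m3.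
have m32 : M i3 i2 = 0 by exact: m3.
have m22 : M i2 i2 * M i2 i2 = 1.
  by have := E i2 i2; rewrite m02 m12 m32 !mxE /=; lra.
have m22N : M i2 i2 != 0 by apply: contra_eq_neq m22 => ->; rewrite mul0r eq_sym oner_eq0.
have m20 : M i2 i0 = 0.
  have := E i0 i2; rewrite m02 m12 m32 m30 !mxE /= => e; apply/eqP.
  have /eqP : M i2 i0 * M i2 i2 = 0 by lra.
  by rewrite mulf_eq0 (negbTE m22N) orbF.
have m21 : M i2 i1 = 0.
  have := E i1 i2; rewrite m02 m12 m32 m31 !mxE /= => e; apply/eqP.
  have /eqP : M i2 i1 * M i2 i2 = 0 by lra.
  by rewrite mulf_eq0 (negbTE m22N) orbF.
have m11 : M i1 i1 * M i1 i1 = 1.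
  by have := E i1 i1; rewrite m01 m21 m31 !mxE /=; lra.
have m11N : M i1 i1 != 0 by apply: contra_eq_neq m11 => ->; rewrite mul0r eq_sym oner_eq0.
have m10 : M i1 i0 = 0.
  have := E i0 i1; rewrite m01 m21 m20 m30 !mxE /= => e; apply/eqP.
  have /eqP : M i1 i0 * M i1 i1 = 0 by lra.
  by rewrite mulf_eq0 (negbTE m11N) orbF.
have m00 : M i0 i0 * M i0 i0 = 1.
  by have := E i0 i0; rewrite m10 m20 m30 !mxE /=; lra.
have cE p : cact M p = (M i0 i0 * p.1.1, M i1 i1 * p.1.2, M i2 i2 * p.2).
  rewrite /cact /spatial !mulmx4E !mxE /= m03 m13 m23 m02 m12 m01 m10 m20 m21.
  by congr (_, _, _); ring.
have iL : leb3_invariant (fun p : mR3 => (M i0 i0 * p.1.1, M i1 i1 * p.1.2, M i2 i2 * p.2) : mR3).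
  have inv1 : leb3_invariant (fun p : mR3 => (M i0 i0 * p.1.1, p.1.2, p.2) : mR3).
    have [->|->] := sq1 _ m00.
      have := @leb3_invariant_id R; congr leb3_invariant.
      by apply/funext => -[[a b] c] /=; rewrite mul1r.
    have := @leb3_invariant_opp1 R; congr leb3_invariant.
    by apply/funext => -[[a b] c] /=; rewrite mulN1r.
  have inv2 : leb3_invariant (fun p : mR3 => (p.1.1, M i1 i1 * p.1.2, p.2) : mR3).
    have [->|->] := sq1 _ m11.
      have := @leb3_invariant_id R; congr leb3_invariant.
      by apply/funext => -[[a b] c] /=; rewrite mul1r.
    have := @leb3_invariant_opp2 R; congr leb3_invariant.
    by apply/funext => -[[a b] c] /=; rewrite mulN1r.
  have inv3 : leb3_invariant (fun p : mR3 => (p.1.1, p.1.2, M i2 i2 * p.2) : mR3).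
    have [->|->] := sq1 _ m22.
      have := @leb3_invariant_id R; congr leb3_invariant.
      by apply/funext => -[[a b] c] /=; rewrite mul1r.
    have := @leb3_invariant_opp3 R; congr leb3_invariant.
    by apply/funext => -[[a b] c] /=; rewrite mulN1r.
  exact: (leb3_invariant_comp inv1 (leb3_invariant_comp inv2 inv3)).
apply: (cone_invariant_linear iL cE) => p.
rewrite /enorm /dot /=; congr Num.sqrt.
transitivity (M i0 i0 * M i0 i0 * (p.1.1 * p.1.1) +
  M i1 i1 * M i1 i1 * (p.1.2 * p.1.2) + M i2 i2 * M i2 i2 * (p.2 * p.2)); first by ring.
by rewrite m00 m11 m22 !mul1r.
Qed.


(** Elimination from the left: two rotations and a boost bring the last column to the time axis, and
    three more rotations clear the upper triangle of the space block. *)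
Theorem olor_cone_invariant M : olor M -> cone_invariant M.
Proof.
(* The predicate [P] records the zeros already created, which the next rotation has to keep. *)
have by_rot12 (P : 'M[R]_4 -> Prop) N (j : 'I_4) : olor N ->
    (forall c s, P (rot12 c s *m N)) ->
    (forall N', olor N' -> P N' -> N' i0 j = 0 -> cone_invariant N') ->
    cone_invariant N.
  move=> oN PN H; have [[c s] /= [cs c0 e]] := givens (N i0 j) (N i1 j).
  apply: (cone_invariant_cancel (olor_rot12 cs) oN (cone_invariant_rot12 cs c0)).
  apply: H => //; first exact: olor_mul (olor_rot12 cs) oN.
  by rewrite mulmx44E !mxE /=; lra.
have by_rot23 (P : 'M[R]_4 -> Prop) N (j : 'I_4) : olor N ->
    (forall c s, P (rot23 c s *m N)) ->
    (forall N', olor N' -> P N' -> N' i1 j = 0 -> cone_invariant N') ->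
    cone_invariant N.
  move=> oN PN H; have [[c s] /= [cs c0 e]] := givens (N i1 j) (N i2 j).
  apply: (cone_invariant_cancel (olor_rot23 cs) oN (cone_invariant_rot23 cs c0)).
  apply: H => //; first exact: olor_mul (olor_rot23 cs) oN.
  by rewrite mulmx44E !mxE /=; lra.
move=> oM.
apply: (by_rot12 (fun=> True) M i3) => // {oM}M oM _ m03.
apply: (by_rot23 (fun N => N i0 i3 = 0) M i3) => // [c s|{m03 oM}M oM m03 m13].
  by rewrite mulmx44E !mxE /=; lra.
have [_ m33] := oM.
have : M i0 i3 * M i0 i3 + M i1 i3 * M i1 i3 + M i2 i3 * M i2 i3 - M i3 i3 * M i3 i3 = -1.
  have [MJ _] := oM; have := congr1 (fun A : 'M[R]_4 => A i3 i3) MJ.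
  by rewrite mulmx44E !mulmx44E !mxE /=; lra.
(* The last column is now [(0, 0, q, m)] with [m ^+ 2 - q ^+ 2 = 1]; the boost with parameters [m]
   and [- q] sends it to the time axis. *)
rewrite m03 m13 => m3q; pose m := M i3 i3; pose q := M i2 i3.
have mq : m ^+ 2 - q ^+ 2 = 1 by rewrite /m /q; lra.
have cs : m ^+ 2 - (- q) ^+ 2 = 1 by lra.
apply: (cone_invariant_cancel (olor_boost3 cs m33) oM (cone_invariant_boost3 cs m33)).
pose N := boost3 m (- q) *m M.
have : N i0 i3 = 0 by rewrite mulmx44E !mxE /=; lra.
have : N i1 i3 = 0 by rewrite mulmx44E !mxE /=; lra.
have : N i2 i3 = 0 by rewrite mulmx44E !mxE /= /m /q; lra.
have oN : olor N by exact: olor_mul (olor_boost3 cs m33) oM.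
rewrite -/N; move: {M oM m03 m13 m33 m3q m q mq cs} N oN => M oM m23 m13 m03.
pose col3 N := [/\ N i0 i3 = 0, N i1 i3 = 0 & N i2 i3 = 0] : Prop.
apply: (by_rot12 col3 M i2) => // [c s|{m23 m13 m03 oM}M oM [m03 m13 m23] m02].
  by split; rewrite mulmx44E !mxE /= ?m03 ?m13 ?m23; lra.
apply: (by_rot23 (fun N => col3 N /\ N i0 i2 = 0) M i2) => //
  [c s|{m23 m13 m03 m02 oM}M oM [[m03 m13 m23] m02] m12].
  by split; [split|]; rewrite mulmx44E !mxE /= ?m03 ?m13 ?m23 ?m02; lra.
apply: (by_rot12 (fun N => col3 N /\ (N i0 i2 = 0 /\ N i1 i2 = 0)) M i1) => //
  [c s|{m23 m13 m03 m02 m12 oM}M oM [[m03 m13 m23] [m02 m12]] m01].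
  by split; split; rewrite mulmx44E !mxE /= ?m03 ?m13 ?m23 ?m02 ?m12; lra.
exact: diag_cone_invariant.
Qed.

End cone_action.

(** * A substitute for polar coordinates *)

Section radial.
Local Open Scope ereal_scope.
Context {R : realType}.
Local Notation mu := (@lebesgue_measure R).
Local Notation mR := (measurableTypeR R).
Local Notation mR3 := (mR * mR * mR)%type.

Definition leb3' : set mR3 -> \bar R := product_measure1 (@leb2 R) mu.

HB.instance Definition _ := Measure.on leb3'.

Let leb3'_sigma_finite : sigma_finite setT leb3'.
Proof.
have /sigma_finiteP[F [TF ndF Foo]] := sigma_finiteT (@leb2 R).
have /sigma_finiteP[G [TG ndG Goo]] := sigma_finiteT mu.
exists (fun n => F n `*` G n).
  rewrite -setXTT TF TG predeqE => -[x y]; split.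
    move=> [/= [n _ Fnx] [k _ Fky]]; exists (maxn n k) => //; split.
    - by move: x Fnx; exact/subsetPset/ndF/leq_maxl.
    - by move: y Fky; exact/subsetPset/ndG/leq_maxr.
  by move=> [n _ []/= ? ?]; split; exists n.
move=> k; have [? ?] := Foo k; have [? ?] := Goo k.
split; first exact: measurableX.
by rewrite /leb3' product_measure1E// lte_mul_pinfty// ge0_fin_numE.
Qed.

HB.instance Definition _ := Measure_isSigmaFinite.Build _ _ _ leb3'
  leb3'_sigma_finite.

Definition bE (b : bool) : \bar R := (b%:R)%:E.

Lemma bE_ge0 b : 0 <= bE b. Proof. by rewrite lee_fin ler0n. Qed.

Local Hint Resolve bE_ge0 : core.

Lemma bEF : bE false = 0. Proof. by []. Qed.

Lemma bET : bE true = 1. Proof. by []. Qed.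

Lemma measurable_bE d (T : measurableType d) (b : T -> bool) :
  measurable_fun setT b -> measurable_fun setT (fun x => bE (b x)).
Proof.
move=> mb; have mbE : measurable_fun [set: bool] bE by [].
exact: (measurableT_comp mbE mb).
Qed.

(** The radial weight that remains once the scale is integrated out. What matters is that it depends
    on neither [h] nor [k]. *)
Definition shell (r : R) : \bar R :=
  \int[mu]_t (bE ((0 < r) && (r <= t <= 1))%R * ((t ^+ 3)^-1)%:E).

Variables (h : mR3 -> \bar R) (k : mR3 -> R).
Hypotheses (mh : measurable_fun setT h) (h0 : forall x, 0 <= h x).
Hypotheses (mk : measurable_fun setT k) (k0 : forall x, (0 < enorm x -> 0 < k x)%R).
Hypothesis hZ : forall (s : R) x, (0 < s)%R -> h (pscale s x) = h x.
Hypothesis kZ : forall (s : R) x, (0 < s)%R -> k (pscale s x) = k x.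

Lemma enormZ (s : R) x : (0 <= s)%R -> enorm (pscale s x) = (s * enorm x)%R.
Proof.
move=> s0; rewrite /enorm (_ : dot _ _ = s ^+ 2 * dot x x)%R.
  by rewrite sqrtrM ?sqr_ge0// sqrtr_sqr ger0_norm.
by rewrite /dot/=; ring.
Qed.

Let K (p : mR3 * mR) := h p.1 *
  bE ((0 < enorm p.1) && (enorm p.1 * k p.1 <= 1) && (0 < p.2 <= k p.1))%R.

Let K' (p : mR3 * mR) := h p.1 *
  (bE ((0 < enorm p.1) && (enorm p.1 * k p.1 <= p.2 <= k p.1))%R * ((p.2 ^+ 3)^-1)%:E).

Let m1 d (T : measurableType d) (f : mR3 -> T) : measurable_fun setT f ->
  measurable_fun setT (fun p : mR3 * mR => f p.1).
Proof. by move=> mf; exact: (measurableT_comp mf measurable_fst). Qed.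

Let m2 : measurable_fun setT (fun p : mR3 * mR => p.2 : R).
Proof. exact: measurable_snd. Qed.

Let mK : measurable_fun setT K.
Proof.
apply: emeasurable_funM; first exact: (m1 mh).
apply: measurable_bE; apply: measurable_and; first apply: measurable_and.
- by apply: measurable_fun_ltr; [exact: measurable_cst|exact: (m1 (@measurable_enorm R))].
- apply: measurable_fun_ler; last exact: measurable_cst.
  by apply: measurable_funM; [exact: (m1 (@measurable_enorm R))|exact: (m1 mk)].
- apply: measurable_and.
  + by apply: measurable_fun_ltr; [exact: measurable_cst|exact: m2].
  + by apply: measurable_fun_ler; [exact: m2|exact: (m1 mk)].
Qed.

Let mK' : measurable_fun setT K'.
Proof.
apply: emeasurable_funM; first exact: (m1 mh).
apply: emeasurable_funM.
- apply: measurable_bE; apply: measurable_and.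
    by apply: measurable_fun_ltr; [exact: measurable_cst|exact: (m1 (@measurable_enorm R))].
  apply: measurable_and.
    apply: measurable_fun_ler; last exact: m2.
    by apply: measurable_funM; [exact: (m1 (@measurable_enorm R))|exact: (m1 mk)].
  by apply: measurable_fun_ler; [exact: m2|exact: (m1 mk)].
- apply/measurable_EFinP; apply: (measurableT_comp (@measurable_inv R)).
  by apply: measurable_funX; exact: m2.
Qed.

Let K0 p : 0 <= K p. Proof. by rewrite mule_ge0. Qed.

Let K'0 p : 0 <= K' p.
Proof.
rewrite mule_ge0//; case: (ltP 0 p.2)%R => p0.
  by rewrite mule_ge0// lee_fin invr_ge0 exprn_ge0// ltW.
case: (boolP (0 < enorm p.1)%R) => [e0|_]; last by rewrite /= ?bEF mul0e.
rewrite (_ : (_ <= p.2 <= _)%R = false) ?bEF ?mul0e//.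
apply/negP => /andP[+ _]; apply/negP; rewrite -ltNge (le_lt_trans p0)//.
by rewrite mulr_gt0// k0.
Qed.

(** In polar coordinates both sides are multiples, with the same constant, of the integral of
    [h * k ^- 2] over the sphere. Here a scale [s] is added instead: integrating [K] over [s] gives
    the left integrand, the dilation by [s^-1] turns [K] into [K'] for each fixed [s], and
    integrating [K'] with [s = k x * t] gives the right integrand. *)
Lemma radial_integral :
  \int[@leb3 R]_x (h x * (k x)%:E * bE ((0 < enorm x) && (enorm x * k x <= 1))%R) =
  \int[@leb3 R]_x (h x * ((k x ^+ 2)^-1)%:E * shell (enorm x)).
Proof.
have s1 x : \int[mu]_s K (x, s) =
    h x * (k x)%:E * bE ((0 < enorm x) && (enorm x * k x <= 1))%R.
  rewrite /K /=; set b := ((0 < enorm x) && (enorm x * k x <= 1))%R.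
  case: (boolP b) => [b1|b0]; last first.
    by rewrite integral0_eq ?bEF ?mule0// => s _; rewrite /= ?bEF ?mule0.
  rewrite ge0_integralZl//; last 1 first.
    apply: measurable_bE; rewrite [X in measurable_fun _ X](_ : _ =
      (fun s : mR => (0 < s) && (s <= k x))%R)//.
    by apply: measurable_and; [apply: measurable_fun_ltr|apply: measurable_fun_ler].
  rewrite bET mule1; congr (_ * _).
  have kx : (0 < k x)%R by apply: k0; case/andP : b1.
  transitivity (mu `]0%R, k x]); last by rewrite lebesgue_measure_itv/= lte_fin kx sube0.
  rewrite -[X in mu X]setIT -integral_indic//; apply: eq_integral => s _.
  by rewrite indicE mem_setE in_itv.
have s2 x : \int[mu]_s K' (x, s) =
    h x * ((k x ^+ 2)^-1)%:E * shell (enorm x).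
  rewrite /K' /= /shell.
  case: (boolP (0 < enorm x)%R) => [e0|e0]; last first.
    rewrite /= integral0_eq; last by move=> s _; rewrite ?bEF ?mul0e ?mule0.
    by rewrite integral0_eq ?mule0// => s _; rewrite ?bEF ?mul0e ?mule0.
  have kx := k0 e0.
  have mS (a b : R) : measurable_fun setT (fun s : mR => bE (true && (a <= s <= b))%R * ((s ^+ 3)^-1)%:E).
    apply: emeasurable_funM.
      apply: measurable_bE; rewrite [X in measurable_fun _ X](_ : _ =
        (fun s : mR => (a <= s) && (s <= b))%R)//.
      by apply: measurable_and; apply: measurable_fun_ler.
    apply/measurable_EFinP; apply: (measurableT_comp (@measurable_inv R)).
    by apply: measurable_funX.
  have S0 (a b s : R) : (0 < a)%R -> 0 <= bE (true && (a <= s <= b))%R * ((s ^+ 3)^-1)%:E.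
    move=> a0 /=; case: (leP a s) => [as_|_]; last by rewrite ?bEF ?mul0e ?mule0.
    by rewrite mule_ge0// lee_fin invr_ge0 exprn_ge0// (le_trans _ as_)// ltW.
  rewrite ge0_integralZl//; last by move=> s _; apply: S0; exact: mulr_gt0.
  rewrite -muleA; congr (_ * _).
  have k2 : 0 <= ((k x ^+ 2)^-1)%:E by rewrite lee_fin invr_ge0 sqr_ge0.
  rewrite -ge0_integralZl//; last by move=> s _; exact: S0.
  apply: (etrans (esym (ge0_integral_scale kx (mS _ _) _))) => [s|].
    by apply: S0; exact: mulr_gt0.
  apply: eq_integral => s _ /=.
  rewrite (_ : (enorm x * k x <= k x * s) = (enorm x <= s))%R; last by rewrite mulrC ler_pM2l.
  rewrite ger_pMr//.
  rewrite -muleA -EFinM [RHS]muleCA -EFinM.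
  congr EFin; congr (_ * _)%R.
  rewrite exprMn invfM mulrAC; congr (_ * _)%R.
  by rewrite exprS invfM mulrAC mulVf ?mul1r// gt_eqF.
have sx s : \int[leb3']_x K (x, s) = \int[leb3']_x K' (x, s).
  have mKs : measurable_fun setT (fun x : mR3 => K (x, s)).
    by apply: (measurableT_comp mK); exact: measurable_fun_pair.
  have [s0|s0] := ltP 0%R s; last first.
    rewrite !integral0_eq// => x _; rewrite /K /K'/=.
      case: (boolP (0 < enorm x)%R) => [e0|_]; last by rewrite /= ?bEF ?mul0e ?mule0.
      rewrite (_ : (_ <= s <= _)%R = false) ?bEF ?mul0e ?mule0//.
      apply/negP => /andP[+ _]; apply/negP; rewrite -ltNge (le_lt_trans s0)//.
      by rewrite mulr_gt0// k0.
    by rewrite (ltNge 0%R s) s0 /= andbF ?bEF ?mule0 ?mul0e.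
  have sV : (0 < s^-1)%R by rewrite invr_gt0.
  have s3 : 0 <= ((s^-1 ^+ 3)%:E) by rewrite lee_fin exprn_ge0// ltW.
  have mL : measurable_fun setT (fun p : mR3 => pscale s^-1 p : mR3).
    have mX1 : measurable_fun setT (fun x : mR3 => x.1.1 : R).
      exact: (measurableT_comp measurable_fst measurable_fst).
    have mX2 : measurable_fun setT (fun x : mR3 => x.1.2 : R).
      exact: (measurableT_comp measurable_snd measurable_fst).
    by apply: measurable_triple => //; exact: measurable_funM.
  apply: (etrans (esym (leb3_scale sV mKs (fun x => K0 _)))).
  apply: (etrans (esym (ge0_integralZr _ measurableT (measurableT_comp mKs mL) (fun x _ => K0 _) s3))).
  apply: eq_integral => x _; rewrite /K /K'/= hZ// kZ// enormZ ?(ltW sV)//.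
  rewrite -muleA; congr (_ * _); rewrite exprVn; congr (_ * _); congr bE.
  rewrite pmulr_rgt0// s0 /= -andbA; congr andb; congr andb.
  by rewrite -mulrA mulrC ler_pdivrMr// mul1r.
have e1 := @fubini_tonelli _ _ _ _ _ leb3' mu K mK K0.
have e2 := @fubini_tonelli _ _ _ _ _ leb3' mu K' mK' K'0.
apply: (etrans (y := \int[leb3']_x \int[mu]_s K (x, s))).
  by apply: eq_integral => x _; rewrite s1.
apply: (etrans e1).
apply: (etrans (y := \int[leb3']_x \int[mu]_s K' (x, s))); last first.
  by apply: eq_integral => x _; rewrite s2.
apply: (etrans _ (esym e2)).
by apply: eq_integral => s _; exact: sx.
Qed.

End radial.

(** * The boundary action and its change of variables *)

Section sphere.
Context {R : realType}.
Local Notation mR := (measurableTypeR R).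
Local Notation mR3 := (mR * mR * mR)%type.
Local Notation R3 := (R * R * R)%type.
Implicit Types (M N : 'M[R]_4) (x p : (R * R * R)%type).

Definition unit3 x : R3 := pscale (enorm x)^-1 x.
(** The factor by which [M] stretches the null vector [vec1 x], so that [M *m vec1 x] is [kap M x]
    times [vec1 (bd M x)]. It is a multiplicative cocycle, and its inverse is the conformal factor
    of [M] on the round sphere. *)
Definition kap M x : R := (M *m vec1 x) i3 0.

Lemma unit3Z (s : R) x : 0 < s -> unit3 (pscale s x) = unit3 x.
Proof.
move=> s0; rewrite /unit3 enormZ ?ltW// /pscale /= invfM.
rewrite ![s^-1 * _]mulrC -!mulrA ![s^-1 * (s * _)]mulrA mulVf ?gt_eqF//.
by rewrite !mul1r.
Qed.

Lemma S2_enorm x : S2 x -> enorm x = 1.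
Proof. by rewrite /S2 /= /enorm => ->; rewrite sqrtr1. Qed.

Lemma enorm_S2 x : enorm x = 1 -> S2 x.
Proof. by move=> x1; rewrite /S2 /= -sqr_enorm x1 expr1n. Qed.

Lemma unit3_S2 x : 0 < enorm x -> S2 (unit3 x).
Proof.
by move=> x0; apply: enorm_S2; rewrite enormZ ?invr_ge0 ?ltW// mulVf ?gt_eqF.
Qed.

Lemma vec1_nul x : S2 x -> vec1 x = nul x.
Proof.
by move=> /S2_enorm x1; apply/matrixP => i j; rewrite !mxE x1.
Qed.

Lemma pos_vec1 x : S2 x -> pos (vec1 x) (vec1 x) = 0.
Proof. by move=> x1; rewrite vec1_nul// pos_nul. Qed.

Lemma vec1_future x : S2 x -> future (vec1 x).
Proof. by move=> x1; rewrite vec1_nul//; apply: nul_future; rewrite S2_enorm. Qed.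

Lemma kap_gt0 M x : olor M -> S2 x -> 0 < kap M x.
Proof. by move=> oM /vec1_future/(olor_future oM)[]. Qed.

Lemma vec1_bd M x : kap M x != 0 -> kap M x *: vec1 (bd M x) = M *m vec1 x.
Proof.
move=> k0; apply/matrixP => i j; rewrite ord1 mxE [X in _ * X]mxE.
by move: i; elim/ord4P => /=; rewrite /kap ?mulr1// mulrC mulfVK.
Qed.

Lemma bd_S2 M x : olor M -> S2 x -> S2 (bd M x).
Proof.
move=> oM x1; have k0 := kap_gt0 oM x1.
have := pos_olor (vec1 x) (vec1 x) oM; rewrite -vec1_bd ?gt_eqF//.
rewrite posZl posZr (pos_vec1 x1) => /eqP.
rewrite !mulf_eq0 gt_eqF//=; move: (bd M x) => y /eqP.
by rewrite /pos !mxE /S2 /= /dot; lra.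
Qed.

Lemma vec1_inj : injective (@vec1 R).
Proof.
move=> [[a b] c] [[a' b'] c'] e.
have E (i : 'I_4) : vec1 (a, b, c) i 0 = vec1 (a', b', c') i 0 by rewrite e.
by have := E i0; have := E i1; have := E i2; rewrite !mxE /= => -> -> ->.
Qed.

Lemma kap_mul M N x : olor N -> S2 x -> kap (M *m N) x = kap N x * kap M (bd N x).
Proof.
move=> oN x1; have k0 := kap_gt0 oN x1.
by rewrite {1}/kap -mulmxA -(vec1_bd (M := N)) ?gt_eqF// -scalemxAr mxE.
Qed.

Lemma bd_mul M N x : olor M -> olor N -> S2 x -> bd (M *m N) x = bd M (bd N x).
Proof.
move=> oM oN x1; apply: vec1_inj; have k0 := kap_gt0 oN x1.
have k1 := kap_gt0 (olor_mul oM oN) x1; have k2 := kap_gt0 oM (bd_S2 oN x1).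
apply: (scalerI (lt0r_neq0 k1)); rewrite vec1_bd ?gt_eqF// kap_mul//.
by rewrite -scalerA vec1_bd ?gt_eqF// scalemxAr vec1_bd ?gt_eqF// mulmxA.
Qed.

Lemma nul_unit3 x : 0 < enorm x -> nul x = enorm x *: vec1 (unit3 x).
Proof.
move=> x0; apply/matrixP => i j; rewrite mxE mxE [X in _ * X]mxE /unit3.
by move: i; elim/ord4P => /=; rewrite ?mulr1// mulVKf// gt_eqF.
Qed.

Lemma enorm_cact M x : olor M -> 0 < enorm x ->
  enorm (cact M x) = enorm x * kap M (unit3 x).
Proof.
move=> oM x0; transitivity (nul (cact M x) i3 0); first by rewrite mxE.
by rewrite nul_cact// nul_unit3// -scalemxAr mxE.
Qed.

Lemma spatialZ (c : R) (v : 'cV[R]_4) : spatial (c *: v) = pscale c (spatial v).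
Proof. by rewrite /spatial /pscale /= !mxE. Qed.

Lemma unit3_cact M x : olor M -> 0 < enorm x ->
  unit3 (cact M x) = bd M (unit3 x).
Proof.
move=> oM x0; rewrite {1}/unit3 enorm_cact// /cact nul_unit3// -scalemxAr.
rewrite spatialZ /bd /kap; move: (M *m _) => v.
rewrite /kproj /pscale /spatial /= invfM.
by congr (_, _, _); rewrite mulrACA mulVf ?gt_eqF// mul1r mulrC.
Qed.

Lemma enorm0 : enorm (0, 0, 0) = 0 :> R.
Proof. by rewrite /enorm /dot /= !mul0r !addr0 sqrtr0. Qed.

Let mX1 : measurable_fun [set: mR3] (fun x : mR3 => x.1.1 : R).
Proof. exact: (measurableT_comp measurable_fst measurable_fst). Qed.
Let mX2 : measurable_fun [set: mR3] (fun x : mR3 => x.1.2 : R).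
Proof. exact: (measurableT_comp measurable_snd measurable_fst). Qed.
Let mX3 : measurable_fun [set: mR3] (fun x : mR3 => x.2 : R).
Proof. exact: measurable_snd. Qed.

Lemma measurable_unit3 : measurable_fun [set: mR3] (unit3 : mR3 -> mR3).
Proof.
have mV := @measurable_enormV R.
by apply: measurable_triple; exact: measurable_funM.
Qed.

Lemma measurable_mulmx_vec1 M i :
  measurable_fun [set: mR3] (fun x : mR3 => (M *m vec1 x) i 0).
Proof.
rewrite (_ : (fun x => _) = (fun x : mR3 => M i i0 * x.1.1 + M i i1 * x.1.2 +
      M i i2 * x.2 + M i i3 * 1)); last first.
  by apply/funext => x; rewrite mulmx4E !mxE.
by do !apply: measurable_funD => //; apply: measurable_funM.
Qed.

Lemma measurable_kap M : measurable_fun [set: mR3] (kap M : mR3 -> R).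
Proof. exact: measurable_mulmx_vec1. Qed.

Lemma measurable_bd M : measurable_fun [set: mR3] (bd M : mR3 -> mR3).
Proof.
have mV : measurable_fun [set: mR3] (fun x : mR3 => ((M *m vec1 x) i3 0)^-1).
  exact: (measurableT_comp (@measurable_inv R) (measurable_mulmx_vec1 M i3)).
apply: measurable_triple; apply: measurable_funM => //;
  exact: measurable_mulmx_vec1.
Qed.

Local Notation inB x := (@bE R ((0 < enorm x) && (enorm x <= 1))).

(** The light cone action pulls the unit ball back to the region [enorm x * k x <= 1].
    [radial_integral], used once with [k] and once with [1], exchanges this region for the ball at
    the price of [k ^- 2], and the two shell weights cancel. *)
Lemma ball_change_of_variables M (F : mR3 -> \bar R) : olor M ->
  measurable_fun setT F -> (forall x, 0 <= F x)%E ->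
  (\int[@leb3 R]_x (F (bd M (unit3 x)) * ((kap M (unit3 x) ^+ 2)^-1)%:E * inB x) =
   \int[@leb3 R]_x (F (unit3 x) * inB x))%E.
Proof.
move=> oM mF F0.
(* The factor [enorm y] compensates the weight [(enorm p)^-1] of the invariant measure. *)
pose f (y : mR3) := (F (unit3 y) * (enorm y)%:E * inB y)%E.
have mB : measurable_fun setT (fun x : mR3 => inB x).
  apply: (@measurable_bE R _ _ (fun x : mR3 => (0 < enorm x) && (enorm x <= 1))).
  apply: measurable_and.
    by apply: measurable_fun_ltr; [exact: measurable_cst|exact: (@measurable_enorm R)].
  by apply: measurable_fun_ler; [exact: (@measurable_enorm R)|exact: measurable_cst].
have mf : measurable_fun setT f.
  apply: emeasurable_funM => //; apply: emeasurable_funM.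
    exact: (measurableT_comp mF measurable_unit3).
  by apply/measurable_EFinP; exact: measurable_enorm.
have f0 y : (0 <= f y)%E by rewrite !mule_ge0// ?lee_fin ?enorm_ge0// bE_ge0.
have e1 := olor_cone_invariant oM mf f0.
pose h (x : mR3) := F (bd M (unit3 x)); pose k (x : mR3) := kap M (unit3 x).
have mh : measurable_fun setT h.
  exact: (measurableT_comp mF (measurableT_comp (measurable_bd M) measurable_unit3)).
have h0 x : (0 <= h x)%E by exact: F0.
have mk : measurable_fun setT k := measurableT_comp (measurable_kap M) measurable_unit3.
have k0 x : 0 < enorm x -> 0 < k x by move=> x0; exact/kap_gt0/unit3_S2.
have hZ (s : R) x : 0 < s -> h (pscale s x) = h x by move=> s0; rewrite /h unit3Z.
have kZ (s : R) x : 0 < s -> k (pscale s x) = k x by move=> s0; rewrite /k unit3Z.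
have e2 := radial_integral mh h0 mk k0 hZ kZ.
pose h' (x : mR3) := (h x * ((k x ^+ 2)^-1)%:E)%E.
have mh' : measurable_fun setT h'.
  apply: emeasurable_funM => //; apply/measurable_EFinP.
  by apply: (measurableT_comp (@measurable_inv R)); exact: measurable_funX.
have h'0 x : (0 <= h' x)%E by rewrite mule_ge0// lee_fin invr_ge0 sqr_ge0.
have h'Z (s : R) x : 0 < s -> h' (pscale s x) = h' x by move=> s0; rewrite /h' hZ// kZ.
have e3 := @radial_integral R h' (cst 1) mh' h'0 (measurable_cst _)
  (fun _ _ => ltr01) h'Z (fun _ _ _ => erefl).
apply: (etrans _ (etrans e3 (etrans _ (etrans (esym e2) (etrans _ (etrans e1 _)))))).
- by apply: eq_integral => x _; rewrite /= mule1 mulr1.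
- by apply: eq_integral => x _; rewrite /= expr1n invr1 mule1.
- apply: eq_integral => x _; rewrite /f; case: (ltP 0 (enorm x)) => x0 /=.
    rewrite (unit3_cact oM x0) (enorm_cact oM x0) -/(k x) -/(h x).
    rewrite (pmulr_rgt0 _ x0) (k0 x x0) /=.
    rewrite [RHS]muleAC -[in RHS](muleA (h x)) -EFinM.
    by rewrite (mulrAC (enorm x)) divff ?gt_eqF// mul1r.
  have x00 : enorm x = 0 by apply/eqP; rewrite eq_le x0 enorm_ge0.
  by rewrite x00 invr0 bEF !mule0.
- apply: eq_integral => x _; rewrite /f; case: (ltP 0 (enorm x)) => x0 /=.
    rewrite [LHS]muleAC -[in LHS](muleA (F (unit3 x))) -EFinM.
    by rewrite divff ?gt_eqF// mule1.
  by rewrite bEF !mule0 mul0e.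
Qed.


Definition ball_vol : R := fine (leb3 [set x : R3 | enorm x <= 1]).

Lemma measurable_enorm_le (r : R) : measurable ([set x | enorm x <= r] : set mR3).
Proof.
have := @measurable_enorm R measurableT `]-oo, r]%classic (measurable_itv _).
by rewrite setTI set_interval.set_itvNyc.
Qed.

Let itv1 : @lebesgue_measure R `[(-1), 1] = 2%:E.
Proof.
rewrite lebesgue_measure_itv/= lte_fin -EFinD.
by case: ifPn => [_|/negP[]]; [congr EFin|]; lra.
Qed.

Let itv2 : @lebesgue_measure R `[(- 2^-1), 2^-1] = 1%:E.
Proof.
rewrite lebesgue_measure_itv/= lte_fin -EFinD.
by case: ifPn => [_|/negP[]]; [congr EFin|]; lra.
Qed.

Lemma leb3_cube (A : set R) : measurable A ->
  leb3 (A `*` A `*` A) =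
  (@lebesgue_measure R A * @lebesgue_measure R A * @lebesgue_measure R A)%E.
Proof.
move=> mA; have mAA : measurable (A `*` A : set (mR * mR)) by exact: measurableX.
apply: (etrans (product_measure1E (@leb2 R) (@lebesgue_measure R) mAA mA)).
by congr (_ * _)%E; exact: (product_measure1E (@lebesgue_measure R) (@lebesgue_measure R) mA mA).
Qed.

(** The ball lies between cubes of volumes 1 and 8. The upper bound matters as much as the lower
    one, since [fine] sends an infinite volume to [0]. *)
Lemma ball_vol_gt0 : 0 < ball_vol.
Proof.
have mB := measurable_enorm_le 1.
have le8 : (leb3 [set x : R3 | (enorm x <= 1)%R] <= 8%:E)%E.
  apply: (@le_trans _ _ (leb3 (`[(-1), 1]%classic `*` `[(-1), 1]%classic `*` `[(-1), 1]%classic))).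
    apply: le_measure; rewrite ?inE//.
      by apply: measurableX => //; exact: measurableX.
    move=> [[a b] c] /= abc.
    have : dot (a, b, c) (a, b, c) <= 1.
      by rewrite -sqr_enorm expr_le1// enorm_ge0.
    rewrite /dot/= => abc1; have [a2 [b2 c2]] := (sqr_ge0 a, (sqr_ge0 b, sqr_ge0 c)).
    rewrite !expr2 in a2 b2 c2.
    by split; first split; rewrite /= in_itv/= -ler_norml -(@expr_le1 _ 2)//
      real_normK ?num_real// expr2; lra.
  by rewrite leb3_cube// itv1 -!EFinM lee_fin; lra.
have ge1 : (1%:E <= leb3 [set x : R3 | (enorm x <= 1)%R])%E.
  apply: (@le_trans _ _ (leb3 (`[(- 2^-1), 2^-1]%classic `*` `[(- 2^-1), 2^-1]%classic `*` `[(- 2^-1), 2^-1]%classic))).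
    by rewrite leb3_cube// itv2 !mule1.
  apply: le_measure; rewrite ?inE//.
    by apply: measurableX => //; exact: measurableX.
  move=> [[a b] c] /= [[/=]]; rewrite !in_itv/= => a1 b1 c1.
  rewrite -(@expr_le1 _ 2)// ?enorm_ge0// sqr_enorm /dot/=.
  have half (t : R) : - 2^-1 <= t <= 2^-1 -> t * t <= 4^-1 by move=> ?; nra.
  by have := half _ a1; have := half _ b1; have := half _ c1; lra.
have fin : leb3 [set x : R3 | enorm x <= 1] \is a fin_num.
  by rewrite ge0_fin_numE// (le_lt_trans le8)// ltry.
rewrite /ball_vol fine_gt0// (lt_le_trans _ ge1) ?lte_fin//=.
by rewrite (le_lt_trans le8)// ltry.
Qed.

End sphere.
Arguments ball_vol R : clear implicits.

(** * Area as a measure on R^3 concentrated on the sphere *)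

Section sphere_measure.
Context {R : realType}.
Local Notation mR := (measurableTypeR R).
Local Notation mR3 := (mR * mR * mR)%type.
Local Notation R3 := (R * R * R)%type.
Implicit Types (M N : 'M[R]_4).

Definition ball_density (x : mR3) : R :=
  (ball_vol R)^-1 * ((0 < enorm x) && (enorm x <= 1))%:R.

Lemma ball_density_ge0 x : 0 <= ball_density x.
Proof. by rewrite mulr_ge0// invr_ge0 ltW// ball_vol_gt0. Qed.

(** The origin is left out because [unit3] fixes it, and it does not lie on the sphere. *)
Definition punctured_ball : set mR3 := [set x | (0 < enorm x) && (enorm x <= 1)].

Lemma measurable_punctured_ball : measurable punctured_ball.
Proof.
have := @measurable_enorm R measurableT `]0, 1]%classic (measurable_itv _).
by rewrite setTI; congr measurable; apply/seteqP; split=> x /=; rewrite in_itv.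
Qed.

Lemma ball_densityE x : ball_density x = (ball_vol R)^-1 * \1_punctured_ball x.
Proof. by rewrite /ball_density indicE; congr (_ * _%:R); congr nat_of_bool; rewrite /punctured_ball; apply/idP/idP; rewrite inE. Qed.

Lemma measurable_ball_density : measurable_fun [set: mR3] ball_density.
Proof.
rewrite (_ : ball_density = (fun x => (ball_vol R)^-1 * \1_punctured_ball x)); last first.
  by apply/funext => x; rewrite ball_densityE.
by apply: measurable_funM => //; apply: measurable_indic; exact: measurable_punctured_ball.
Qed.

Definition ball_measure : {measure set mR3 -> \bar R} :=
  density (@leb3 R) measurable_ball_density ball_density_ge0.

Lemma measurable_unit3R : measurable_fun [set: mR3] (unit3 : mR3 -> R3).
Proof. exact: measurable_unit3. Qed.

(** Radial projection of the uniform probability on the ball; it agrees with [sigma0] on measurable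
    sets and supplies the measure structure. *)
Definition sph : {measure set R3 -> \bar R} :=
  measure_function_pushforward__canonical__measure_function_Measure ball_measure
    measurable_unit3R.

Lemma sph_integral (F : R3 -> \bar R) : measurable_fun setT F ->
  (forall x, 0 <= F x)%E ->
  (\int[sph]_x F x = \int[@leb3 R]_x (F (unit3 x) * (ball_density x)%:E))%E.
Proof.
move=> mF F0.
apply: (etrans (ge0_integral_pushforward measurable_unit3R ball_measure measurableT mF _)) => //.
have mFu : measurable_fun [set: mR3] (F \o unit3) := measurableT_comp mF measurable_unit3R.
exact: (ge0_integral_density (@leb3 R) measurable_ball_density ball_density_ge0 mFu (fun x => F0 _)).
Qed.

Lemma sph_setE (E : set R3) : measurable E ->
  sph E = ((ball_vol R)^-1%:E * leb3 (unit3 @^-1` E `&` punctured_ball))%E.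
Proof.
move=> mE; have mU : measurable (unit3 @^-1` E : set mR3).
  by have := measurable_unit3R measurableT mE; rewrite setTI.
apply: (etrans (y := (\int[@leb3 R]_(x in unit3 @^-1` E)
   ((ball_vol R)^-1%:E * (\1_punctured_ball x)%:E))%E)).
  by apply: eq_integral => x _; rewrite ball_densityE EFinM.
have c0 : (0 <= (ball_vol R)^-1%:E)%E by rewrite lee_fin invr_ge0 ltW// ball_vol_gt0.
have mI : measurable_fun (unit3 @^-1` E) (fun x : mR3 => (\1_punctured_ball x : R)%:E).
  by apply/measurable_EFinP; apply: measurable_indic; exact: measurable_punctured_ball.
apply: (etrans (ge0_integralZl (@leb3 R) mU mI _ c0)); first by move=> x _; rewrite lee_fin.
by congr (_ * _)%E; rewrite setIC; exact: (integral_indic (@leb3 R) mU measurable_punctured_ball).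
Qed.

Lemma sigma0E (E : set R3) : measurable E -> sigma0 E = sph E.
Proof.
move=> mE; rewrite sph_setE// muleC; congr (leb3 _ * _)%E.
by apply/seteqP; split => x; rewrite /cone /punctured_ball /=; case.
Qed.

Lemma sph_setT : sph setT = 1%E.
Proof.
rewrite sph_setE// preimage_setT setTI.
pose ball : set mR3 := [set x | enorm x <= 1].
have mB : measurable ball := measurable_enorm_le 1.
pose zero : set mR3 := [set 0] `*` [set 0] `*` [set 0].
have m0 : measurable zero by apply: measurableX => //; exact: measurableX.
have z0 : leb3 zero = 0%E.
  by rewrite leb3_cube// lebesgue_measure_set1 !mule0.
have -> : punctured_ball = ball `\` zero.
  apply/seteqP; split => x; rewrite /punctured_ball /ball /zero /=.
    move=> /andP[x0 x1]; split=> // -[[e1 e2] e3].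
    move: x0; rewrite (_ : x = (0, 0, 0)) ?enorm0 ?ltxx//.
    by case: x e1 e2 e3 {x1} => -[a b] c /= -> -> ->.
  move=> [x1 xz]; rewrite x1 andbT lt0r enorm_ge0 andbT; apply/eqP => /enorm_eq0 e.
  by apply: xz; rewrite e.
have fin : leb3 ball \is a fin_num.
  have := @ball_vol_gt0 R; rewrite /ball_vol -/ball.
  case: (leb3 ball) => //=; rewrite ltxx//.
have le : (leb3 (ball `\` zero) = leb3 ball).
  have sub : (leb3 ball <= leb3 (ball `\` zero) + leb3 zero)%E.
    apply: (le_trans _ (measureU2 (@leb3 R) _ m0)); last exact: measurableD.
    apply: le_measure; rewrite ?inE//; first by apply: measurableU => //; exact: measurableD.
    by move=> x bx; have [zx|zx] := pselect (zero x); [right|left].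
  apply/eqP; rewrite eq_le; apply/andP; split.
    by apply: le_measure; rewrite ?inE; [exact: measurableD|exact: mB|exact: subDsetl].
  by rewrite z0 adde0 in sub.
have v0 : ball_vol R != 0 by rewrite gt_eqF// ball_vol_gt0.
by rewrite le -(fineK fin) -EFinM -/(ball_vol R) mulVf.
Qed.

Lemma measurable_S2 : measurable (S2 : set R3).
Proof.
have m1 : measurable_fun [set: mR3] (fun x : mR3 => enorm x) := @measurable_enorm R.
have := m1 measurableT [set 1] (measurable_set1 _); rewrite setTI.
congr (@measurable _ mR3 _); apply/seteqP; split=> x /=; first exact: enorm_S2.
exact: S2_enorm.
Qed.

Lemma sph_S2C : sph (~` S2) = 0%E.
Proof.
rewrite sph_setE; last by apply: measurableC; exact: measurable_S2.
have -> : unit3 @^-1` (~` S2) `&` punctured_ball = set0.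
  by apply/seteqP; split=> x //= -[xS /andP[x0 _]]; apply: xS; exact: unit3_S2.
rewrite -[RHS](mule0 (ball_vol R)^-1%:E); congr (_ * _)%E.
exact: (@measure0 _ _ _ (@leb3 R)).
Qed.

Lemma sph_change_of_variables M (F : R3 -> \bar R) : olor M ->
  measurable_fun setT F -> (forall x, 0 <= F x)%E ->
  (\int[sph]_x (F (bd M x) * ((kap M x ^+ 2)^-1)%:E) = \int[sph]_x F x)%E.
Proof.
move=> oM mF F0.
have mG : measurable_fun [set: R3] (fun x : R3 => F (bd M x) * ((kap M x ^+ 2)^-1)%:E)%E.
  apply: emeasurable_funM; first exact: (measurableT_comp mF (measurable_bd M)).
  apply/measurable_EFinP; apply: (measurableT_comp (@measurable_inv R)).
  by apply: measurable_funX; exact: measurable_kap.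
have G0 x : (0 <= F (bd M x) * ((kap M x ^+ 2)^-1)%:E)%E.
  by rewrite mule_ge0// lee_fin invr_ge0 sqr_ge0.
have c0 : (0 <= (ball_vol R)^-1%:E)%E by rewrite lee_fin invr_ge0 ltW// ball_vol_gt0.
have key (H : R3 -> \bar R) : measurable_fun setT H -> (forall x, 0 <= H x)%E ->
    (\int[sph]_x H x = (ball_vol R)^-1%:E *
      \int[@leb3 R]_x (H (unit3 x) * @bE R ((0 < enorm x) && (enorm x <= 1))%R))%E.
  move=> mH H0; apply: (etrans (sph_integral mH H0)).
  have mI : measurable_fun [set: mR3] (fun x : mR3 => H (unit3 x) * @bE R ((0 < enorm x) && (enorm x <= 1))%R)%E.
    apply: emeasurable_funM; first exact: (measurableT_comp mH measurable_unit3R).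
    apply: (@measurable_bE R _ _ (fun x : mR3 => (0 < enorm x) && (enorm x <= 1))).
    apply: measurable_and.
      by apply: measurable_fun_ltr; [exact: measurable_cst|exact: (@measurable_enorm R)].
    by apply: measurable_fun_ler; [exact: (@measurable_enorm R)|exact: measurable_cst].
  apply: (etrans _ (ge0_integralZl (@leb3 R) measurableT mI _ c0)); last first.
    by move=> x _; rewrite mule_ge0// bE_ge0.
  by apply: eq_integral => x _; rewrite /ball_density EFinM [RHS]muleCA.
rewrite (key _ mG G0) (key _ mF F0); congr (_ * _)%E.
exact: (ball_change_of_variables oM mF F0).
Qed.

End sphere_measure.

(** * Reduced words, cylinders and the sets [Sset] *)

Section words.
Implicit Types (a b l : letter) (u v w g p : seq letter).

(** Left multiplication by a letter, on reduced words: one step of [freered]. *)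
Definition cred a w := if w is b :: t then if b == linv a then t else a :: b :: t
  else [:: a].

Lemma cred_cat a u v : u != [::] -> cred a (u ++ v) = cred a u ++ v.
Proof. by case: u => // b t _; rewrite cat_cons /cred; case: ifP. Qed.

Lemma freered_cons a w : freered (a :: w) = cred a (freered w).
Proof. by []. Qed.

Lemma linvK : involutive linv.
Proof. by case=> x y; rewrite /linv /= negbK. Qed.

Lemma reduced_cons a b w : reduced (a :: b :: w) = (b != linv a) && reduced (b :: w).
Proof. by []. Qed.

Lemma reduced_cred a w : reduced w -> reduced (cred a w).
Proof.
case: w => [//|b t]; rewrite /cred; case: eqP => [_|/eqP ba].
  by case: t => // c t /andP[].
by rewrite reduced_cons ba.
Qed.

Lemma freered_reduced w : reduced (freered w).
Proof. by elim: w => // a w IH; rewrite freered_cons reduced_cred. Qed.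

Lemma freered_id w : reduced w -> freered w = w.
Proof.
elim: w => // a w IH aw; rewrite freered_cons IH; last first.
  by case: w aw {IH} => // b w; rewrite reduced_cons => /andP[].
by case: w aw {IH} => // b w; rewrite reduced_cons /cred => /andP[/negbTE->].
Qed.

Lemma cred_linv a w : reduced w -> cred (linv a) (cred a w) = w.
Proof.
case: w => [|b t]; first by rewrite /= linvK eqxx.
rewrite [cred a _]/cred; case: eqP => [->|/eqP ba] red; last by rewrite /= linvK eqxx.
case: t red => [//|c t]; rewrite reduced_cons linvK /cred => /andP[/negbTE ca _].
by rewrite linvK ca.
Qed.

Lemma freered_catr u v : freered (u ++ freered v) = freered (u ++ v).
Proof.
elim: u => [|a u IH]; first by rewrite !cat0s freered_id// freered_reduced.
by rewrite !cat_cons !freered_cons IH.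
Qed.

Lemma freered_catl u v : freered (freered u ++ v) = freered (u ++ v).
Proof.
elim: u => [//|a u IH]; rewrite cat_cons !freered_cons -IH.
case: (freered u) => [//|b t]; rewrite [cred a (b :: t)]/cred.
case: eqP => [ba|//]; rewrite cat_cons freered_cons ba.
by rewrite -[X in cred X]linvK cred_linv// freered_reduced.
Qed.

Definition winv u := rev (map linv u).

Lemma winvK : involutive winv.
Proof.
by move=> u; rewrite /winv map_rev revK -map_comp map_id_in// => a _ /=; exact: linvK.
Qed.

Lemma freered_winv u v : freered (winv u ++ (u ++ v)) = freered v.
Proof.
elim: u v => [//|a u IH] v; rewrite /winv /= rev_cons cat_rcons -/(winv u).
rewrite -freered_catr freered_cons freered_cons cred_linv ?freered_reduced//.
by rewrite freered_catr IH.
Qed.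

Lemma freered_winvK g w : reduced w -> freered (winv g ++ freered (g ++ w)) = w.
Proof. by move=> rw; rewrite freered_catr freered_winv freered_id. Qed.

Lemma freered_winvKr g w : reduced w -> freered (g ++ freered (winv g ++ w)) = w.
Proof. by move=> rw; rewrite -{1}(winvK g) freered_winvK. Qed.

Lemma size_cred a w : (size w <= (size (cred a w)).+1)%N /\ (size (cred a w) <= (size w).+1)%N.
Proof.
by case: w => [//|b t]; rewrite /cred; case: eqP => _ /=; split; rewrite ?leqnn// (leqW (leqnSn _)).
Qed.

Lemma size_freered w : (size (freered w) <= size w)%N.
Proof.
elim: w => // a w IH; rewrite freered_cons.
by apply: leq_trans (size_cred a (freered w)).2 _.
Qed.

Lemma size_freered_cat g p : reduced p -> (size p <= size (freered (g ++ p)) + size g)%N.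
Proof.
move=> rp; elim: g => [|a g IH]; first by rewrite addn0 freered_id.
rewrite cat_cons freered_cons (leq_trans IH)// /= addnS -addSn leq_add2r.
exact: (size_cred _ _).1.
Qed.

(** Each letter of [g] cancels at most one letter, so the last letter [l] survives unless the whole
    word is cancelled. In that case [g] is the inverse word and starts with [linv l]. *)
Lemma freered_cat_last g p l : reduced (rcons p l) ->
  (size g <= (size p).+1)%N ->
  (freered (g ++ rcons p l) = [::] /\ ohead g = Some (linv l)) \/
  exists s, freered (g ++ rcons p l) = rcons s l.
Proof.
move=> rp; elim: g => [_|a g IH gp]; first by right; exists p; rewrite freered_id.
have [[e _]|[s es]] := IH (ltnW gp).
  have := size_freered_cat g rp; rewrite e add0n size_rcons => gp'.
  by move: gp => /=; rewrite ltnNge gp'.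
rewrite cat_cons freered_cons es; case: s {es} => [|b s] /=.
  case: eqP => [->|_]; first by left; rewrite linvK.
  by right; exists [:: a].
case: eqP => _; right; first by exists s.
by exists (a :: b :: s).
Qed.

Local Notation nocancel := (fun a b : letter => b != linv a).

Lemma reduced_rcons_cat s l v :
  reduced (rcons s l ++ v) = reduced (rcons s l) && path nocancel l v.
Proof.
rewrite /reduced; case: s => [|x s] /=; first by [].
by rewrite cat_path last_rcons.
Qed.

Lemma reduced_take n w : reduced w -> reduced (take n w).
Proof. exact: take_sorted. Qed.

Lemma prefix_take_iff k u v : (size u <= k)%N -> prefix u (take k v) = prefix u v.
Proof.
move=> uk; apply/idP/idP => [/prefixP[t e]|].
  by rewrite -(cat_take_drop k v) e -catA prefix_prefix.
by move=> /prefixP[t ->]; rewrite take_cat ltnNge uk prefix_prefix.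
Qed.

(** The geometric content of [Sset]: [g] maps the cylinder of [p] onto the words that start with
    [g p], or, when [g p] is trivial, onto those that do not start with the first letter of [g]. The
    surviving last letter of [p] prevents any cancellation between [g p] and the tail. *)
Lemma cylinder_action k g (p : k.-tuple letter) v : relation_k g p -> reduced v ->
  (size p <= size v)%N ->
  let t := take k (freered (g ++ v)) in
  (take k v == p) = ~~ (if freered (g ++ p) == [::] then ohead t == ohead g
                        else ~~ prefix (freered (g ++ p)) t).
Proof.
case/and5P => rg g0 gk rp rk rv sv t.
have k0 : (0 < k)%N by case: g g0 gk {rg rk t} => // a g _; apply: leq_trans.
have [p' [l el]] : exists p' l, (p : seq letter) = rcons p' l.
  have := size_tuple p; case: (lastP (p : seq letter)) => [k00|p' l _]; last by exists p', l.
  by move: k0; rewrite -k00.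
have spl : size (rcons p' l) = k by rewrite -el size_tuple.
rewrite el in rp rk sv t *.
have gl : (size g <= (size p').+1)%N by rewrite -(size_rcons p' l) spl.
have tk u : ohead (take k u) = ohead u by case: k k0 {t spl rk sv gk p el} => // k _; case: u.
apply/idP/idP.
  move=> /eqP tv.
  have ev : v = rcons p' l ++ drop k v by rewrite -tv cat_take_drop.
  move: rv; rewrite ev reduced_rcons_cat => /andP[_ pv].
  have ef : freered (g ++ v) = freered (freered (g ++ rcons p' l) ++ drop k v).
    by rewrite {1}ev catA freered_catl.
  have [[e hg]|[s es]] := freered_cat_last rp gl.
    rewrite e eqxx /t tk ef e cat0s freered_id; last by apply: path_sorted pv.
    by rewrite hg; case: (drop k v) pv => //= c d /andP[+ _]; apply: contra => /eqP[->].
  rewrite es (_ : _ == _ = false); last by case: (s).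
  rewrite negbK /t prefix_take_iff -?es// ef es freered_id ?prefix_prefix//.
  by rewrite reduced_rcons_cat pv -es freered_reduced.
(* Multiplication by [winv g]: a factorisation of [g v] as [g p u] with [p u] reduced gives back
   [v = p u]. *)
have ev u : freered (g ++ rcons p' l ++ u) = freered (g ++ v) -> reduced (rcons p' l ++ u) ->
    take k v == rcons p' l.
  move=> e ru; rewrite -(freered_winvK g rv) -e freered_winvK//.
  by rewrite take_size_cat.
have [[e hg]|[s es]] := freered_cat_last rp gl.
  rewrite e eqxx /t tk hg => nh; apply: (ev (freered (g ++ v))).
    by rewrite catA -freered_catl e cat0s freered_id// freered_reduced.
  rewrite reduced_rcons_cat rp /=; have := freered_reduced (g ++ v).
  by case: (freered (g ++ v)) nh => //= c d nh ->; rewrite andbT; apply: contra nh => /eqP ->.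
rewrite es (_ : _ == _ = false); last by case: (s).
rewrite negbK /t prefix_take_iff -?es//.
move=> /prefixP[u eu]; apply: (ev u).
  by rewrite catA -freered_catl -eu freered_id// freered_reduced.
have := freered_reduced (g ++ v); rewrite eu es !reduced_rcons_cat rp.
by case/andP.
Qed.

(* [xi^oo] is the boundary point whose translates discretise the boundary. *)
Definition xi_letter : letter := (false, false).
Definition ray w m := freered (w ++ nseq m xi_letter).

(** Each letter of [w] absorbs at most one [xi], so after [size w] of them the others are appended
    without cancellation. *)
Lemma rayE w j : ray w (size w + j) = ray w (size w) ++ nseq j xi_letter.
Proof.
elim: w j => [|a w IH] j.
  by rewrite /ray !cat0s add0n freered_id//; elim: j => // -[|j].
have rc m : ray (a :: w) m = cred a (ray w m) by [].
have e1 : ray w (size w).+1 = ray w (size w) ++ nseq 1 xi_letter by rewrite -addn1 IH.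
rewrite !rc [size (a :: w)]/= addSnnS IH e1 -[j.+1]add1n nseqD catA cred_cat//.
by case: (ray w _).
Qed.

(** The first [k] letters of the infinite reduced word [w xi^oo]. Words shorter than [k] lie in no
    [k]-cylinder; passing to the end assigns one to every word, compatibly with left translation. *)
Definition wend k w := take k (ray w (size w) ++ nseq k xi_letter).

Lemma take_ray k w m : (size w + k <= m)%N -> take k (ray w m) = wend k w.
Proof.
move=> wm; rewrite -(subnKC wm) -addnA rayE nseqD catA /wend.
by rewrite takel_cat// size_cat size_nseq leq_addl.
Qed.

Lemma size_ray k w m : (size w + k <= m)%N -> (k <= size (ray w m))%N.
Proof.
move=> wm; rewrite -(subnKC wm) -addnA rayE nseqD catA size_cat size_cat size_nseq.
by rewrite addnAC leq_addl.
Qed.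

Lemma size_wend k w : size (wend k w) == k.
Proof. by rewrite size_takel// size_cat size_nseq leq_addl. Qed.

Definition tend k w : k.-tuple letter := Tuple (size_wend k w).

Lemma reduced_tend k w : reduced (tend k w).
Proof.
by rewrite /= -(take_ray (leqnn _)); apply: reduced_take; exact: freered_reduced.
Qed.

Lemma tend_action k g (p : k.-tuple letter) w : relation_k g p ->
  (tend k w == p) = ~~ Sset g p (tend k (freered (g ++ w))).
Proof.
(* [m] is large enough for [w] and for the reduced form of [g w] at the same time. *)
move=> rgp; pose m := (size w + size g + k)%N.
have wm : (size w + k <= m)%N by rewrite /m addnAC leq_addr.
have gwm : (size (freered (g ++ w)) + k <= m)%N.
  by rewrite leq_add2r (leq_trans (size_freered _))// size_cat addnC.
have e : freered (g ++ ray w m) = ray (freered (g ++ w)) m.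
  by rewrite /ray freered_catr catA freered_catl.
have := cylinder_action rgp (freered_reduced (w ++ nseq m xi_letter)).
rewrite size_tuple => /(_ (size_ray wm)) /=; rewrite -/(ray w m) e !take_ray//.
move=> {}e; rewrite /Sset reduced_tend andTb -e.
by rewrite -(inj_eq val_inj).
Qed.

End words.

(** * Convergence of the orbital sum for a discrete group *)

Section orbit_sum.
Context {R : realType}.
Implicit Types (M N : 'M[R]_4).

Lemma mxBE M N i j : (M - N) i j = M i j - N i j.
Proof. by rewrite !mxE. Qed.

Lemma olor_mulmxJ M : olor M -> M *m Jm *m M^T = Jm.
Proof.
move=> oM; have := mulmxV (olor_unit oM); rewrite invmx_olor// !mulmxA => e.
by rewrite -[LHS]mulmx1 -Jm2 mulmxA e mul1mx.
Qed.

(** The last row satisfies [M3j ^+ 2 <= M33 ^+ 2 - 1] for a space index [j], and the space part of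
    column [j] has squared norm [1 + M3j ^+ 2]. *)
Lemma olor_entry_sqr M i j : olor M -> M i j ^+ 2 <= M i3 i3 ^+ 2.
Proof.
move=> oM; have [MJ m33] := oM.
have E k l : M i0 k * M i0 l + M i1 k * M i1 l + M i2 k * M i2 l - M i3 k * M i3 l
   = (Jm : 'M[R]_4) k l.
  by rewrite -MJ mulmx44E !mulmx44E !mxE /=; ring.
have E' : M i3 i0 * M i3 i0 + M i3 i1 * M i3 i1 + M i3 i2 * M i3 i2 - M i3 i3 * M i3 i3 = -1.
  have := congr1 (fun A : 'M[R]_4 => A i3 i3) (olor_mulmxJ oM).
  by rewrite mulmx44E !mulmx44E !mxE /= => <-; ring.
have sq k l := sqr_ge0 (M k l).
have := (sq i3 i0, sq i3 i1, sq i3 i2); rewrite !expr2 => -[[a0 a1] a2].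
have Ejj := E j j; have J1 : (Jm : 'M[R]_4) j j <= 1 by rewrite JmE eqxx; case: ifP; lra.
have b j' : j' != i3 -> M i3 j' * M i3 j' <= M i3 i3 * M i3 i3 - 1.
  by move: j'; elim/ord4P => // _; lra.
have := (sq i0 j, sq i1 j, sq i2 j); rewrite !expr2 => -[[c0 c1] c2].
have [j3|j3] := eqVneq j i3.
  subst j; move: i; elim/ord4P; have := E i3 i3; rewrite JmE eqxx /= => e3; lra.
have bj := b j j3.
by move: i; elim/ord4P; lra.
Qed.

Lemma olor_entry M i j : olor M -> `|M i j| <= M i3 i3.
Proof.
move=> oM; have [_ m33] := oM.
rewrite -(@ler_pXn2r _ 2) ?nnegrE ?normr_ge0 ?(ltW m33)// real_normK ?num_real//.
exact: olor_entry_sqr.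
Qed.

Lemma olor33_ge1 M : olor M -> 1 <= M i3 i3.
Proof.
move=> oM; have [MJ m33] := oM.
have : M i0 i3 * M i0 i3 + M i1 i3 * M i1 i3 + M i2 i3 * M i2 i3 - M i3 i3 * M i3 i3 = -1.
  have := congr1 (fun A : 'M[R]_4 => A i3 i3) MJ.
  by rewrite mulmx44E !mulmx44E !mxE /= => <-; ring.
have := (sqr_ge0 (M i0 i3), sqr_ge0 (M i1 i3), sqr_ge0 (M i2 i3)); rewrite !expr2.
move=> [[a0 a1] a2] e; nra.
Qed.

Lemma invmx33 M : olor M -> invmx M i3 i3 = M i3 i3.
Proof. by move=> oM; rewrite invmx_olor// mulmx44E !mulmx44E !mxE /=; ring. Qed.

(* [g -> g33 * g] separates the points of a discrete group uniformly. *)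
Lemma scaled_separation (eps : R) M N : 0 < eps -> olor M -> olor N ->
  M i3 i3 <= N i3 i3 ->
  (forall i j, `|M i3 i3 * M i j - N i3 i3 * N i j| < eps / 16) ->
  forall i j, `|(invmx M *m N) i j - (1%:M : 'M[R]_4) i j| < eps.
Proof.
move=> eps0 oM oN MN near i j; set eta := eps / 16 in near.
have eta0 : 0 < eta by rewrite divr_gt0.
have m1 := olor33_ge1 oM; have n1 := olor33_ge1 oN.
set m := M i3 i3 in near m1 MN *; set n := N i3 i3 in near n1 MN *.
(* From the last diagonal entry, [n ^+ 2 - m ^+ 2 < eta], together with [m <= n]. *)
have mn : (n - m) * n <= eta.
  have := near i3 i3; rewrite -/m -/n distrC => /ltr_normlW; nra.
(* The factor [m] pays for the entries of [invmx M], which are at most [m]. Four terms of size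
   [2 * eta] then stay below [16 * eta = eps]. *)
have dist k l : m * `|N k l - M k l| <= 2 * eta.
  rewrite -{1}[m]ger0_norm ?(le_trans _ m1)// -normrM.
  rewrite [X in `|X|](_ : _ = - (m * M k l - n * N k l) - (n - m) * N k l); last by ring.
  rewrite (le_trans (ler_normB _ _))// normrN mulr_natl mulr2n lerD ?(ltW (near k l))//.
  rewrite normrM ger0_norm ?subr_ge0// (le_trans _ mn)//.
  by rewrite ler_wpM2l ?subr_ge0// olor_entry.
have oV := olor_invmx oM.
have -> : (invmx M *m N) i j - (1%:M : 'M[R]_4) i j = (invmx M *m (N - M)) i j.
  by rewrite mulmxBr mulVmx ?olor_unit// mxBE.
have t k : `|invmx M i k * (N - M) k j| <= 2 * eta.
  rewrite normrM (le_trans _ (dist k j))//.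
  rewrite mxBE ler_wpM2r//.
  by rewrite /m -(invmx33 oM) olor_entry.
rewrite mulmx44E (le_lt_trans (ler_normD _ _))//.
have := ler_normD (invmx M i i0 * (N - M) i0 j + invmx M i i1 * (N - M) i1 j) (invmx M i i2 * (N - M) i2 j).
have := ler_normD (invmx M i i0 * (N - M) i0 j) (invmx M i i1 * (N - M) i1 j).
have := (t i0, t i1, t i2, t i3) => -[[[t0 t1] t2] t3].
rewrite /eta in t0 t1 t2 t3; lra.
Qed.

Lemma intrBn (i j : nat) : ((i%:Z - j%:Z)%:~R : R) = i%:R - j%:R.
Proof. by rewrite rmorphB /= -!pmulrn. Qed.

(** Each term is at most four times an increment of the function [x / (1 + |x|)], whose values lie
    in [[-1, 1]], so the telescoping sum is at most 8 for every [L]. *)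
Lemma sum_inv_sqr (L : nat) :
  \sum_(i < L.*2.+1) (1 + ((i%:R : R) - L%:R) ^+ 2)^-1 <= 8.
Proof.
pose b (x : R) := x / (1 + `|x|).
have b1 x : `|b x| <= 1.
  have d0 : 0 < 1 + `|x| by rewrite ltr_pwDl.
  by rewrite normrM normfV (ger0_norm (ltW d0)) ler_pdivrMr// mul1r lerDr.
have step (n : int) : (1 + (n%:~R : R) ^+ 2)^-1 <= 4 * (b (n%:~R + 1) - b n%:~R).
  have d0 : 0 < 1 + (n%:~R : R) ^+ 2 by rewrite ltr_pwDl// sqr_ge0.
  rewrite -[leLHS]mul1r ler_pdivrMr// /b.
  case: (lerP 0 n) => n0.
    have x0 : 0 <= (n%:~R : R) by rewrite ler0z.
    rewrite !ger0_norm ?addr_ge0//; move: (n%:~R) x0 {d0} => x x0.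
    have e1 : 0 < 1 + (x + 1) by lra.
    have e2 : 0 < 1 + x by lra.
    rewrite (_ : (x + 1) / (1 + (x + 1)) - x / (1 + x) = ((1 + (x + 1)) * (1 + x))^-1); last first.
      by field; rewrite !gt_eqF.
    rewrite mulrAC ler_pdivlMr ?mulr_gt0// mul1r; have := sqr_ge0 (x - 2^-1); rewrite !expr2; lra.
  have x1 : (n%:~R : R) <= -1.
    by have : n <= -1; [lia|rewrite -(ler_int R) mulrN1z].
  move: (n%:~R) x1 {d0} => x x1.
  rewrite ler0_norm; last by lra.
  rewrite (ler0_norm (x := x)); last by lra.
  have e1 : 0 < 1 - (x + 1) by lra.
  have e2 : 0 < 1 - x by lra.
  rewrite (_ : (x + 1) / (1 - (x + 1)) - x / (1 - x) = ((1 - (x + 1)) * (1 - x))^-1); last first.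
    by field; rewrite !gt_eqF.
  rewrite mulrAC ler_pdivlMr ?mulr_gt0// mul1r; have := sqr_ge0 (x + 2^-1); rewrite !expr2; lra.
pose F (i : nat) := b ((i%:R : R) - L%:R).
apply: (@le_trans _ _ (\sum_(0 <= i < L.*2.+1) 4 * (F i.+1 - F i))).
  rewrite big_mkord; apply: ler_sum => i _.
  have := step (i%:Z - L%:Z); rewrite intrBn /F.
  by have -> : (i.+1%:R - L%:R : R) = i%:R - L%:R + 1 by rewrite -natr1; ring.
rewrite -mulr_sumr telescope_sumr//.
have := b1 ((L.*2.+1%:R : R) - L%:R); have := b1 (0%:R - L%:R).
rewrite /F !ler_norml; lra.
Qed.

(** Rounding the entries of [g33 * g / eta] embeds the orbit into Z^16. Each coordinate is of order
    at most [g33 ^+ 2], so [g33 ^- 4] is bounded by a summable function of it; the product over 16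
    coordinates bounds [g33 ^- 64], and the sum over Z^16 factors. *)
Lemma orbit_sum_bounded (T : eqType) (N : T -> 'M[R]_4) (P : pred T) (eps : R) :
  0 < eps -> (forall w, olor (N w)) ->
  (forall w w', P w -> P w' -> w != w' ->
     exists i j, eps <= `|(invmx (N w) *m N w') i j - (1%:M : 'M[R]_4) i j|) ->
  exists C : R, forall ws : seq T, uniq ws -> all P ws ->
    \sum_(w <- ws) (N w i3 i3 ^+ 64)^-1 <= C.
Proof.
move=> eps0 oN sep; pose eta := eps / 16; have eta0 : 0 < eta by rewrite divr_gt0.
(* Chosen so that [1 + k ^+ 2 <= C0 * g33 ^+ 4] for every rounded entry [k]. *)
pose C0 : R := 1 + (eta^-1 + 1) ^+ 2.
have C00 : 0 < C0 by rewrite ltr_pwDl// sqr_ge0.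
pose n w (ij : 'I_4 * 'I_4) := Num.floor (N w i3 i3 * N w ij.1 ij.2 / eta).
pose t (k : int) : R := C0 / (1 + (k%:~R) ^+ 2).
have t0 k : 0 <= t k by rewrite divr_ge0 ?(ltW C00)// addr_ge0// sqr_ge0.
have ninj w w' : P w -> P w' -> n w =1 n w' -> w = w'.
  move=> Pw Pw' nn; apply/eqP; apply: contraT => ww'.
  have near i j : `|N w i3 i3 * N w i j - N w' i3 i3 * N w' i j| < eta.
    have := nn (i, j); rewrite /n /= => e.
    have /andP[a1 a2] := floor_itv (N w i3 i3 * N w i j / eta).
    have /andP[b1 b2] := floor_itv (N w' i3 i3 * N w' i j / eta).
    rewrite e in a1 a2; move: a1 a2 b1 b2; rewrite intrD.
    rewrite !ler_pdivlMr// !ltr_pdivrMr//.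
    by move: (Num.floor _) => f; rewrite mulrDl mul1r ltr_norml; lra.
  have [le|/ltW le] := lerP (N w i3 i3) (N w' i3 i3).
    have [i [j]] := sep _ _ Pw Pw' ww'.
    by rewrite leNgt (scaled_separation eps0 (oN w) (oN w') le near).
  have [i [j]] := sep _ _ Pw' Pw (contra_neq esym ww').
  rewrite leNgt (scaled_separation eps0 (oN w') (oN w) le)// => k l.
  by rewrite distrC near.
have nbound w ij : (N w i3 i3 ^+ 4)^-1 <= t (n w ij).
  have m1 := olor33_ge1 (oN w); have e1 := olor_entry ij.1 ij.2 (oN w).
  set m := N w i3 i3 in m1 e1 *; rewrite /t /n -/m.
  set x := N w ij.1 ij.2 in e1 *; set f := Num.floor _.
  have fb : `|f%:~R : R| <= m ^+ 2 / eta + 1.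
    have /andP[a1 a2] := floor_itv (m * x / eta); rewrite -/f intrD in a1 a2.
    have : `|m * x / eta| <= m ^+ 2 / eta.
      rewrite normrM normrM (ger0_norm (x := m)) ?(le_trans _ m1)//.
      rewrite (ger0_norm (x := eta^-1)) ?invr_ge0 ?(ltW eta0)//.
      by rewrite ler_wpM2r ?invr_ge0 ?(ltW eta0)// expr2 ler_wpM2l// (le_trans _ m1).
    by move: (m * x / eta) (m ^+ 2 / eta) a1 a2 => y z; rewrite !ler_norml; lra.
  have m2 : 1 <= m ^+ 2 by rewrite expr_ge1// (le_trans _ m1).
  have fb2 : `|f%:~R : R| <= m ^+ 2 * (eta^-1 + 1).
    by rewrite (le_trans fb)// mulrDr mulr1 lerD2l.
  have fsq : (f%:~R : R) ^+ 2 <= m ^+ 4 * (eta^-1 + 1) ^+ 2.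
    rewrite -[X in X <= _]real_normK ?num_real// (_ : m ^+ 4 * _ = (m ^+ 2 * (eta^-1 + 1)) ^+ 2); last by ring.
    by rewrite ler_pXn2r ?nnegrE// (le_trans _ fb2).
  have m4 : 1 <= m ^+ 4 by rewrite expr_ge1// (le_trans _ m1).
  have m40 : 0 < m ^+ 4 by exact: lt_le_trans m4.
  rewrite -[leLHS]mul1r ler_pdivrMr// mulrAC ler_pdivlMr ?ltr_pwDl ?sqr_ge0// mul1r.
  by rewrite /C0 mulrDl mul1r; move: fsq m4; rewrite [X in _ <= X]mulrC; lra.
exists ((8 * C0) ^+ 16) => ws uws aws.
pose L := \max_(w <- ws) \max_ij `|n w ij|%N.
have nL w ij : w \in ws -> (`|n w ij| <= L)%N.
  move=> wws; rewrite /L (big_rem w)//= leq_max; apply/orP; left.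
  by rewrite (bigD1 ij)//= leq_maxl.
(* Finitely many words have coordinates in [[-L, L]]; shifted by [L] they become functions between
   finite types, for which sum and product can be exchanged. *)
pose c w : {ffun 'I_4 * 'I_4 -> 'I_L.*2.+1} := [ffun ij => inord (absz (n w ij + L%:Z))].
have cE w ij : w \in ws -> (c w ij)%:Z - L%:Z = n w ij.
  move=> wws; have := nL _ ij wws; rewrite ffunE; move: (n w ij) => k kL.
  have kb : (absz (k + L%:Z)%R < L.*2.+1)%N by rewrite -mul2n; lia.
  by rewrite (inordK kb); lia.
have cinj : {in ws &, injective c}.
  move=> w w' wws wws' cc; apply: ninj; rewrite ?(allP aws)// => ij.
  by rewrite -!cE// cc.
pose G (f : {ffun 'I_4 * 'I_4 -> 'I_L.*2.+1}) := \prod_ij t ((f ij)%:Z - L%:Z).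
apply: (@le_trans _ _ (\sum_(f <- map c ws) G f)).
  rewrite big_map [leLHS]big_seq [leRHS]big_seq; apply: ler_sum => w wws.
  rewrite /G (eq_bigr (fun ij => t (n w ij))); last by move=> ij _; rewrite cE.
  rewrite (_ : (N w i3 i3 ^+ 64)^-1 = \prod_(ij : 'I_4 * 'I_4) (N w i3 i3 ^+ 4)^-1); last first.
    by rewrite prodr_const card_prod !card_ord exprVn -exprM.
  apply: ler_prod => ij _; rewrite nbound andbT invr_ge0 exprn_ge0//.
  by rewrite (le_trans _ (olor33_ge1 (oN w))).
apply: (@le_trans _ _ (\sum_f G f)).
  rewrite big_uniq ?map_inj_in_uniq//= [leRHS](bigID (mem (map c ws)))/=.
  by rewrite lerDl sumr_ge0// => f _; apply: prodr_ge0.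
rewrite -(bigA_distr_bigA (fun _ (k : 'I_L.*2.+1) => t (k%:Z - L%:Z))).
rewrite prodr_const card_prod !card_ord lerXn2r ?nnegrE//.
- by apply: sumr_ge0.
- by rewrite mulr_ge0// ltW.
rewrite /t -mulr_sumr mulrC ler_wpM2r ?(ltW C00)//.
have := sum_inv_sqr L; congr (_ <= _); apply: eq_bigr => i _.
by rewrite intrBn.
Qed.

End orbit_sum.

(** * Finitely additive set functions below a finite measure *)

Section dominated_measure.
Context d (T : measurableType d) (R : realType) (m : {measure set T -> \bar R}).
Variable L : set T -> R.
Hypotheses (mfin : forall E, measurable E -> m E \is a fin_num)
  (L0 : forall E, 0 <= L E) (Lm : forall E, measurable E -> L E <= fine (m E))
  (LD : forall A B, measurable A -> measurable B -> A `&` B = set0 ->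
    L (A `|` B) = L A + L B).

Definition dominated of (forall E, measurable E -> m E \is a fin_num)
  & (forall E, 0 <= L E) & (forall E, measurable E -> L E <= fine (m E))
  & (forall A B, measurable A -> measurable B -> A `&` B = set0 ->
    L (A `|` B) = L A + L B) : set T -> \bar R := fun E => (L E)%:E.

Local Notation mu := (dominated mfin L0 Lm LD).

Let Lset0 : L set0 = 0.
Proof. by apply/le_anti; rewrite L0 andbT (le_trans (Lm measurable0))// measure0. Qed.

Let mu0 : mu set0 = 0%E.
Proof. by rewrite /dominated Lset0. Qed.

Let mu_ge0 E : (0 <= mu E)%E.
Proof. by rewrite lee_fin. Qed.

(* Finitely additive and dominated by a finite measure, hence sigma-additive. *)
Let mu_sigma_additive : semi_sigma_additive mu.
Proof.
move=> F mF tF mUF; rewrite /dominated.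
pose B n := \big[setU/set0]_(i < n) F i.
have mB n : measurable (B n) by exact: bigsetU_measurable.
have disj n : B n `&` F n = set0.
  apply/seteqP; split=> // x [+ Fnx]; rewrite /B -bigcup_mkord => -[i /= il Fix].
  have /trivIsetP h := tF; have := h i n I I; rewrite lt_eqF// => /(_ isT) e.
  by have : (F i `&` F n) x by []; rewrite e.
have BS n : B n.+1 = B n `|` F n by rewrite /B big_ord_recr.
have LB n : L (B n) = \sum_(i < n) L (F i).
  elim: n => [|n IH]; first by rewrite /B !big_ord0 Lset0.
  by rewrite BS LD// IH big_ord_recr.
have mBs n : fine (m (B n)) = \sum_(i < n) fine (m (F i)).
  elim: n => [|n IH]; first by rewrite /B !big_ord0 measure0.
  by rewrite BS measureU// fineD ?mfin// IH big_ord_recr.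
pose V := \bigcup_n F n.
have BV n : B n `<=` V by rewrite /B -bigcup_mkord => x [i _ Fx]; exists i.
have splitV n : V = B n `|` (V `\` B n).
  apply/seteqP; split=> x; last by case=> [/BV|[]].
  by move=> Vx; have [?|?] := pselect (B n x); [left|right].
have mVB n : measurable (V `\` B n) by exact: measurableD.
have LV n : L V = L (B n) + L (V `\` B n).
  by rewrite {1}(splitV n) LD// setDE setICA setICr setI0.
have mV n : fine (m V) = fine (m (B n)) + fine (m (V `\` B n)).
  by rewrite {1}(splitV n) measureU// ?fineD ?mfin// setDE setICA setICr setI0.
have cm : (fun n => \sum_(i < n) fine (m (F i))) @ \oo --> fine (m V).
  have := @measure_semi_sigma_additive _ _ _ m F mF tF mUF.
  rewrite -(fineK (mfin mUF)) => /(@fine_cvg _ _ _ _ _ _).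
  apply: cvg_trans; apply: near_eq_cvg; apply: nearW => n /=.
  by rewrite big_mkord -sum_fine// => i _; exact: mfin.
under eq_fun do rewrite sumEFin big_mkord.
apply: cvg_EFin; first by apply: nearW.
(* What the first [n] sets miss has [L] at most its [m], and the latter tends to zero. *)
apply: (@squeeze_cvgr _ _ _ _ (fun n => L V - (fine (m V) - \sum_(i < n) fine (m (F i)))) (cst (L V))).
- apply: nearW => n /=; rewrite -LB -mBs (LV n) (mV n).
  by have := L0 (V `\` B n); have := Lm (mVB n); lra.
- rewrite -[X in _ --> X]subr0 -[X in _ --> _ - X](subrr (fine (m V))).
  by apply: cvgB; [exact: cvg_cst|apply: cvgB => //; exact: cvg_cst].
- exact: cvg_cst.
Qed.

HB.instance Definition _ := isMeasure.Build _ _ _ mu mu0 mu_ge0 mu_sigma_additive.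

End dominated_measure.

Lemma fine_sandwich (R : realType) (x : \bar R) (a b : R) :
  (a%:E <= x <= b%:E)%E -> a <= fine x <= b.
Proof.
case: x => [r| |]; first by rewrite !lee_fin.
  by move=> /andP[_]; rewrite leye_eq.
by move=> /andP[+ _]; rewrite leeNy_eq.
Qed.

Lemma cvg_sumr (R : realType) (J : Type) (r : seq J) (F : set_system nat)
    (FF : Filter F) (u : J -> nat -> R) (l : J -> R) :
  (forall j, u j @ F --> l j) ->
  (fun n => \sum_(j <- r) u j n) @ F --> \sum_(j <- r) l j.
Proof.
move=> ul; elim: r => [|j r IH].
  by rewrite big_nil; under eq_fun do rewrite big_nil; exact: cvg_cst.
by rewrite big_cons; under eq_fun do rewrite big_cons; exact: cvgD.
Qed.

(** * Setwise limits of densities along an ultrafilter *)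

Section ultralimit.
Context d (T : measurableType d) (R : realType).
Variable U : set_system nat.
Hypothesis UF : UltraFilter U.

(** Compactness of [[0, 1]] provides a cluster point, and a cluster point of an ultrafilter is a
    limit. *)
Lemma ultra_bounded_cvg (u : nat -> R) : (forall n, 0 <= u n <= 1) ->
  exists l : R, u @ U --> l.
Proof.
move=> u01; have PU : ProperFilter U := ultra_proper.
have Uu : U (u @^-1` `[0, 1]%classic) by apply: filterE => n; rewrite /= in_itv/=; exact: u01.
have [l [_ cl]] := @segment_compact R 0 1 (u @ U) _ Uu; exists l => A Al.
have [//|UA] := in_ultra_setVsetC (u @^-1` A) UF.
have [y [+ Ay]] := cl (~` A) A UA Al.
by [].
Qed.

Section simple_bounds.
Variables (eta : {measure set T -> \bar R}).
Hypothesis eta1 : (eta setT <= 1)%E.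

(** The integral of [g] rounded down to multiples of [dlt]. It involves finitely many values of
    [eta] only, so it passes to setwise limits, while its distance to the true integral is at most
    [dlt] for every [eta] of mass at most [1]. *)
Definition step_sum (g : T -> R) (dlt : R) (K : nat) : R :=
  \sum_(j < K) j%:R * dlt * fine (eta (g @^-1` `[j%:R * dlt, j.+1%:R * dlt[)).

Let fin E : measurable E -> eta E \is a fin_num.
Proof.
move=> mE; rewrite ge0_fin_numE//.
apply: (@le_lt_trans _ _ (eta setT)); first by apply: le_measure; rewrite ?inE.
by rewrite (le_lt_trans eta1)// ltry.
Qed.

Lemma simple_bounds (g : T -> R) (dlt : R) (K : nat) :
  measurable_fun setT g -> 0 < dlt -> (forall x, 0 <= g x < K%:R * dlt) ->
  ((step_sum g dlt K)%:E <= \int[eta]_x (g x)%:E <=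
   (step_sum g dlt K + dlt)%:E)%E.
Proof.
move=> mg d0 g0; set S := step_sum _ _ _.
pose E (j : nat) := g @^-1` `[j%:R * dlt, j.+1%:R * dlt[%classic.
have mE j : measurable (E j) by rewrite -[E j]setTI; exact: mg.
pose s x := \sum_(j < K) j%:R * dlt * \1_(E j) x.
have s0 x : 0 <= s x by apply: sumr_ge0 => j _; rewrite !mulr_ge0// ltW.
have ms : measurable_fun setT s.
  by apply: measurable_sum => j; apply: measurable_funM => //; exact: measurable_indic.
have sg x : s x <= g x <= s x + dlt.
  have /andP[gx0 gxK] := g0 x.
  have gd : 0 <= g x / dlt by rewrite divr_ge0// ltW.
  have /andP[j1 j2] := truncn_itv gd.
  set j := Num.truncn (g x / dlt) in j1 j2.
  rewrite ler_pdivlMr// in j1; rewrite ltr_pdivrMr// in j2.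
  have jK : (j < K)%N.
    by rewrite -(ltr_nat R) -(ltr_pM2r d0) (le_lt_trans j1).
  have -> : s x = j%:R * dlt.
    rewrite /s (bigD1 (Ordinal jK))//= indicE mem_set ?mulr1; last first.
      by rewrite /E /= in_itv/= j1 j2.
    rewrite big1 ?addr0// => i ij; rewrite indicE memNset ?mulr0//= /E /= in_itv/=.
    move=> /andP[i1 i2]; move/negP: ij; apply; apply/eqP/val_inj => /=.
    apply/eqP; rewrite eqn_leq; apply/andP; split.
      by rewrite -ltnS -(ltr_nat R) -(ltr_pM2r d0) (le_lt_trans i1 j2).
    by rewrite -ltnS -(ltr_nat R) -(ltr_pM2r d0) (le_lt_trans j1 i2).
  rewrite j1 /= (le_trans (ltW j2))//.
  by rewrite -natr1 mulrDl mul1r.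
have intS : (\int[eta]_x (s x)%:E = S%:E)%E.
  rewrite /s; under eq_integral do rewrite -sumEFin.
  rewrite ge0_integral_sum//; last 2 first.
  - move=> j; apply/measurable_EFinP; apply: measurable_funM => //; exact: measurable_indic.
  - by move=> j x _; rewrite lee_fin !mulr_ge0// ltW.
  rewrite /S /step_sum -sumEFin; apply: eq_bigr => j _; under eq_integral do rewrite EFinM.
  have mI : measurable_fun setT (fun x => (\1_(E j) x : R)%:E).
    by apply/measurable_EFinP; exact: measurable_indic.
  have c0 : (0 <= (j%:R * dlt)%:E)%E by rewrite lee_fin mulr_ge0// ltW.
  have I0 x : setT x -> (0 <= (\1_(E j) x : R)%:E)%E by rewrite lee_fin.
  rewrite (ge0_integralZl eta measurableT mI I0 c0).
  rewrite integral_indic// setIT [RHS]EFinM; congr (_ * _)%E.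
  by rewrite fineK//; exact: (fin (mE j)).
have mEs : measurable_fun setT (fun x => (s x)%:E) by exact/measurable_EFinP.
have mEg : measurable_fun setT (fun x => (g x)%:E) by exact/measurable_EFinP.
have mEd : measurable_fun setT (fun x => (s x)%:E + dlt%:E)%E.
  by apply: emeasurable_funD => //; exact: measurable_cst.
have s0E x : setT x -> (0 <= (s x)%:E)%E by rewrite lee_fin.
have g0E x : setT x -> (0 <= (g x)%:E)%E by rewrite lee_fin; case/andP : (g0 x).
have d0E x : setT x -> (0 <= (s x)%:E + dlt%:E)%E.
  by move=> _; rewrite -EFinD lee_fin addr_ge0// ltW.
apply/andP; split.
  rewrite -intS; apply: ge0_le_integral => // x _; rewrite lee_fin.
  by case/andP : (sg x).
apply: (@le_trans _ _ (\int[eta]_x ((s x)%:E + dlt%:E))%E).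
  apply: ge0_le_integral => // x _; rewrite -EFinD lee_fin.
  by case/andP : (sg x).
rewrite ge0_integralD//; last by move=> x _; rewrite lee_fin ltW.
rewrite intS EFinD leeD2l// integral_cst//.
by rewrite -[leRHS]mule1 lee_pmul2l// lte_fin.
Qed.

End simple_bounds.


(** The limit is taken separately on each set; it is finitely additive and below [m], hence a
    measure. Integrals of a bounded [g] follow because its step sums approximate uniformly in
    [n]. *)
Theorem ultralimit_measures (I : finType) (m : {measure set T -> \bar R})
    (f : nat -> I -> T -> R) (mf : forall n i, measurable_fun setT (f n i))
    (f0 : forall n i x, 0 <= f n i x) :
  m setT = 1%E -> (forall n x, \sum_i f n i x = 1) ->
  exists nu : I -> {measure set T -> \bar R},
    [/\ forall E, measurable E -> m E = (\sum_i nu i E)%E,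
        forall i, (nu i setT <= 1)%E &
        forall i (g : T -> R) (C : R), measurable_fun setT g ->
          (forall x, 0 <= g x <= C) ->
          (fun n => fine (\int[m]_x (g x * f n i x)%:E)) @ U -->
          fine (\int[nu i]_x (g x)%:E)].
Proof.
move=> m1 fsum; have PU : ProperFilter U := ultra_proper.
pose eta n i : {measure set T -> \bar R} := density m (mf n i) (f0 n i).
have etaE n E : measurable E -> (\sum_i eta n i E)%E = m E.
  move=> mE; rewrite /eta /= /density -ge0_integral_sum//; last 2 first.
  - by move=> i; apply/measurable_EFinP; apply: measurable_funTS.
  - by move=> i x _; rewrite lee_fin.
  under eq_integral do rewrite sumEFin fsum.
  by rewrite integral_cst// mul1e.
have mfin E : measurable E -> m E \is a fin_num.
  move=> mE; rewrite ge0_fin_numE// (@le_lt_trans _ _ (m setT))//.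
    by apply: le_measure; rewrite ?inE.
  by rewrite m1 ltry.
have etam n i E : measurable E -> (eta n i E <= m E)%E.
  move=> mE; rewrite -(etaE n)// (bigD1 i)//= leeDl//.
  by apply: sume_ge0 => j _; exact: measure_ge0.
have etafin n i E : measurable E -> eta n i E \is a fin_num.
  move=> mE; rewrite ge0_fin_numE; last exact: measure_ge0.
  by rewrite (le_lt_trans (etam _ _ _ mE))// -ge0_fin_numE// mfin.
have eta1 n i : (eta n i setT <= 1)%E by rewrite -m1; exact: etam.
(* The value [0] on non-measurable sets gives a bounded sequence, hence a limit, for every set. *)
pose a n i E := if pselect (measurable E) then fine (eta n i E) else 0.
have aE n i E : measurable E -> a n i E = fine (eta n i E).
  by move=> mE; rewrite /a; case: pselect.
have a0 n i E : 0 <= a n i E.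
  by rewrite /a; case: pselect => // mE; rewrite fine_ge0//; exact: measure_ge0.
have am n i E : measurable E -> a n i E <= fine (m E).
  by move=> mE; rewrite aE// fine_le ?etafin ?mfin ?etam.
have a1 n i E : a n i E <= 1.
  rewrite /a; case: pselect => // mE; rewrite -(aE n i E mE) (le_trans (am _ _ _ mE))//.
  rewrite -lee_fin fineK ?mfin// -m1; apply: le_measure; rewrite ?inE//.
have /choice[L' HL'] : forall iE : I * set T, exists l : R, (fun n => a n iE.1 iE.2) @ U --> l.
  by move=> [i E]; apply: ultra_bounded_cvg => n; rewrite a0 a1.
pose L i E := L' (i, E).
have HL i E : (fun n => a n i E) @ U --> L i E by exact: (HL' (i, E)).
have limE i E (l : R) : (fun n => a n i E) @ U --> l -> L i E = l.
  by move=> cl; exact: (cvg_unique _ (HL i E) cl).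
have L0 i E : 0 <= L i E by apply: (cvgr_to_ge (HL i E)); exact: nearW.
have Lm i E : measurable E -> L i E <= fine (m E).
  by move=> mE; apply: (cvgr_to_le (HL i E)); apply: nearW => n; exact: am.
have LD i A B : measurable A -> measurable B -> A `&` B = set0 ->
   L i (A `|` B) = L i A + L i B.
  move=> mA mB AB; apply: limE.
  rewrite (_ : (fun n => _) = (fun n => a n i A + a n i B)); first exact: cvgD.
  apply/funext => n; rewrite !aE//; last exact: measurableU.
  by rewrite measureU// fineD// etafin.
pose nu i : {measure set T -> \bar R} := dominated mfin (L0 i) (Lm i) (LD i).
have nuE i E : nu i E = (L i E)%:E by [].
have nu1 i : (nu i setT <= 1)%E by rewrite nuE -m1 -(fineK (mfin _ measurableT)) lee_fin Lm.
exists nu; split => //.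
  move=> E mE; rewrite (eq_bigr (fun i => (L i E)%:E))// sumEFin -(fineK (mfin _ mE)).
  have c1 : (fun n => \sum_i a n i E) @ U --> fine (m E).
    rewrite (_ : (fun n => _) = cst (fine (m E))); first exact: cvg_cst.
    apply/funext => n /=; rewrite -(etaE n)// -sum_fine; last by move=> i _; exact: etafin.
    by apply: eq_bigr => i _; rewrite aE.
  have c2 : (fun n => \sum_i a n i E) @ U --> \sum_i L i E.
    by apply: cvg_sumr => i; exact: HL.
  by congr EFin; exact: (cvg_unique _ c1 c2).
move=> i g C mg g0.
have intE n : (\int[m]_x (g x * f n i x)%:E = \int[eta n i]_x (g x)%:E)%E.
  rewrite (ge0_integral_density m (mf n i) (f0 n i) (f := fun x => (g x)%:E))//.
  - exact/measurable_EFinP.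
  - by move=> x; rewrite lee_fin; case/andP : (g0 x).
apply/cvgrPdist_le => e e0; pose dlt := e / 3.
have d0 : 0 < dlt by rewrite divr_gt0.
(* The successor makes [g < K%:R * dlt] strict, as the half-open layers demand. *)
pose K := (Num.truncn (C / dlt)).+1.
have gK x : 0 <= g x < K%:R * dlt.
  have /andP[-> gC] /= := g0 x; rewrite (le_lt_trans gC)// -ltr_pdivrMr//.
  exact: truncnS_gt.
pose E (j : nat) := g @^-1` `[j%:R * dlt, j.+1%:R * dlt[%classic.
have mE j : measurable (E j) by rewrite -[E j]setTI; exact: mg.
have bnu := simple_bounds (nu1 i) mg d0 gK.
have beta n := simple_bounds (eta1 n i) mg d0 gK.
pose S n := \sum_(j < K) j%:R * dlt * a n i (E j).
pose S0 := \sum_(j < K) j%:R * dlt * L i (E j).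
have cS : S n @[n --> U] --> S0.
  by apply: cvg_sumr => j; apply: cvgM; [exact: cvg_cst|exact: HL].
have nub : S0 <= fine (\int[nu i]_x (g x)%:E) <= S0 + dlt.
  have eS : step_sum (nu i) g dlt K = S0 by [].
  by move: bnu; rewrite eS => /fine_sandwich.
have etab n : S n <= fine (\int[m]_x (g x * f n i x)%:E) <= S n + dlt.
  have eS : step_sum (eta n i) g dlt K = S n.
    by apply: eq_bigr => j _; rewrite aE.
  rewrite intE; move: (beta n); rewrite eS.
  exact: fine_sandwich.
move/cvgrPdist_lt : cS => /(_ _ d0); apply: filterS => n.
move: nub (etab n); rewrite /dlt ltr_norml ler_norml; move: (fine _) (fine _) => x y.
lra.
Qed.

End ultralimit.

(** * The expansion factor [lam] in terms of [kap] *)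

Section expansion_factor.
Context {R : realType}.
Local Notation R3 := (R * R * R)%type.
Implicit Types (M N g : 'M[R]_4) (z : 'cV[R]_4) (p q x y : (R * R * R)%type).

Lemma olor_boost z : H3 z -> olor (boost z).
Proof.
move=> [zz z3]; move: zz; rewrite pos_formE => zz.
have {}zz : pos z z = 1 by apply/eqP; rewrite -eqr_opp zz.
rewrite /pos in zz.
set a := z i0 0 in zz; set b := z i1 0 in zz; set c := z i2 0 in zz; set w := z i3 0 in zz z3.
pose u := (1 + w)^-1; have w1 : 0 < 1 + w by lra.
have uw : u * w = 1 - u.
  by rewrite -[in RHS](mulVf (lt0r_neq0 w1)) -/u; ring.
pose S := a * a + b * b + c * c.
have SE : S = w * w - 1 by rewrite /S; lra.
have uS : u * S = w - 1.
  rewrite SE; transitivity ((u * w) * w - u); first by ring.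
  by rewrite uw; transitivity (w - (u * w) - u); [ring|rewrite uw; ring].
have uuS : u * u * S = 1 - 2 * u.
  by rewrite -mulrA uS; transitivity (u * w - u); [ring|rewrite uw; ring].
(* The matrix identities are linear combinations of these relations multiplied by coordinates; once
   the products are supplied, linear arithmetic closes all 16 entries. *)
have k2 (s t : R) : s * t * (u * u * S) = s * t * (1 - 2 * u) by rewrite uuS.
have k1 (s : R) : s * (u * S) = s * (w - 1) by rewrite uS.
have K2 := (k2 a a, k2 a b, k2 a c, k2 b b, k2 b c, k2 c c, k1 a, k1 b, k1 c).
case: K2 => [[[[[[[[h1 h2] h3] h4] h5] h6] h7] h8] h9].
rewrite /S in SE h1 h2 h3 h4 h5 h6 h7 h8 h9.
split; last by rewrite mxE.
apply/matrixP; elim/ord4P; elim/ord4P;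
  rewrite mulmx44E !mulmx44E !mxE /= -/a -/b -/c -/w -/u; lra.
Qed.

Lemma pos_vec1E x y : pos (vec1 x) (vec1 y) = 1 - dot x y.
Proof. by rewrite /pos !mxE /= /dot; ring. Qed.

(** [1 - dot x y] is the Lorentz product of [vec1 x] and [vec1 y], which [N] preserves; the [kap]
    factors come from renormalising the images. *)
Lemma dot_bd N x y : olor N -> S2 x -> S2 y ->
  dot (bd N x) (bd N y) = 1 - (1 - dot x y) / (kap N x * kap N y).
Proof.
move=> oN x1 y1; have k0 := kap_gt0 oN x1; have k1 := kap_gt0 oN y1.
rewrite -(pos_vec1E x y) -(pos_olor (vec1 x) (vec1 y) oN).
rewrite -!vec1_bd ?gt_eqF// posZl posZr pos_vec1E mulrA [X in X / _]mulrC.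
by rewrite mulfK ?mulf_neq0 ?gt_eqF//; ring.
Qed.

Lemma dot_lt1 x y : S2 x -> S2 y -> x <> y -> dot x y < 1.
Proof.
rewrite /S2 /=; case: x y => [[a b] c] [[a' b'] c']; rewrite /dot /= => x1 y1 xy.
rewrite ltNge; apply/negP => d1; apply: xy.
have : (a - a') ^+ 2 + (b - b') ^+ 2 + (c - c') ^+ 2 <= 0 by rewrite !expr2; lra.
have := (sqr_ge0 (a - a'), sqr_ge0 (b - b'), sqr_ge0 (c - c')) => -[[s1 s2] s3] s0.
have e1 : a - a' = 0 by apply/eqP; rewrite -sqrf_eq0; apply/eqP; lra.
have e2 : b - b' = 0 by apply/eqP; rewrite -sqrf_eq0; apply/eqP; lra.
have e3 : c - c' = 0 by apply/eqP; rewrite -sqrf_eq0; apply/eqP; lra.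
by congr (_, _, _); lra.
Qed.

Lemma dot_geN1 x y : S2 x -> S2 y -> -1 <= dot x y.
Proof.
rewrite /S2 /=; case: x y => [[a b] c] [[a' b'] c']; rewrite /dot /= => x1 y1.
have := (sqr_ge0 (a + a'), sqr_ge0 (b + b'), sqr_ge0 (c + c')); rewrite !expr2.
by move=> [[s1 s2] s3]; lra.
Qed.

(** Half-angle formula. It replaces [acos], singular at [1], by [asin] near [0], where it is
    differentiable. *)
Lemma acos_asin (u : R) : 0 <= u <= 2 -> acos (1 - u) = 2 * asin (Num.sqrt (u / 2)).
Proof.
move=> u02; pose s := Num.sqrt (u / 2).
have s2 : s ^+ 2 = u / 2 by rewrite sqr_sqrtr//; lra.
have s0 : 0 <= s by exact: sqrtr_ge0.
have s1 : s <= 1 by rewrite -(@expr_le1 _ 2)// s2; lra.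
have sI : -1 <= s <= 1 by lra.
have pi0 := pi_gt0 R.
have aI : asin s \in `[(- (pi / 2)), pi / 2] by rewrite in_itv/= asin_geNpi2// asin_lepi2.
have a0 : 0 <= asin s.
  rewrite leNgt -(ltr_sin aI) ?sin0 ?asinK ?in_itv//=; last by lra.
  by rewrite -leNgt.
have api := asin_lepi2 sI.
rewrite -[RHS]cosK; last by rewrite in_itv/= -/s; lra.
congr acos; rewrite -/s (_ : 2 * asin s = asin s + asin s); last by ring.
rewrite cosD asinK ?in_itv//= cos_asin// -!expr2 sqr_sqrtr s2; lra.
Qed.

Lemma asin_div_cvg : (fun s : R => asin s / s) @ (0 : R)^' --> (1 : R).
Proof.
have dI : is_derive (0 : R) (1 : R) (@asin R) (Num.sqrt (1 - 0 ^+ 2))^-1.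
  by apply: is_derive1_asin; lra.
have [dd dv] := dI.
have a0 : asin (0 : R) = 0.
  by rewrite -[in LHS](sin0 R) sinK// in_itv/=; have := pi_gt0 R; lra.
have : (fun h : R => h^-1 *: ((@asin R \o shift 0) (h *: 1) - asin 0)) @ (0 : R)^' -->
  'D_1 (@asin R) 0 by exact: dd.
rewrite dv expr0n /= subr0 sqrtr1 invr1; apply: cvg_trans.
apply: near_eq_cvg; apply: nearW => h /=.
by rewrite /shift /= addr0 /GRing.scale /= mulr1 a0 subr0 mulrC.
Qed.

Section limit.
Variable p : R3.
Hypothesis p1 : S2 p.
Local Notation W := (within (fun q => S2 q /\ q <> p) (nbhs p)).

Let cX1 : (fun q : R3 => q.1.1) @ p --> p.1.1.
Proof. by apply: (@cvg_comp _ _ _ fst fst _ (nbhs p.1)); exact: cvg_fst. Qed.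
Let cX2 : (fun q : R3 => q.1.2) @ p --> p.1.2.
Proof. by apply: (@cvg_comp _ _ _ fst snd _ (nbhs p.1)); [exact: cvg_fst|exact: cvg_snd]. Qed.
Let cX3 : (fun q : R3 => q.2) @ p --> p.2.
Proof. exact: cvg_snd. Qed.

(** Properness makes the limit in [lam] unique. Points of the sphere tending to [p] are obtained by
    rotating [p] about a coordinate axis that does not contain it. *)
Lemma punctured_sphere_proper : ProperFilter W.
Proof.
apply: Build_ProperFilter_ex => A WA.
suff [r [cr r0]] : exists r : R -> R3, r @ (0 : R)^'+ --> p /\
    \forall t \near (0 : R)^'+, S2 (r t) /\ r t <> p.
  have h := cr _ WA.
  have PT : ProperFilter (0 : R)^'+ by exact: at_right_proper_filter.
  have [t [[t1 t2] t3]] := @filter_ex _ _ PT _ (filterI r0 h).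
  by exists (r t); apply: t3.
have c0 : cos t @[t --> (0 : R)^'+] --> (1 : R).
  by rewrite -(cos0 R); apply: cvg_at_right_filter; exact: continuous_cos.
have s0 : sin t @[t --> (0 : R)^'+] --> (0 : R).
  by rewrite -[X in _ --> X](sin0 R); apply: cvg_at_right_filter; exact: continuous_sin.
have cl (a b : R) : (fun t => a * cos t - b * sin t) @ (0 : R)^'+ --> a.
  rewrite -[X in _ --> X]subr0 -[X in _ --> X - _]mulr1 -[X in _ --> _ - X](mulr0 b).
  by apply: cvgB; apply: cvgM => //; exact: cvg_cst.
have cr (a b : R) : (fun t => a * sin t + b * cos t) @ (0 : R)^'+ --> b.
  rewrite -[X in _ --> X]add0r -[X in _ --> X + _](mulr0 a) -[X in _ --> _ + X]mulr1.
  by apply: cvgD; apply: cvgM => //; exact: cvg_cst.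
have tpi : \forall t \near (0 : R)^'+, 0 < t < pi.
  near=> t; apply/andP; split; first by near: t; exact: nbhs_right_gt.
  by near: t; exact: (nbhs_right_lt (pi_gt0 R)).
have rotneq (a b t : R) : a ^+ 2 + b ^+ 2 != 0 -> 0 < t < pi ->
    a * cos t - b * sin t = a -> a * sin t + b * cos t = b -> False.
  move=> ab t0 e1 e2.
  have st := sin_gt0_pi t0; have cs := cos2Dsin2 t.
  have : (a ^+ 2 + b ^+ 2) * sin t = 0.
    transitivity (a * (a * sin t + b * cos t) - b * (a * cos t - b * sin t)); first by ring.
    by rewrite e1 e2; ring.
  by move=> /eqP; rewrite mulf_eq0 (negbTE ab) gt_eqF.
move: p1; rewrite /S2 /= /dot => pp.
(* If [p] is on the third axis, the rotation is about the first axis. *)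
have [ab|ab] := eqVneq (p.1.1 ^+ 2 + p.1.2 ^+ 2) 0.
  exists (fun t => (p.1.1, p.1.2 * cos t - p.2 * sin t, p.1.2 * sin t + p.2 * cos t)); split.
    rewrite [X in _ --> X](_ : p = (p.1.1, p.1.2, p.2)); last by case: (p) => -[].
    exact: (cvg_pair (cvg_pair (cvg_cst p.1.1) (cl p.1.2 p.2)) (cr p.1.2 p.2)).
  near=> t; have t0 : 0 < t < pi by near: t.
  split.
    rewrite /S2 /= /dot /=; have cs := cos2Dsin2 t.
    transitivity (p.1.1 * p.1.1 + (p.1.2 * p.1.2 + p.2 * p.2) * (cos t ^+ 2 + sin t ^+ 2)); first by ring.
    by rewrite cs mulr1 addrA.
  move=> e; have e1 := congr1 (fun q : R3 => q.1.2) e; have e2 := congr1 (fun q : R3 => q.2) e.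
  have nz : p.1.2 ^+ 2 + p.2 ^+ 2 != 0.
    move: ab; rewrite !expr2 => ab; apply/eqP => bc.
    by have := sqr_ge0 p.1.2; rewrite expr2 => b2; lra.
  exact: (rotneq _ _ _ nz t0 e1 e2).
exists (fun t => (p.1.1 * cos t - p.1.2 * sin t, p.1.1 * sin t + p.1.2 * cos t, p.2)); split.
  rewrite [X in _ --> X](_ : p = (p.1.1, p.1.2, p.2)); last by case: (p) => -[].
  exact: (cvg_pair (cvg_pair (cl p.1.1 p.1.2) (cr p.1.1 p.1.2)) (cvg_cst p.2)).
near=> t; have t0 : 0 < t < pi by near: t.
split.
  rewrite /S2 /= /dot /=; have cs := cos2Dsin2 t.
  transitivity ((p.1.1 * p.1.1 + p.1.2 * p.1.2) * (cos t ^+ 2 + sin t ^+ 2) + p.2 * p.2); first by ring.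
  by rewrite cs mulr1.
move=> e; have e1 := congr1 (fun q : R3 => q.1.1) e; have e2 := congr1 (fun q : R3 => q.1.2) e.
exact: (rotneq _ _ _ ab t0 e1 e2).
Unshelve. all: by end_near. Qed.

Let ckap N : kap N q @[q --> p] --> kap N p.
Proof.
have kE q : kap N q = N i3 i0 * q.1.1 + N i3 i1 * q.1.2 + N i3 i2 * q.2 + N i3 i3.
  by rewrite /kap mulmx4E !mxE /= mulr1.
rewrite kE; under eq_fun do rewrite kE.
by do !apply: cvgD; try exact: cvg_cst; apply: cvgM => //; exact: cvg_cst.
Qed.

(** Half the chord between [bd N q] and [bd N p], that is, the sine of half their angle. *)
Let half_chord N q : R := Num.sqrt ((1 - dot q p) / (kap N q * kap N p) / 2).

Let half_chord_cvg N : olor N -> half_chord N @ W --> (0 : R)^'.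
Proof.
move=> oN; have k0 := kap_gt0 oN p1.
have pp : dot p p = 1 := p1.
have d1 : (fun q => (1 - dot q p) / (kap N q * kap N p) / 2) @ p --> (0 : R).
  have z : (1 - dot p p) / (kap N p * kap N p) / 2 = 0 :> R by rewrite pp subrr !mul0r.
  rewrite -[X in _ --> X]z; apply: cvgM; last exact: cvg_cst.
  apply: cvgM; last first.
    apply: cvgV; first by rewrite mulf_neq0 ?gt_eqF.
    by apply: cvgM; [exact: ckap|exact: cvg_cst].
  apply: cvgB; first exact: cvg_cst.
  by rewrite /dot; do !apply: cvgD; apply: cvgM => //; exact: cvg_cst.
have c0' : half_chord N @ p --> (0 : R).
  rewrite -[X in _ --> X](@sqrtr0 R).
  exact: (cvg_comp _ _ d1 (@sqrt_continuous R 0)).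
have c0 : half_chord N @ W --> (0 : R) by exact: cvg_within_filter c0'.
have h1 : W (fun q => S2 q /\ q <> p) by exact: withinT.
move=> A A0; have FW : Filter W by apply: within_filter.
have h2 : W (fun q => half_chord N q != 0 -> A (half_chord N q)) := c0 _ A0.
change (W (half_chord N @^-1` A)).
apply: (@filterS _ W FW _ _ _ (filterI h1 h2)) => q [[q1 qp]]; apply.
rewrite gt_eqF// sqrtr_gt0 !divr_gt0// ?mulr_gt0//.
- by rewrite subr_gt0 dot_lt1.
- exact: kap_gt0.
Qed.

Let acos_dot_bd N q : olor N -> S2 q ->
  acos (dot (bd N q) (bd N p)) = 2 * asin (half_chord N q).
Proof.
move=> oN q1; have k0 := kap_gt0 oN p1; have kq := kap_gt0 oN q1.
have d1 : 0 <= 1 - dot q p.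
  by have [->|/dot_lt1 h] := pselect (q = p); [rewrite p1 subrr|have := h q1 p1; lra].
have u0 : 0 <= (1 - dot q p) / (kap N q * kap N p) by rewrite divr_ge0// ltW// mulr_gt0.
have := dot_geN1 (bd_S2 oN q1) (bd_S2 oN p1).
by rewrite dot_bd// => h; rewrite acos_asin//; lra.
Qed.

(** Angles may be replaced by half chords in the limit, and in the quotient of the half chords the
    vanishing factor [1 - dot q p] cancels. *)
Lemma acos_ratio_cvg N1 N2 : olor N1 -> olor N2 ->
  (fun q => acos (dot (bd N2 q) (bd N2 p)) / acos (dot (bd N1 q) (bd N1 p))) @ W -->
  kap N1 p / kap N2 p.
Proof.
move=> o1 o2; have k1 := kap_gt0 o1 p1; have k2 := kap_gt0 o2 p1.
pose G q := asin (half_chord N2 q) / half_chord N2 q *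
   Num.sqrt ((kap N1 q * kap N1 p) / (kap N2 q * kap N2 p)) *
   (asin (half_chord N1 q) / half_chord N1 q)^-1.
have FW : Filter W by apply: within_filter.
have cG : G @ W --> kap N1 p / kap N2 p.
  have sE : kap N1 p / kap N2 p = Num.sqrt ((kap N1 p * kap N1 p) / (kap N2 p * kap N2 p)).
    by rewrite -mulf_div -expr2 sqrtr_sqr ger0_norm// divr_ge0// ltW.
  have a1 : (fun q => asin (half_chord N1 q) / half_chord N1 q) @ W --> (1 : R).
    exact: (cvg_comp _ _ (half_chord_cvg o1) asin_div_cvg).
  have a2 : (fun q => asin (half_chord N2 q) / half_chord N2 q) @ W --> (1 : R).
    exact: (cvg_comp _ _ (half_chord_cvg o2) asin_div_cvg).
  have a3 : (fun q => Num.sqrt ((kap N1 q * kap N1 p) / (kap N2 q * kap N2 p))) @ W -->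
      kap N1 p / kap N2 p.
    apply: cvg_within_filter; rewrite sE.
    apply: (@cvg_comp _ _ _ (fun q => (kap N1 q * kap N1 p) / (kap N2 q * kap N2 p)) Num.sqrt _
      (nbhs ((kap N1 p * kap N1 p) / (kap N2 p * kap N2 p)))); last exact: sqrt_continuous.
    apply: cvgM; first by apply: cvgM; [exact: ckap|exact: cvg_cst].
    apply: cvgV; first by rewrite mulf_neq0 ?gt_eqF.
    by apply: cvgM; [exact: ckap|exact: cvg_cst].
  have := cvgM (cvgM a2 a3) (cvgV (oner_neq0 R) a1).
  by rewrite mul1r invr1 mulr1; exact.
apply: cvg_trans cG; apply: near_eq_cvg.
have : W (fun q => S2 q /\ q <> p) by exact: withinT.
apply: filterS => q [q1 qp]; rewrite /G !acos_dot_bd//.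
have kq1 := kap_gt0 o1 q1; have kq2 := kap_gt0 o2 q1.
have D0 : 0 < 1 - dot q p by rewrite subr_gt0 dot_lt1.
have h1 : 0 < half_chord N1 q by rewrite sqrtr_gt0 !divr_gt0// mulr_gt0.
have h2 : 0 < half_chord N2 q by rewrite sqrtr_gt0 !divr_gt0// mulr_gt0.
have <- : half_chord N2 q / half_chord N1 q =
    Num.sqrt ((kap N1 q * kap N1 p) / (kap N2 q * kap N2 p)).
  have e0 : 0 <= (kap N1 q * kap N1 p) / (kap N2 q * kap N2 p).
    by rewrite divr_ge0// mulr_ge0// ltW.
  apply: (mulIf (lt0r_neq0 h1)); rewrite mulfVK ?gt_eqF// /half_chord -sqrtrM//.
  by congr Num.sqrt; field; rewrite ?(lt0r_neq0 k1) ?(lt0r_neq0 k2) ?(lt0r_neq0 kq1) ?(lt0r_neq0 kq2).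
rewrite invfM invrK.
have [a0|a0] := eqVneq (asin (half_chord N1 q)) 0.
  by rewrite a0 mulr0 invr0 !mulr0 mul0r mulr0.
by field; rewrite a0 !gt_eqF.
Qed.

End limit.

(** The metric [rho z] is the angle seen after [invmx (boost z)], so numerator and denominator are
    angles for two Lorentz maps. *)
Lemma lamE g z p : olor g -> H3 z -> S2 p ->
  lam g z p = kap (invmx (boost z)) p / kap (invmx (boost z) *m g) p.
Proof.
move=> og /olor_boost/olor_invmx oB p1; rewrite /lam.
have oBg := olor_mul oB og.
have PW := punctured_sphere_proper p1.
apply: cvg_lim => //.
apply: cvg_trans (acos_ratio_cvg p1 oB oBg); apply: near_eq_cvg.
have : within (fun q => S2 q /\ q <> p) (nbhs p) (fun q => S2 q /\ q <> p) by exact: withinT.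
by apply: filterS => q [q1 qp]; rewrite /rho -!bd_mul.
Qed.

End expansion_factor.

(** * Images of rays compared with rays *)

Section asymptotic_rays.
Context {R : realType}.
Implicit Types (M : 'M[R]_4) (d u v : 'cV[R]_4) (x : (R * R * R)%type).

Lemma pos_vec1_ge0 x u : S2 x -> timelike u -> 0 <= pos (vec1 x) u.
Proof. by move=> x1 tu; rewrite posC ltW// pos_gt0//; exact: vec1_future. Qed.

(* The vectors [v] and [v + d] with [d] orthogonal to the null vector [X] have
   asymptotic rays [v + s X], [v + d + s X]. *)
Lemma asymptotic x d u (B eps s : R) : S2 x -> timelike u ->
  pos d (vec1 x) = 0 -> (forall i, `|d i 0| <= B) -> 0 < eps -> eps <= 1 -> 1 <= B ->
  6 * B ^+ 2 / eps ^+ 2 <= s ->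
  `|pos d u| <= eps * pos (origin + s *: vec1 x) u.
Proof.
move=> x1 tu dX dB e0 e1 B1 sB.
have P0 := pos_vec1_ge0 x1 tu.
have s6 : 6 * B ^+ 2 <= s * eps ^+ 2 by rewrite -ler_pdivrMr// exprn_gt0.
have B2 : 1 <= B ^+ 2 by rewrite expr_ge1// (le_trans _ B1).
have ee : eps ^+ 2 <= eps by rewrite expr2 ger_pMr.
have s0 : 0 < s.
  by rewrite -(pmulr_lgt0 _ (exprn_gt0 2 e0)) (lt_le_trans _ s6)// mulr_gt0// (lt_le_trans _ B2).
rewrite posDl posZl pos_origin.
have [w0 uu] := tu; rewrite /pos in uu.
have PE : pos (vec1 x) u = u i3 0 - (x.1.1 * u i0 0 + x.1.2 * u i1 0 + x.2 * u i2 0).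
  by rewrite /pos !mxE /=; ring.
have dE : pos d u = d i3 0 * u i3 0 - (d i0 0 * u i0 0 + d i1 0 * u i1 0 + d i2 0 * u i2 0).
  by [].
have dX' : d i3 0 - (d i0 0 * x.1.1 + d i1 0 * x.1.2 + d i2 0 * x.2) = 0.
  by rewrite -dX /pos !mxE /=; ring.
have x1' : x.1.1 * x.1.1 + x.1.2 * x.1.2 + x.2 * x.2 = 1 := x1.
rewrite dE; move: (dB i0) (dB i1) (dB i2) (dB i3); clear dB dE dX x1 tu.
move: (pos (vec1 x) u) PE P0 => P PE P0.
move: (x.1.1) (x.1.2) (x.2) x1' dX' PE => a b c x1 dX PE {x}.
move: (u i0 0) (u i1 0) (u i2 0) (u i3 0) w0 uu PE => u0 u1 u2 w w0 uu PE {u}.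
move: (d i0 0) (d i1 0) (d i2 0) (d i3 0) dX => d0 d1 d2 d3 dX {d} b0 b1 b2 b3.
(* Subtracting [d3] times the null vector from [d] leaves the purely spatial vector [f], orthogonal
   to [x]. *)
pose f0 := d0 - d3 * a; pose f1 := d1 - d3 * b; pose f2 := d2 - d3 * c.
pose T := w + s * P; have sP : 0 <= s * P by rewrite mulr_ge0// ltW.
have T0 : 0 < T by rewrite /T; lra.
pose xu := a * u0 + b * u1 + c * u2; pose fu := f0 * u0 + f1 * u1 + f2 * u2.
have e : d3 * w - (d0 * u0 + d1 * u1 + d2 * u2) = d3 * P - fu.
  by rewrite PE /fu /f0 /f1 /f2; ring.
pose E2 := f0 ^+ 2 + f1 ^+ 2 + f2 ^+ 2.
have fx : f0 * a + f1 * b + f2 * c = 0.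
  transitivity ((d0 * a + d1 * b + d2 * c) - d3 * (a * a + b * b + c * c)).
    by rewrite /f0 /f1 /f2; ring.
  by rewrite x1; lra.
(* Nonnegativity of the Gram determinant of [x], [f] and [u], with [x] of norm one and orthogonal to
   [f]. *)
have gram : fu ^+ 2 <= E2 * (u0 * u0 + u1 * u1 + u2 * u2 - xu ^+ 2).
  rewrite -subr_ge0.
  pose det := a * (f1 * u2 - f2 * u1) - b * (f0 * u2 - f2 * u0) + c * (f0 * u1 - f1 * u0).
  have : (a * a + b * b + c * c) * (E2 * (u0 * u0 + u1 * u1 + u2 * u2) - fu ^+ 2)
     - E2 * xu ^+ 2 + (f0 * a + f1 * b + f2 * c) * (2 * fu * xu - (f0 * a + f1 * b + f2 * c) * (u0 * u0 + u1 * u1 + u2 * u2)) = det ^+ 2.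
    by rewrite /det /E2 /fu /xu; ring.
  rewrite x1 fx => h; have := sqr_ge0 det; rewrite -h; lra.
have E2B : E2 <= 3 * B ^+ 2.
  have -> : E2 = d0 ^+ 2 + d1 ^+ 2 + d2 ^+ 2 - d3 ^+ 2.
    transitivity (d0 ^+ 2 + d1 ^+ 2 + d2 ^+ 2 - 2 * d3 * (d0 * a + d1 * b + d2 * c) + d3 ^+ 2 * (a * a + b * b + c * c)).
      by rewrite /E2 /f0 /f1 /f2; ring.
    have -> : d0 * a + d1 * b + d2 * c = d3 by lra.
    by rewrite x1; ring.
  have q (t : R) : `|t| <= B -> t ^+ 2 <= B ^+ 2.
    by move=> tB; rewrite -[t ^+ 2]real_normK ?num_real// lerXn2r ?nnegrE// (le_trans _ tB).
  by have := q _ b0; have := q _ b1; have := q _ b2; have := sqr_ge0 d3; lra.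
have E20 : 0 <= E2 by rewrite /E2 !addr_ge0 ?sqr_ge0.
have fuT : fu ^+ 2 <= (eps / 2 * T) ^+ 2.
  have h1 : u0 * u0 + u1 * u1 + u2 * u2 - xu ^+ 2 <= P * (2 * w).
    have : P * (w + xu) = w * w - xu ^+ 2 by rewrite PE /xu; ring.
    have : xu <= w by rewrite /xu; lra.
    nra.
  have Pw0 : 0 <= P * (2 * w) by rewrite !mulr_ge0// ltW.
  have h2 : fu ^+ 2 <= 3 * B ^+ 2 * (P * (2 * w)).
    apply: (le_trans gram); apply: (@le_trans _ _ (E2 * (P * (2 * w)))).
      by rewrite ler_wpM2l.
    by rewrite ler_wpM2r.
  (* The arithmetic-geometric mean inequality gains the factor [s^-1]; the constant 6 in the lower
     bound for [s] is what turns the result into [(eps / 2 * T) ^+ 2]. *)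
  have h3 : 4 * (w * (s * P)) <= T ^+ 2.
    by rewrite /T; have := sqr_ge0 (w - s * P); rewrite !expr2; lra.
  rewrite -(ler_pM2l s0) (le_trans (y := 3 * B ^+ 2 * (T ^+ 2 / 2)))//.
    have B20 : 0 <= 3 * B ^+ 2 by lra.
    have := ler_wpM2l (x := s) (ltW s0) h2 => h4; apply: (le_trans h4).
    rewrite (_ : s * _ = 3 * B ^+ 2 * (2 * (w * (s * P)))); last by ring.
    by rewrite ler_wpM2l//; lra.
  rewrite exprMn (_ : s * _ = s * eps ^+ 2 / 4 * T ^+ 2); last by field.
  have T2 := sqr_ge0 T; nra.
have fuA : `|fu| <= eps / 2 * T.
  have eT : 0 <= eps / 2 * T by rewrite mulr_ge0 ?(ltW T0)//; lra.
  by rewrite -(@ler_pXn2r _ 2) ?nnegrE// real_normK ?num_real.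
have dP : `|d3 * P| <= eps / 2 * T.
  rewrite normrM (ger0_norm P0).
  have : B * P <= eps / 2 * (s * P).
    rewrite mulrA ler_wpM2r//.
    have BB : B <= B ^+ 2 by rewrite expr2 ler_peMr// (le_trans _ B1).
    have : s * eps ^+ 2 <= s * eps by rewrite ler_wpM2l// ltW.
    nra.
  have : `|d3| * P <= B * P by rewrite ler_wpM2r.
  have : 0 <= eps / 2 * w by rewrite mulr_ge0 ?(ltW w0)//; lra.
  by rewrite /T mulrDr; lra.
rewrite e (le_trans (ler_normB _ _))//.
by move: fuA dP; rewrite -/T; lra.
Qed.

Lemma kap_le M x : olor M -> S2 x -> kap M x <= 4 * M i3 i3.
Proof.
move=> oM x1; rewrite /kap mulmx4E !mxE /= mulr1.
have le1 (t : R) : t * t <= 1 -> `|t| <= 1.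
  by move=> tt; rewrite -(@expr_le1 _ 2)// real_normK ?num_real.
move: x1; rewrite /S2 /dot /= => x1.
have := (sqr_ge0 x.1.1, sqr_ge0 x.1.2, sqr_ge0 x.2); rewrite !expr2 => -[[s1 s2] s3].
have m0 : 0 <= M i3 i3 by case: oM => _ /ltW.
have b (i : 'I_4) (t : R) : `|t| <= 1 -> M i3 i * t <= M i3 i3.
  move=> t1; rewrite (le_trans (ler_norm _))// normrM -[leRHS]mulr1.
  by rewrite ler_pM// olor_entry.
have := b i0 _ (le1 x.1.1 ltac:(lra)); have := b i1 _ (le1 x.1.2 ltac:(lra)).
have := b i2 _ (le1 x.2 ltac:(lra)); lra.
Qed.

Lemma kap_inv M x : olor M -> S2 x -> kap M x * kap (invmx M) (bd M x) = 1.
Proof.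
move=> oM x1; rewrite -kap_mul// mulVmx ?olor_unit// /kap mul1mx mxE //.
Qed.

(** [kap M x] times the image of [origin + t *: vec1 x] equals [kap M x *: (M *m origin)] plus
    [t * kap M x ^+ 2] times the null vector of [bd M x]. Its offset from the ray based at [origin]
    is Lorentz orthogonal to that null vector, since both base vectors pair to [1] with it, so the
    two rays are asymptotic. *)
Lemma ray_compare M x u (C eps s t : R) : olor M -> S2 x -> timelike u ->
  1 <= C -> M i3 i3 <= C -> 0 < eps -> eps <= 1 ->
  6 * (4 * C ^+ 2 + 1) ^+ 2 / eps ^+ 2 <= s ->
  s <= t * kap M x ^+ 2 <= (1 + eps) * s ->
  (1 - eps) * pos (origin + s *: vec1 (bd M x)) u <=
  kap M x * pos (M *m (origin + t *: vec1 x)) u <=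
  (1 + 2 * eps) * pos (origin + s *: vec1 (bd M x)) u.
Proof.
move=> oM x1 tu C1 MC e0 e1 sB st; set A := pos (M *m _) u; set B := pos (origin + _) u.
set kp := kap M x in st *.
have k0 : 0 < kp := kap_gt0 oM x1; have x1' := bd_S2 oM x1.
pose X' := vec1 (bd M x); pose d := kp *: (M *m origin) - origin.
have AE : kp * A = pos d u + B + (t * kp ^+ 2 - s) * pos X' u.
  rewrite /A /B /d mulmxDr -scalemxAr -(vec1_bd (M := M)) ?gt_eqF//.
  by rewrite -/kp -/X' posBl !posDl !posZl; ring.
have k4 : kp <= 4 * C by rewrite (le_trans (kap_le oM x1))// ler_wpM2l.
have dX : pos d X' = 0.
  have : pos (M *m origin) (M *m vec1 x) = 1 by rewrite pos_olor// pos_origin mxE.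
  rewrite -(vec1_bd (M := M)) ?gt_eqF// posZr -/X' -/kp => h.
  by rewrite /d posBl posZl h pos_origin mxE /= subrr.
have dB i : `|d i 0| <= 4 * C ^+ 2 + 1.
  have -> : d i 0 = kp * (M *m origin) i 0 - (origin : 'cV[R]_4) i 0 by rewrite !mxE.
  rewrite (le_trans (ler_normB _ _))// lerD//.
    rewrite normrM (ger0_norm (ltW k0)) expr2 mulrA ler_pM ?(ltW k0)//.
    have -> : (M *m origin) i 0 = M i i3 by rewrite mulmx4E !mxE /=; ring.
    exact: le_trans (olor_entry _ _ oM) MC.
  by rewrite mxE; case: (i == i3); rewrite ?normr1 ?normr0.
have B1 : 1 <= 4 * C ^+ 2 + 1 by have := sqr_ge0 C; lra.
have as_ := asymptotic x1' tu dX dB e0 e1 B1 sB; rewrite -/B in as_.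
have P0 := pos_vec1_ge0 x1' tu; rewrite -/X' in P0.
have s0 : 0 <= s.
  by apply: le_trans sB; rewrite divr_ge0 ?sqr_ge0// mulr_ge0// sqr_ge0.
have Pb : s * pos X' u <= B.
  by rewrite /B posDl posZl pos_origin lerDr; case: tu => /ltW.
have h1 : 0 <= (t * kp ^+ 2 - s) * pos X' u by rewrite mulr_ge0//; lra.
have h2 : (t * kp ^+ 2 - s) * pos X' u <= eps * B.
  apply: (@le_trans _ _ (eps * s * pos X' u)); first by rewrite ler_wpM2r//; lra.
  by rewrite -mulrA ler_wpM2l// ltW.
by rewrite AE; move: as_; rewrite ler_norml; lra.
Qed.

End asymptotic_rays.

(** * Weighted sums over the orbit *)

Section orbit_weights.
Context {R : realType}.
Variable N : seq letter -> 'M[R]_4.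
Hypothesis oN : forall w, olor (N w).
Hypothesis N_mul : forall u v, N (freered (u ++ v)) = N u *m N v.
Hypothesis sumN : exists C : R, forall ws : seq (seq letter), uniq ws -> all reduced ws ->
    \sum_(w <- ws) (N w i3 i3 ^+ 64)^-1 <= C.
Implicit Types (y : 'cV[R]_4) (b : seq letter -> R).

Definition orb w := N w *m origin.

Lemma orb_timelike w : timelike (orb w).
Proof. exact: timelike_col3. Qed.

Definition wt y w : R := (pos y (orb w) ^+ 64)^-1.

Local Notation D := [set w : seq letter | reduced w].

Definition wsum y b : \bar R := (\esum_(w in D) (wt y w * b w)%:E)%E.

Lemma wt_ge0 y w : 0 <= wt y w.
Proof. by rewrite invr_ge0 -[64%N]/(2 * 32)%N exprM exprn_ge0// sqr_ge0. Qed.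

Lemma wsum_ge0 y b : (forall w, 0 <= b w) -> (0 <= wsum y b)%E.
Proof. by move=> b0; apply: esum_ge0 => w _; rewrite lee_fin mulr_ge0// wt_ge0. Qed.

(** Exact equivariance: invariance of the Lorentz form moves [N g] onto the orbit, and left
    translation permutes the reduced words. *)
Lemma wsum_action g y b : (forall w, 0 <= b w) ->
  wsum (N g *m y) b = wsum y (fun w => b (freered (g ++ w))).
Proof.
move=> b0; rewrite /wsum (reindex_esum D D (fun w => freered (g ++ w))).
- apply: eq_esum => w _; rewrite /wt /orb N_mul -mulmxA pos_olor//.
- split.
  + by move=> w _ /=; exact: freered_reduced.
  + by move=> w w' /set_mem rw /set_mem rw' e; rewrite -(freered_winvK g rw) e freered_winvK.
  + move=> w /= rw; exists (freered (winv g ++ w)); first exact: freered_reduced.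
    exact: freered_winvKr.
Qed.

Lemma wsum_le y y' b (c : R) : (forall w, 0 <= b w) -> 0 < c ->
  (forall w, 0 < pos y (orb w)) ->
  (forall w, pos y (orb w) <= c * pos y' (orb w)) ->
  (wsum y' b <= (c ^+ 64)%:E * wsum y b)%E.
Proof.
move=> b0 c0 py cmp.
have c640 : 0 <= c ^+ 64 by rewrite exprn_ge0// ltW.
have cw w : wt y' w * b w <= c ^+ 64 * (wt y w * b w).
  rewrite mulrA ler_wpM2r//.
  have py' : 0 < pos y' (orb w) by rewrite -(pmulr_rgt0 _ c0) (lt_le_trans (py w)).
  rewrite /wt -[leLHS]mul1r ler_pdivrMr ?exprn_gt0// mulrAC ler_pdivlMr ?exprn_gt0// mul1r.
  by rewrite -exprMn lerXn2r ?nnegrE ?(ltW (py w))// mulr_ge0// ltW.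
apply: ub_ereal_sup => _ [A [finA AD] <-].
apply: (@le_trans _ _ ((c ^+ 64)%:E * \sum_(w \in A) (wt y w * b w)%:E)%E).
  by rewrite !fsbig_finite//= !sumEFin -EFinM lee_fin mulr_sumr ler_sum.
rewrite lee_wpmul2l ?lee_fin//; apply: esum_ge; exists A => //.
Qed.

Lemma wsum_fin y b : (forall w, 0 <= b w <= 1) ->
  (forall w, (N w) i3 i3 <= pos y (orb w)) -> wsum y b \is a fin_num.
Proof.
move=> b01 yo; rewrite ge0_fin_numE; last by apply: wsum_ge0 => w; case/andP : (b01 w).
have [C HC] := sumN.
apply: (@le_lt_trans _ _ C%:E); last exact: ltry.
apply: ub_ereal_sup => _ [A [finA AD] <-].
rewrite fsbig_finite//= sumEFin lee_fin.
have aA : all reduced (finmap.enum_fset (fset_set A)).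
  by apply/allP => w; rewrite in_fset_set// => /set_mem/AD.
apply: le_trans (HC _ (finmap.fset_uniq _) aA).
apply: ler_sum => w _; rewrite -[leRHS]mulr1.
have n1 := olor33_ge1 (oN w); have n0 : 0 < N w i3 i3 by exact: lt_le_trans n1.
have /andP[b0 b1] := b01 w.
rewrite ler_pM ?wt_ge0// /wt lef_pV2 ?posrE ?exprn_gt0// ?(lt_le_trans n0)//.
by rewrite lerXn2r ?nnegrE ?(ltW n0)// (le_trans (ltW n0)).
Qed.

Lemma wsum_gt0 y : (0 < pos y (orb [::])) -> (0 < wsum y (cst 1%R))%E.
Proof.
move=> p0; apply: (@lt_le_trans _ _ (wt y [::])%:E).
  by rewrite lte_fin invr_gt0 exprn_gt0.
apply: esum_ge; exists [set [::]]; first by split => // _ ->.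
by rewrite fsbig_set1 mulr1.
Qed.

Lemma wsum_partition (I : finType) (P : pred I) y (b : I -> seq letter -> R) :
  (forall i w, 0 <= b i w) ->
  (\sum_(i | P i) wsum y (b i) = wsum y (fun w => (\sum_(i | P i) b i w)%R))%E.
Proof.
move=> b0; rewrite /wsum -esum_sum; last first.
  by move=> w i _ _; rewrite lee_fin mulr_ge0// wt_ge0.
by apply: eq_esum => w _; rewrite sumEFin mulr_sumr.
Qed.

Lemma wsumD y b b' : (forall w, 0 <= b w) -> (forall w, 0 <= b' w) ->
  (wsum y b + wsum y b' = wsum y (fun w => (b w + b' w)%R))%E.
Proof.
move=> b0 b0'; rewrite /wsum -esumD.
- by apply: eq_esum => w _; rewrite -EFinD mulrDr.
- by move=> w _; rewrite lee_fin mulr_ge0// wt_ge0.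
- by move=> w _; rewrite lee_fin mulr_ge0// wt_ge0.
Qed.

(** Words are countable, so the sum over them becomes a series indexed by their codes. *)
Lemma measurable_wsum d (T : measurableType d) (y : T -> 'cV[R]_4) b :
  (forall w, 0 <= b w) ->
  (forall w, measurable_fun setT (fun x => wt (y x) w)) ->
  measurable_fun setT (fun x => wsum (y x) b).
Proof.
move=> b0 mw.
pose G x (n : nat) : \bar R := if pickle_inv n is Some w then
  (if reduced w then (wt (y x) w * b w)%:E else 0%E) else 0%E.
have G0 x n : (0 <= G x n)%E.
  by rewrite /G; case: pickle_inv => // w; case: ifP => // _; rewrite lee_fin mulr_ge0// wt_ge0.
have -> : (fun x => wsum (y x) b) = (fun x => \sum_(n <oo) G x n)%E.
  apply/funext => x; rewrite nneseries_esumT//.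
  transitivity (\esum_(n in @pickle _ @` D) G x n)%E.
    rewrite (reindex_esum D (@pickle _ @` D) (@pickle _)).
    - by apply: eq_esum => w /= rw; rewrite /G pickleK_inv rw.
    - split; [by move=> w Dw; exists w| |by []].
      by move=> w w' _ _; exact: (pcan_inj (@pickleK _)).
  rewrite esum_mkcond; apply: eq_esum => n _; case: ifPn => //.
  rewrite notin_setE /= => nD; rewrite /G; case e : (pickle_inv n) => [w|//].
  case: ifP => // rw; exfalso; apply: nD; exists w => //.
  by have := @pickle_invK (seq letter) n; rewrite e.
apply: ge0_emeasurable_sum => [n x _ _|n _]; first exact: G0.
rewrite /G; case: pickle_inv => [w|]; last exact: measurable_cst.
case: (reduced w); last exact: measurable_cst.
by apply/measurable_EFinP; apply: measurable_funM => //; exact: mw.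
Qed.

End orbit_weights.

(** Shifting by one exchanges one end term for another, both in [[0, 1]]. *)
Lemma average_shift (R : realType) (phi : nat -> R) (m n : nat) :
  (forall j, 0 <= phi j <= 1) ->
  `|\sum_(j < n) phi (j + m)%N - \sum_(j < n) phi j| <= m%:R.
Proof.
move=> p01; elim: m => [|m IH].
  by rewrite (eq_bigr (fun j : 'I_n => phi j)) ?subrr ?normr0// => j _; rewrite addn0.
have e : \sum_(j < n) phi (j + m.+1)%N + phi m = \sum_(j < n) phi (j + m)%N + phi (n + m)%N.
  rewrite -[RHS](big_ord_recr n (fun j => phi (j + m)%N)) big_ord_recl /= add0n addrC.
  by congr (_ + _); apply: eq_bigr => j _; rewrite /bump /= add1n addSnnS.
have := p01 m; have := p01 (n + m)%N; move: IH; rewrite -natr1 !ler_norml.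
by move: e; lra.
Qed.

(** Only the sequences shifted by [L] and by [m] are close; undoing both shifts costs
    [L + m <= 3 * L] before division by [n]. *)
Lemma average_compare (R : realType) (phi phi' : nat -> R) (L m n : nat) (d : R) :
  (forall j, 0 <= phi j <= 1) -> (forall j, 0 <= phi' j <= 1) ->
  (forall j, `|phi' (j + L)%N - phi (j + m)%N| <= d) -> (m <= 2 * L)%N -> (0 < n)%N ->
  `|n%:R^-1 * \sum_(j < n) phi' j - n%:R^-1 * \sum_(j < n) phi j| <= d + 3 * L%:R / n%:R.
Proof.
move=> p01 p01' pp mL n0; have nR : 0 < n%:R :> R by rewrite ltr0n.
have h1 := average_shift L n p01'; have h2 := average_shift m n p01.
have h3 : `|\sum_(j < n) phi' (j + L)%N - \sum_(j < n) phi (j + m)%N| <= n%:R * d.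
  rewrite -sumrB (le_trans (ler_norm_sum _ _ _))//.
  apply: le_trans; first by apply: ler_sum => j _; exact: pp.
  by rewrite sumr_const card_ord mulr_natl.
have mL' : m%:R <= 2 * L%:R :> R by rewrite -natrM ler_nat.
rewrite -mulrBr normrM ger0_norm ?invr_ge0 ?(ltW nR)// mulrC ler_pdivrMr//.
rewrite mulrDl mulfVK ?gt_eqF//.
by move: h1 h2 h3; rewrite !ler_norml [n%:R * d]mulrC; lra.
Qed.

(** * Almost equivariant densities on the sphere *)

Section approximate.
Context {R : realType}.
Local Notation R3 := (R * R * R)%type.
Variable N : seq letter -> 'M[R]_4.
Hypothesis oN : forall w, olor (N w).
Hypothesis N_mul : forall u v, N (freered (u ++ v)) = N u *m N v.
Hypothesis sumN : exists C : R, forall ws : seq (seq letter), uniq ws -> all reduced ws ->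
    \sum_(w <- ws) (N w i3 i3 ^+ 64)^-1 <= C.

Implicit Types (y : 'cV[R]_4) (b : seq letter -> R) (x : R3).

Definition Phi y b : R := fine (wsum N y b) / fine (wsum N y (cst 1)).
Definition good y := (forall w, 0 < pos y (orb N w)) /\
  (forall b, (forall w, 0 <= b w <= 1) -> wsum N y b \is a fin_num).
(** A timelike vector on the line of a point of the geodesic ray from [origin] to [x]. Rescaling it
    onto the hyperboloid would multiply all weights by a common factor, which cancels in [Phi]. *)
Definition Yp (t : R) x := origin + t *: vec1 x.

Lemma Yp_timelike t x : S2 x -> 0 <= t -> timelike (Yp t x).
Proof.
move=> x1 t0; split; first by rewrite !mxE /= mulr1; lra.
rewrite /Yp !posDl !posDr !posZl !posZr (pos_vec1 x1) !pos_origin posC pos_origin !mxE /=.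
by lra.
Qed.

Lemma good_Yp t x : S2 x -> 0 <= t -> good (Yp t x).
Proof.
move=> x1 t0; split=> [w|b b01].
  by apply: pos_gt0; [exact: Yp_timelike|apply: timelike_future; exact: orb_timelike].
apply: (wsum_fin oN sumN b01) => w; rewrite posDl posZl pos_origin.
have -> : orb N w i3 0 = N w i3 i3 by rewrite mulmx4E !mxE /=; ring.
by rewrite lerDl mulr_ge0// pos_vec1_ge0//; exact: orb_timelike.
Qed.

Lemma good_action g t x : S2 x -> 0 <= t -> good (N g *m Yp t x).
Proof.
move=> x1 t0; split=> [w|b b01].
  apply: pos_gt0; last by apply: timelike_future; exact: orb_timelike.
  by apply: olor_timelike => //; exact: Yp_timelike.
rewrite (wsum_action oN N_mul); last by move=> w; case/andP : (b01 w).
by have [_] := good_Yp x1 t0; apply => w; exact: b01.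
Qed.

Let cst01 (w : seq letter) : 0 <= cst (1 : R) w <= 1.
Proof. by rewrite /= ler01 lexx. Qed.

Lemma total_gt0 y : good y -> 0 < fine (wsum N y (cst 1)).
Proof.
move=> [py fy]; rewrite fine_gt0// (wsum_gt0 (py [::])) /=.
by rewrite -ge0_fin_numE ?fy//; apply: wsum_ge0 => w; rewrite /= ler01.
Qed.

Lemma wsum_fine_bounds y b : good y -> (forall w, 0 <= b w <= 1) ->
  0 <= fine (wsum N y b) <= fine (wsum N y (cst 1)).
Proof.
move=> gy b01; have [_ fy] := gy; apply/andP; split.
  by apply: fine_ge0; apply: wsum_ge0 => w; case/andP : (b01 w).
rewrite fine_le ?fy//; apply: le_esum => w _; rewrite lee_fin ler_wpM2l ?wt_ge0//.
by case/andP : (b01 w).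
Qed.

Lemma Phi01 y b : good y -> (forall w, 0 <= b w <= 1) -> 0 <= Phi y b <= 1.
Proof.
move=> gy b01; have T0 := total_gt0 gy; have /andP[s0 s1] := wsum_fine_bounds gy b01.
by rewrite /Phi divr_ge0 ?(ltW T0)// ler_pdivrMr// mul1r.
Qed.

Let fine_wsum_le y y' b (c : R) : good y -> good y' -> (forall w, 0 <= b w <= 1) ->
  0 < c -> (forall w, pos y (orb N w) <= c * pos y' (orb N w)) ->
  fine (wsum N y' b) <= c ^+ 64 * fine (wsum N y b).
Proof.
move=> [py fy] [_ fy'] b01 c0 cmp.
have b0 w : 0 <= b w by case/andP : (b01 w).
have := wsum_le b0 c0 py cmp.
rewrite -(fineK (fy _ b01)) -(fineK (fy' _ b01)) -EFinM lee_fin.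
by rewrite (fineK (fy _ b01)) (fineK (fy' _ b01)).
Qed.

(** Numerator and denominator change by factors [c1 ^+ 64] and [c2 ^+ 64], and [Phi <= 1] turns the
    ratio bound into a difference. Only the product [c1 * c2] enters, so a rescaling of [y] has no
    effect. *)
Lemma Phi_compare y y' b (c1 c2 : R) : good y -> good y' ->
  (forall w, 0 <= b w <= 1) -> 0 < c1 -> 0 < c2 -> 1 <= c1 * c2 ->
  (forall w, pos y (orb N w) <= c1 * pos y' (orb N w)) ->
  (forall w, pos y' (orb N w) <= c2 * pos y (orb N w)) ->
  `|Phi y b - Phi y' b| <= (c1 * c2) ^+ 64 - 1.
Proof.
move=> gy gy' b01 c10 c20 c12 h1 h2.
have T0 := total_gt0 gy; have T0' := total_gt0 gy'.
have S1 := fine_wsum_le gy gy' b01 c10 h1; have S2 := fine_wsum_le gy' gy b01 c20 h2.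
have T1 := fine_wsum_le gy gy' cst01 c10 h1; have T2 := fine_wsum_le gy' gy cst01 c20 h2.
have /andP[p0 p1] := Phi01 gy b01; have /andP[p0' p1'] := Phi01 gy' b01.
have /andP[s0 _] := wsum_fine_bounds gy b01; have /andP[s0' _] := wsum_fine_bounds gy' b01.
have r1 : 1 <= (c1 * c2) ^+ 64 by rewrite expr_ge1// mulr_ge0// ltW.
have c10' : 0 <= c1 ^+ 64 by rewrite exprn_ge0// ltW.
have c20' : 0 <= c2 ^+ 64 by rewrite exprn_ge0// ltW.
have key (S T S' T' a a' : R) : 0 < T -> 0 < T' -> 0 <= S' -> 0 <= a -> 0 <= a' ->
    S <= a * S' -> T' <= a' * T -> S / T <= a' * a * (S' / T').
  move=> t0 t0' s0'' a0 a0' hS hT; rewrite ler_pdivrMr// mulrA mulrAC ler_pdivlMr//.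
  apply: (@le_trans _ _ (a * S' * T')); first by rewrite ler_wpM2r// ltW.
  apply: (@le_trans _ _ (a * S' * (a' * T))); first by rewrite ler_wpM2l// mulr_ge0.
  by rewrite le_eqVlt; apply/orP; left; apply/eqP; ring.
have k1 := key _ _ _ _ _ _ T0 T0' s0' c20' c10' S2 T1.
have k2 := key _ _ _ _ _ _ T0' T0 s0 c10' c20' S1 T2.
rewrite -/(Phi y b) -/(Phi y' b) -exprMn in k1; rewrite -/(Phi y b) -/(Phi y' b) -exprMn mulrC [c2 * c1]mulrC in k2.
move: k1 k2 r1; set r := (c1 * c2) ^+ 64 => k1 k2 r1.
have m1 : (r - 1) * Phi y' b <= r - 1 by rewrite -[leRHS]mulr1 ler_wpM2l// subr_ge0.
have m2 : (r - 1) * Phi y b <= r - 1 by rewrite -[leRHS]mulr1 ler_wpM2l// subr_ge0.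
by rewrite ler_norml; lra.
Qed.

Section fixed_level.
Variable k : nat.
Implicit Types p : k.-tuple letter.

Definition cyl p (w : seq letter) : R := (tend k w == p)%:R.

Lemma cyl01 p w : 0 <= cyl p w <= 1.
Proof. by rewrite /cyl; case: eqP; rewrite ?lexx ?ler01. Qed.

Lemma cyl_sum (P : pred (k.-tuple letter)) w : \sum_(p | P p) cyl p w = (P (tend k w))%:R.
Proof.
rewrite /cyl; case: (boolP (P (tend k w))) => Pw.
  rewrite (bigD1 (tend k w))//= eqxx big1 ?addr0// => p /andP[_].
  by rewrite eq_sym => /negbTE ->.
by rewrite big1// => p Pp; case: eqP => // e; move: Pw; rewrite e Pp.
Qed.

Lemma Phi_partition y : good y -> \sum_p Phi y (cyl p) = 1.
Proof.
move=> gy; have T0 := total_gt0 gy; have [_ fy] := gy.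
rewrite /Phi -mulr_suml sum_fine; last by move=> p _; apply: fy; exact: cyl01.
have c0 p w : 0 <= cyl p w by case/andP : (cyl01 p w).
rewrite (wsum_partition N predT y c0).
rewrite (_ : wsum N y _ = wsum N y (cst 1)) ?divff ?gt_eqF//.
by apply: eq_esum => w _; rewrite cyl_sum.
Qed.

(** By [tend_action] every word is counted exactly once, either by its own cylinder or by that of
    its translate by [g]. *)
Lemma Phi_relation g p t x : relation_k g p -> S2 x -> 0 <= t ->
  Phi (Yp t x) (cyl p) + \sum_(p' | Sset g p p') Phi (N g *m Yp t x) (cyl p') = 1.
Proof.
move=> rgp x1 t0; have gy := good_Yp x1 t0; have gy' := good_action g x1 t0.
have T0 := total_gt0 gy; have [_ fy] := gy; have [_ fy'] := gy'.
have c0 p' w : 0 <= cyl p' w by case/andP : (cyl01 p' w).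
have totE : wsum N (N g *m Yp t x) (cst 1) = wsum N (Yp t x) (cst 1).
  by rewrite (wsum_action oN N_mul)// => w; rewrite /= ler01.
rewrite /Phi totE -mulr_suml -mulrDl sum_fine; last by move=> p' _; apply: fy'; exact: cyl01.
under eq_bigr do rewrite (wsum_action oN N_mul _ _ (c0 _)).
rewrite (wsum_partition N _ _ (fun p' w => c0 p' (freered (g ++ w)))).
have c01 w : 0 <= \sum_(p' | Sset g p p') cyl p' (freered (g ++ w)) <= 1.
  by rewrite cyl_sum; case: Sset; rewrite ?lexx ?ler01.
rewrite -fineD ?fy//; last exact: cyl01.
rewrite (wsumD N _ (c0 p) (fun w => (andP (c01 w)).1)).
rewrite (_ : wsum N _ _ = wsum N (Yp t x) (cst 1)) ?divff ?gt_eqF//.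
apply: eq_esum => w _; rewrite cyl_sum /cyl (tend_action w rgp).
by case: Sset; rewrite /= ?add0r ?addr0.
Qed.

End fixed_level.

(** The measures live on R^3, so the densities must be nonnegative with sum one off the sphere as
    well; there they take their value at an arbitrary point of it. *)
Definition sretract x : R3 := if dot x x == 1 then x else (1, 0, 0).

Lemma sretract_S2 x : S2 (sretract x).
Proof.
rewrite /sretract; case: eqP => // _.
by rewrite /S2 /dot /= mul0r !addr0 mulr1.
Qed.

Lemma sretract_id x : S2 x -> sretract x = x.
Proof. by rewrite /S2 /sretract /= => ->; rewrite eqxx. Qed.

Let mR3X : [/\ measurable_fun setT (fun x : R3 => x.1.1), measurable_fun setT (fun x : R3 => x.1.2) &
  measurable_fun setT (fun x : R3 => x.2)].
Proof.
split; [exact: (measurableT_comp measurable_fst measurable_fst)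
 |exact: (measurableT_comp measurable_snd measurable_fst)|exact: measurable_snd].
Qed.

Lemma measurable_sretract : measurable_fun setT sretract.
Proof.
have [m1 m2 m3] := mR3X.
apply: measurable_fun_ifT; [|exact: measurable_id|exact: measurable_cst].
apply: measurable_fun_eqr; last exact: measurable_cst.
by rewrite /dot; do !apply: measurable_funD; exact: measurable_funM.
Qed.

Let measurable_Phi t b : (forall w, 0 <= b w) ->
  measurable_fun setT (fun x : R3 => Phi (Yp t (sretract x)) b).
Proof.
move=> b0; have [m1 m2 m3] := mR3X.
have mp w : measurable_fun setT (fun x : R3 => pos (Yp t (sretract x)) (orb N w)).
  set u := orb N w.
  have mq : measurable_fun setT (fun x : R3 => u i3 0 + t * (u i3 0 - (x.1.1 * u i0 0 + x.1.2 * u i1 0 + x.2 * u i2 0))).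
    apply: measurable_funD => //; apply: measurable_funM => //; apply: measurable_funB => //.
    by do !apply: measurable_funD; exact: measurable_funM.
  rewrite (_ : (fun x => _) = (fun x : R3 => u i3 0 + t * (u i3 0 - (x.1.1 * u i0 0 + x.1.2 * u i1 0 + x.2 * u i2 0))) \o sretract).
    exact: (measurableT_comp mq measurable_sretract).
  by apply/funext => x; rewrite /= posDl posZl pos_origin /pos !mxE /=; ring.
have mwt w : measurable_fun setT (fun x : R3 => wt N (Yp t (sretract x)) w).
  by apply: (measurableT_comp (@measurable_inv R)); exact: measurable_funX.
have mS b' : (forall w, 0 <= b' w) -> measurable_fun setT (fun x : R3 => fine (wsum N (Yp t (sretract x)) b')).
  move=> b0'; apply: measurableT_comp; first exact: fine_measurable.
  exact: (measurable_wsum b0' mwt).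
apply: measurable_funM; first exact: mS.
by apply: (measurableT_comp (@measurable_inv R)); apply: mS => w; rewrite /= ler01.
Qed.

(** One bound for all words of length at most [k], so that the later constants do not depend on the
    relation. By domination of entries, a letter multiplies the bound by at most [4 * S]. *)
Let word_bound k : exists C : R, 1 <= C /\
  forall g, (size g <= k)%N -> reduced g -> N g i3 i3 <= C.
Proof.
elim: k => [|k [C [C1 HC]]].
  exists (Num.max 1 (N [::] i3 i3)); split; first by rewrite le_max lexx.
  by move=> g; rewrite leqn0 => /nilP -> _; rewrite le_max lexx orbT.
have n0 w : 0 <= N w i3 i3 by case: (oN w) => _ /ltW.
pose S := \sum_a N [:: a] i3 i3.
exists (C + 4 * S * C); split.
  by rewrite (le_trans C1)// lerDl !mulr_ge0// ?sumr_ge0// (le_trans _ C1).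
have S0 : 0 <= S by rewrite sumr_ge0.
have C0 : 0 <= C by rewrite (le_trans _ C1).
case=> [|a g] sg rg; first by rewrite (le_trans (HC [::] _ _))// lerDl !mulr_ge0.
have rg' : reduced g by case: g rg {sg} => // c g /andP[].
have -> : N (a :: g) = N [:: a] *m N g by rewrite -N_mul cat1s freered_id.
have HS : N [:: a] i3 i3 <= S by rewrite /S (bigD1 a)//= lerDl sumr_ge0.
have Hg := HC g sg rg'.
have t (i : 'I_4) : N [:: a] i3 i * N g i i3 <= S * C.
  rewrite (le_trans (ler_norm _))// normrM ler_pM//.
    exact: le_trans (olor_entry _ _ (oN _)) HS.
  exact: le_trans (olor_entry _ _ (oN _)) Hg.
by rewrite mulmx44E; have := t i0; have := t i1; have := t i2; have := t i3; lra.
Qed.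

Let small_ratio (eta : R) : 0 < eta -> exists e : R, [/\ 0 < e, e <= 2^-1 &
  ((1 + 2 * e) / (1 - e)) ^+ 64 <= 1 + eta].
Proof.
move=> eta0.
have cf : (fun e : R => ((1 + 2 * e) / (1 - e)) ^+ 64) @ (0 : R)^'+ --> (1 : R).
  have h0 : (fun e : R => (1 + 2 * e) / (1 - e)) @ (0 : R) --> (1 : R).
    have z : (1 + 2 * 0) / (1 - 0) = 1 :> R by rewrite mulr0 addr0 subr0 divr1.
    rewrite -[X in _ --> X]z; apply: cvgM.
      by apply: cvgD; [exact: cvg_cst|apply: cvgM; [exact: cvg_cst|exact: cvg_id]].
    apply: cvgV; first by rewrite subr0 oner_eq0.
    by apply: cvgB; [exact: cvg_cst|exact: cvg_id].
  apply: cvg_at_right_filter; rewrite -[X in _ --> X](expr1n _ 64).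
  apply: (@cvg_comp _ _ _ _ (fun y : R => y ^+ 64) _ (nbhs (1 : R)) _ h0).
  exact: exprn_continuous.
have h1 : \forall e \near (0 : R)^'+, ((1 + 2 * e) / (1 - e)) ^+ 64 <= 1 + eta.
  have := cf; move=> /cvgrPdist_le/(_ _ eta0); apply: filterS => e.
  by rewrite ler_norml; lra.
have h2 : \forall e \near (0 : R)^'+, 0 < e by exact: nbhs_right_gt.
have h3 : \forall e \near (0 : R)^'+, e < 2^-1 by apply: nbhs_right_lt; lra.
have PT : ProperFilter (0 : R)^'+ by exact: at_right_proper_filter.
have [e [[e1 e2] e3]] := @filter_ex _ _ PT _ (filterI (filterI h1 h2) h3).
by exists e; split => //; exact: ltW.
Qed.

Let pow_unbounded (q A : R) : 1 < q -> exists L : nat, A <= q ^+ L.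
Proof.
move=> q1; pose e := q - 1; have e0 : 0 < e by rewrite /e; lra.
have bern n : 1 + n%:R * e <= q ^+ n.
  elim: n => [|n IH]; first by rewrite expr0 mul0r addr0.
  rewrite exprS (le_trans (y := q * (1 + n%:R * e)))//; last by rewrite ler_wpM2l//; lra.
  have n0 : 0 <= n%:R * e ^+ 2 by rewrite mulr_ge0// sqr_ge0.
  have -> : q = 1 + e by rewrite /e; ring.
  by rewrite -natr1; move: n0; rewrite expr2; lra.
exists (Num.truncn (A / e)).+1; apply: le_trans (bern _).
have := truncnS_gt (A / e); rewrite ltr_pdivrMr// => h.
by rewrite (le_trans (ltW h))// lerDr.
Qed.

Lemma approximate_densities (k : nat) (dlt : R) : 0 < dlt ->
  exists f : k.-tuple letter -> R3 -> R,
  [/\ forall p, measurable_fun setT (f p), forall p x, 0 <= f p x,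
      forall x, \sum_p f p x = 1,
      forall (p : k.-tuple letter) x, ~~ reduced p -> f p x = 0 &
      forall g (p : k.-tuple letter), relation_k g p -> forall x, S2 x ->
        `|f p x + \sum_(p' | Sset g p p') f p' (bd (N g) x) - 1| <= dlt].
Proof.
move=> dlt0; have [C [C1 HC]] := word_bound k.
(* [K] bounds the number of terms in the sum over [Sset g p]. Each is allowed the error
   [dlt / (K + 1)], half for comparing rays and half for averaging. *)
pose K : R := #|{: k.-tuple letter}|%:R.
have K1 : 0 <= K by rewrite ler0n.
have K2 : 0 < K + 1 by lra.
have [e [e0 e12 er]] := small_ratio (divr_gt0 dlt0 (mulr_gt0 (ltr0n R 2) K2)).
pose c := (1 + 2 * e) / (1 - e).
have c1 : 1 <= c by rewrite ler_pdivlMr ?mul1r; lra.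
pose q := 1 + e; have q1 : 1 < q by rewrite /q; lra.
have q0 : 0 < q by lra.
(* The threshold of [ray_compare] for the error [e], valid for all words of length at most [k]. *)
pose tau0 := 6 * (4 * C ^+ 2 + 1) ^+ 2 / e ^+ 2.
have tau00 : 0 <= tau0 by rewrite divr_ge0 ?sqr_ge0// mulr_ge0// sqr_ge0.
(* [16 * C ^+ 2] bounds [kap ^+ 2] and its inverse, so in powers of [q] the factor [kap ^+ 2] is a
   shift by at most [L] either way. *)
have [L HL] := pow_unbounded (16 * C ^+ 2) q1.
pose n := (Num.truncn (3 * L%:R * (2 * (K + 1)) / dlt)).+1.
have n0 : 0 < n%:R :> R by rewrite ltr0n.
have nL : 3 * L%:R / n%:R <= dlt / (2 * (K + 1)).
  have := truncnS_gt (3 * L%:R * (2 * (K + 1)) / dlt); rewrite -/n => h.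
  by rewrite ler_pdivrMr// mulrAC ler_pdivlMr ?mulr_gt0// mulrC [dlt * _]mulrC -ler_pdivrMr// mulrC ltW.
pose tau j := tau0 * q ^+ j.
have tau_ge j : 0 <= tau j by rewrite mulr_ge0// exprn_ge0// ltW.
pose f (p : k.-tuple letter) (x : R3) := n%:R^-1 * \sum_(j < n) Phi (Yp (tau j) (sretract x)) (cyl p).
have nI : n%:R^-1 * n%:R = 1 :> R by rewrite mulVf// gt_eqF.
exists f; split.
- move=> p; apply: measurable_funM => //; apply: measurable_sum => j.
  by apply: measurable_Phi => w; case/andP : (cyl01 p w).
- move=> p x; rewrite mulr_ge0 ?invr_ge0 ?(ltW n0)// sumr_ge0// => j _.
  by case/andP : (Phi01 (good_Yp (sretract_S2 x) (tau_ge j)) (cyl01 p)).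
- move=> x; rewrite /f -mulr_sumr exchange_big /=.
  under eq_bigr do rewrite (Phi_partition k (good_Yp (sretract_S2 x) (tau_ge _))).
  by rewrite sumr_const card_ord -mulr_natr mul1r.
- move=> p x np; rewrite /f big1 ?mulr0// => j _; rewrite /Phi (_ : wsum _ _ _ = 0%E) ?mul0r//.
  rewrite /wsum esum1// => w _; rewrite /cyl; case: eqP => [tp|_]; last by rewrite mulr0.
  by move: np; rewrite -tp reduced_tend.
move=> g p rgp x x1; have x1' := bd_S2 (oN g) x1.
have /and5P[rg _ gk _ _] := rgp.
have MC := HC g gk rg; set kp := kap (N g) x.
have k0 : 0 < kp := kap_gt0 (oN g) x1.
have k4 : kp <= 4 * C by rewrite (le_trans (kap_le (oN g) x1))// ler_wpM2l.
have k4' : 1 <= kp * (4 * C).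
  rewrite -[leLHS](kap_inv (oN g) x1) ler_wpM2l ?(ltW k0)//.
  have := kap_le (olor_invmx (oN g)) x1'; rewrite (invmx33 (oN g)) => h.
  by rewrite (le_trans h)// ler_wpM2l.
have kq1 : 1 <= kp ^+ 2 * q ^+ L.
  apply: (@le_trans _ _ (kp ^+ 2 * (16 * C ^+ 2))); last by rewrite ler_wpM2l// sqr_ge0.
  rewrite (_ : _ * _ = (kp * (4 * C)) ^+ 2); last by ring.
  by rewrite expr_ge1// (le_trans _ k4').
have kq2 : kp ^+ 2 <= q ^+ L.
  apply: le_trans HL; rewrite (_ : 16 * _ = (4 * C) ^+ 2); last by ring.
  by rewrite lerXn2r ?nnegrE ?(ltW k0)// mulr_ge0// (le_trans _ C1).
(* [kap ^+ 2] is about [q ^+ (m - L)], within one factor [q = 1 + e], which is the tolerance of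
   [ray_compare]. The shift can be negative; adding [L] to both indices keeps them natural. *)
have [m [mL m1 m2]] : exists m : nat, [/\ (m <= 2 * L)%N, q ^+ m <= kp ^+ 2 * q ^+ L &
    kp ^+ 2 * q ^+ L <= q * q ^+ m].
  have ub i : q ^+ i <= kp ^+ 2 * q ^+ L -> (i <= 2 * L)%N.
    move=> h; have : q ^+ i <= q ^+ (2 * L).
      by rewrite mul2n -addnn exprD (le_trans h)// ler_wpM2r// exprn_ge0// ltW.
    by rewrite ler_eXn2l.
  have ex : exists i, q ^+ i <= kp ^+ 2 * q ^+ L by exists 0%N; rewrite expr0.
  case: (ex_maxnP ex ub) => m m1 mmax; exists m; split => //; first exact: ub.
  rewrite -exprS leNgt; apply/negP => /ltW/mmax; by rewrite ltnn.
pose phi' (p' : k.-tuple letter) j := Phi (N g *m Yp (tau j) x) (cyl p').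
pose phi (p' : k.-tuple letter) j := Phi (Yp (tau j) (bd (N g) x)) (cyl p').
have b' p' j : 0 <= phi' p' j <= 1.
  exact: Phi01 (good_action g x1 (tau_ge j)) (cyl01 p').
have bphi p' j : 0 <= phi p' j <= 1 by exact: Phi01 (good_Yp x1' (tau_ge j)) (cyl01 p').
have cmp p' j : `|phi' p' (j + L)%N - phi p' (j + m)%N| <= dlt / (2 * (K + 1)).
  have st : tau (j + m) <= tau (j + L) * kp ^+ 2 <= (1 + e) * tau (j + m).
    have tj : 0 <= tau0 * q ^+ j := tau_ge j.
    rewrite /tau !exprD -/q; apply/andP; split.
      rewrite (_ : tau0 * (q ^+ j * q ^+ L) * kp ^+ 2 = tau0 * q ^+ j * (kp ^+ 2 * q ^+ L)); last by ring.
      by rewrite mulrA ler_wpM2l.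
    rewrite (_ : tau0 * (q ^+ j * q ^+ L) * kp ^+ 2 = tau0 * q ^+ j * (kp ^+ 2 * q ^+ L)); last by ring.
    rewrite (_ : q * _ = tau0 * q ^+ j * (q * q ^+ m)); last by ring.
    by rewrite ler_wpM2l.
  have ts : tau0 <= tau (j + m) by rewrite ler_peMr// exprn_ege1// ltW.
  have e1 : e <= 1 by lra.
  have rc w := ray_compare (oN g) x1 (orb_timelike oN w) C1 MC e0 e1 ts st.
  have c1p : 0 < (1 + 2 * e) / kp by rewrite divr_gt0//; lra.
  have c2p : 0 < kp / (1 - e) by rewrite divr_gt0//; lra.
  have cc : (1 + 2 * e) / kp * (kp / (1 - e)) = c.
    by rewrite /c mulrA mulfVK// gt_eqF.
  apply: (le_trans (Phi_compare (c1 := (1 + 2 * e) / kp) (c2 := kp / (1 - e))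
     (good_action g x1 (tau_ge _)) (good_Yp x1' (tau_ge _)) (cyl01 p') c1p c2p _ _ _)).
  - by rewrite cc.
  - move=> w; have /andP[_ h] := rc w.
    by rewrite mulrAC ler_pdivlMr// mulrC.
  - move=> w; have /andP[h _] := rc w.
    by rewrite mulrAC ler_pdivlMr; [rewrite mulrC|lra].
  by rewrite cc /c; lra.
have fE : f p x + \sum_(p' | Sset g p p') n%:R^-1 * \sum_(j < n) phi' p' j = 1.
  rewrite /f (sretract_id x1) -mulr_sumr exchange_big /= -mulrDr -big_split /=.
  under eq_bigr do rewrite (Phi_relation rgp x1 (tau_ge _)).
  by rewrite sumr_const card_ord -mulr_natr mul1r.
have -> : f p x + \sum_(p' | Sset g p p') f p' (bd (N g) x) - 1 =
   \sum_(p' | Sset g p p') (n%:R^-1 * \sum_(j < n) phi p' j - n%:R^-1 * \sum_(j < n) phi' p' j).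
  rewrite sumrB (eq_bigr (fun p' => n%:R^-1 * \sum_(j < n) phi p' j)).
    by move: fE; lra.
  by move=> p' _; rewrite /f (sretract_id x1').
have each p' : `|n%:R^-1 * \sum_(j < n) phi p' j - n%:R^-1 * \sum_(j < n) phi' p' j| <= dlt / (K + 1).
  rewrite distrC; have := average_compare (bphi p') (b' p') (cmp p') mL (ltn0Sn _ : (0 < n)%N).
  move=> /le_trans; apply; rewrite (_ : dlt / (K + 1) = dlt / (2 * (K + 1)) + dlt / (2 * (K + 1))).
    by rewrite lerD2l.
  by field; rewrite gt_eqF.
rewrite (le_trans (ler_norm_sum _ _ _))// (le_trans (ler_sum _ (fun p' _ => each p')))//.
rewrite (le_trans (y := \sum_(p' : k.-tuple letter) dlt / (K + 1)))//.
  rewrite [leRHS](bigID (Sset g p))/= lerDl sumr_ge0// => p' _.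
  by rewrite divr_ge0 ?(ltW dlt0) ?(ltW K2).
rewrite sumr_const -mulr_natl -/K mulrA ler_pdivrMr// mulrC ler_wpM2l ?(ltW dlt0)//.
by rewrite lerDl.
Qed.

End approximate.

(** * Matrices of words, conjugated to the base point *)

Section word_matrices.
Context {R : realType}.
Variables xi eta : 'M[R]_4.
Hypotheses (oxi : olor xi) (oeta : olor eta).
Local Notation wmx := (word_mx xi eta).

Lemma olor_word_mx w : olor (wmx w).
Proof.
elim: w => [|a w IH] /=; [exact: olor1|apply: olor_mul => //].
by rewrite /letter_mx; case: a => -[] [] //=; exact: olor_invmx.
Qed.

Lemma word_mx_cat u v : wmx (u ++ v) = wmx u *m wmx v.
Proof. by elim: u => [|a u IH] /=; rewrite ?mul1mx// IH mulmxA. Qed.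

Lemma letter_mxV a : letter_mx xi eta a *m letter_mx xi eta (linv a) = 1%:M.
Proof.
by case: a => -[] [] /=; first [apply: mulVmx; exact: olor_unit|apply: mulmxV; exact: olor_unit].
Qed.

Lemma word_mx_freered w : wmx (freered w) = wmx w.
Proof.
elim: w => [//|a w IH] /=; rewrite -IH; case: (freered w) => [//|b t] /=.
by case: eqP => [->|//]; rewrite mulmxA letter_mxV mul1mx.
Qed.

Lemma conj_entry (D M : 'M[R]_4) (e : R) : olor M -> (forall i j, `|D i j| <= e) ->
  forall i j, `|(M *m D *m invmx M) i j| <= 16 * M i3 i3 ^+ 2 * e.
Proof.
move=> oM De i j; have m0 : 0 <= M i3 i3 by case: oM => _ /ltW.
have e0 : 0 <= e := le_trans (normr_ge0 _) (De i j).
have h l : `|(M *m D) i l| <= 4 * (M i3 i3 * e).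
  rewrite mxE (le_trans (ler_norm_sum _ _ _))//.
  apply: (@le_trans _ _ (\sum_(m < 4) M i3 i3 * e)).
    by apply: ler_sum => m _; rewrite normrM ler_pM// olor_entry.
  by rewrite sumr_const card_ord -mulr_natl; lra.
rewrite mxE (le_trans (ler_norm_sum _ _ _))//.
apply: (@le_trans _ _ (\sum_(l < 4) 4 * (M i3 i3 * e) * M i3 i3)).
  apply: ler_sum => l _; rewrite normrM ler_pM// -(invmx33 oM).
  by apply: olor_entry; exact: olor_invmx.
by rewrite sumr_const card_ord -mulr_natl; lra.
Qed.

Variable b : 'M[R]_4.
Hypothesis ob : olor b.

Definition conj_word w := invmx b *m wmx w *m b.

Lemma olor_conj_word w : olor (conj_word w).
Proof. exact: olor_mul (olor_mul (olor_invmx ob) (olor_word_mx w)) ob. Qed.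

Lemma conj_word_mul u v : conj_word (freered (u ++ v)) = conj_word u *m conj_word v.
Proof.
by rewrite /conj_word word_mx_freered word_mx_cat !mulmxA mulmxK// olor_unit.
Qed.

(** Freeness makes distinct reduced words distinct elements, and discreteness separates them.
    Conjugation by [b] changes entrywise distances to the identity by a factor of at most
    [16 * b33 ^+ 2], hence the smaller gap [e']. *)
Lemma conj_word_sum_bounded : discrete_group (Gamma xi eta) -> free_on xi eta ->
  exists C : R, forall ws : seq (seq letter), uniq ws -> all reduced ws ->
    \sum_(w <- ws) (conj_word w i3 i3 ^+ 64)^-1 <= C.
Proof.
move=> [eps [e0 sep]] fr; pose m := b i3 i3.
have d0 : 0 < 16 * m ^+ 2 + 1 by have := sqr_ge0 m; lra.
pose e' := eps / (16 * m ^+ 2 + 1).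
have e'0 : 0 < e' by rewrite divr_gt0.
apply: (orbit_sum_bounded e'0 olor_conj_word) => w w' rw rw' ww'.
pose v := freered (winv w ++ w').
have vE : freered (w ++ v) = w' by exact: freered_winvKr.
have -> : invmx (conj_word w) *m conj_word w' = conj_word v.
  by rewrite -{1}vE conj_word_mul mulKmx// olor_unit//; exact: olor_conj_word.
have vn : v <> [::].
  by move=> v0; move: vE; rewrite v0 cats0 freered_id// => e; rewrite e eqxx in ww'.
have [i [j h]] := sep (wmx v) (ex_intro _ v erefl) (fr v (freered_reduced _) vn).
apply: contrapT => nex.
have De i' j' : `|(conj_word v - 1%:M) i' j'| <= e'.
  rewrite leNgt; apply/negP => lt; apply: nex; exists i', j'.
  by rewrite -mxBE ltW.
have gE : b *m (conj_word v - 1%:M) *m invmx b = wmx v - 1%:M.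
  have ub := olor_unit ob.
  by rewrite mulmxBr mulmxBl mulmx1 mulmxV// /conj_word !mulmxA mulmxV// mul1mx mulmxK.
have := conj_entry ob De i j; rewrite gE mxBE -/m => h2.
have : 16 * m ^+ 2 * e' < eps by rewrite /e' mulrA ltr_pdivrMr//; lra.
by move: h h2; lra.
Qed.

End word_matrices.

(** * Integrals against measures concentrated on the sphere *)

Section concentrated_on_sphere.
Context {R : realType}.
Local Notation R3 := (R * R * R)%type.
Implicit Types (mu : {measure set (R * R * R)%type -> \bar R}) (F G : (R * R * R)%type -> \bar R).

Lemma eq_integral_S2 mu F G : mu (~` S2) = 0%E ->
  measurable_fun setT F -> measurable_fun setT G ->
  (forall x, S2 x -> F x = G x) -> (\int[mu]_x F x = \int[mu]_x G x)%E.
Proof.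
move=> mu0 mF mG FG; apply: ae_eq_integral => //.
exists (~` S2); split => //; first by apply: measurableC; exact: measurable_S2.
by move=> x /= nx xS; apply: nx => _; exact: FG.
Qed.

Lemma le_integral_S2 mu F G : mu (~` S2) = 0%E ->
  measurable_fun setT F -> measurable_fun setT G ->
  (forall x, 0 <= F x)%E -> (forall x, 0 <= G x)%E ->
  (forall x, S2 x -> (F x <= G x)%E) -> (\int[mu]_x F x <= \int[mu]_x G x)%E.
Proof.
move=> mu0 mF mG F0 G0 FG; apply: ae_ge0_le_integral => //.
exists (~` S2); split => //; first by apply: measurableC; exact: measurable_S2.
by move=> x /= nx xS; apply: nx => _; exact: FG.
Qed.

Lemma integral_S2 mu F : mu (~` S2) = 0%E -> measurable_fun setT F ->
  (\int[mu]_(x in S2) F x = \int[mu]_x F x)%E.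
Proof.
move=> mu0 mF; rewrite integral_mkcond; apply: eq_integral_S2 => //.
- by apply/(measurable_restrictT _ measurable_S2); exact: measurable_funTS.
- by move=> x xS; rewrite patchE mem_set.
Qed.

End concentrated_on_sphere.

(** * The Jacobian and the integrated cylinder identity *)

Section jacobian.
Context {R : realType}.
Local Notation R3 := (R * R * R)%type.
Implicit Types (M : 'M[R]_4) (x : (R * R * R)%type).

(* The retraction onto the sphere makes the Jacobian bounded on all of R^3. *)
Definition jac M x : R := (kap M (sretract x) ^+ 2)^-1.

Lemma measurable_jac M : measurable_fun setT (jac M).
Proof.
apply: (measurableT_comp (@measurable_inv R)); apply: measurable_funX.
exact: (measurableT_comp (measurable_kap M) (@measurable_sretract R)).
Qed.

Lemma jac_bounds M x : olor M -> 0 <= jac M x <= (4 * M i3 i3) ^+ 2.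
Proof.
move=> oM; have x1 := sretract_S2 x; have k0 := kap_gt0 oM x1.
rewrite /jac invr_ge0 sqr_ge0 /=.
have le := kap_le (olor_invmx oM) (bd_S2 oM x1); rewrite (invmx33 oM) in le.
have k1 : (kap M (sretract x))^-1 = kap (invmx M) (bd M (sretract x)).
  by apply: (mulfI (lt0r_neq0 k0)); rewrite kap_inv// mulfV ?gt_eqF.
have k2 : 0 < kap (invmx M) (bd M (sretract x)) := kap_gt0 (olor_invmx oM) (bd_S2 oM x1).
by rewrite -exprVn k1 lerXn2r ?nnegrE ?(ltW k2)// (le_trans (ltW k2)).
Qed.

Lemma sph_jac M (F : R3 -> R) : olor M -> measurable_fun setT F -> (forall x, 0 <= F x) ->
  (\int[sph]_x (jac M x * F (bd M x))%:E = \int[sph]_x (F x)%:E)%E.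
Proof.
move=> oM mF F0.
have mFb : measurable_fun setT (fun x : R3 => F (bd M x)).
  exact: (measurableT_comp mF (measurable_bd M)).
have mk : measurable_fun setT (fun x : R3 => (kap M x ^+ 2)^-1).
  by apply: (measurableT_comp (@measurable_inv R)); apply: measurable_funX; exact: measurable_kap.
have mE : measurable_fun setT (EFin \o F) by exact/measurable_EFinP.
have E0 x : (0 <= (EFin \o F) x)%E by rewrite /= lee_fin.
transitivity (\int[sph]_x (F (bd M x) * (kap M x ^+ 2)^-1)%:E)%E.
  apply: eq_integral_S2; first exact: sph_S2C.
  - by apply/measurable_EFinP; apply: measurable_funM => //; exact: measurable_jac.
  - by apply/measurable_EFinP; exact: measurable_funM.
  - by move=> x x1; rewrite /jac sretract_id// mulrC.
exact: (sph_change_of_variables oM mE E0).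
Qed.

Lemma integral_one (mu : {measure set R3 -> \bar R}) : (\int[mu]_x (1 : R)%:E = mu setT)%E.
Proof. by rewrite -[RHS]mul1e -integral_cst. Qed.

(** The pointwise bound is multiplied by [jac M], which has total mass [1]; the change of variables
    then removes [bd M] from the terms [h j]. *)
Lemma cocycle_estimate M (f : R3 -> R) (J : Type) (r : seq J) (h : J -> R3 -> R) (d : R) :
  olor M -> measurable_fun setT f -> (forall j, measurable_fun setT (h j)) ->
  (forall x, 0 <= f x <= 1) -> (forall j x, 0 <= h j x <= 1) -> 0 <= d ->
  (forall x, S2 x -> `|f x + \sum_(j <- r) h j (bd M x) - 1| <= d) ->
  `|fine (\int[sph]_x (jac M x * f x)%:E) +
    \sum_(j <- r) fine (\int[sph]_x (h j x)%:E) - 1| <= d.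
Proof.
move=> oM mf mh f01 h01 d0 est.
have mj := measurable_jac M.
have j0 x : 0 <= jac M x by case/andP : (jac_bounds x oM).
have f0 x : 0 <= f x by case/andP : (f01 x).
have h0 j x : 0 <= h j x by case/andP : (h01 j x).
have J1 : (\int[sph]_x (jac M x)%:E = 1)%E.
  rewrite -(@sph_setT R) -integral_one -(@sph_jac M (cst 1)) //.
  by apply: eq_integral => x _; rewrite /= mulr1.
have mjf : measurable_fun setT (fun x => jac M x * f x) by exact: measurable_funM.
have mjh j : measurable_fun setT (fun x => jac M x * h j (bd M x)).
  by apply: measurable_funM => //; exact: (measurableT_comp (mh j) (measurable_bd M)).
pose T x := jac M x * f x + \sum_(j <- r) jac M x * h j (bd M x).
have T0 x : 0 <= T x by rewrite addr_ge0 ?mulr_ge0// sumr_ge0// => j _; rewrite mulr_ge0.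
have mT : measurable_fun setT T by apply: measurable_funD => //; exact: measurable_sum.
have pw x : S2 x -> `|T x - jac M x| <= d * jac M x.
  move=> /est e; rewrite (_ : T x - jac M x =
    jac M x * (f x + \sum_(j <- r) h j (bd M x) - 1)); last by rewrite /T -mulr_sumr; ring.
  by rewrite normrM ger0_norm// mulrC ler_wpM2r.
set A := (\int[sph]_x (jac M x * f x)%:E)%E.
have TE : (\int[sph]_x (T x)%:E = A + \sum_(j <- r) \int[sph]_x (h j x)%:E)%E.
  transitivity (\int[sph]_x ((jac M x * f x)%:E + \sum_(j <- r) (jac M x * h j (bd M x))%:E))%E.
    by apply: eq_integral => x _; rewrite sumEFin -EFinD.
  have sE : (\int[sph]_x (\sum_(j <- r) (jac M x * h j (bd M x))%:E) =
      \sum_(j <- r) \int[sph]_x (jac M x * h j (bd M x))%:E)%E.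
    apply: ge0_integral_sum => //; first [by move=> j; exact/measurable_EFinP
      |by move=> j x _; rewrite lee_fin mulr_ge0].
  transitivity (A + \int[sph]_x (\sum_(j <- r) (jac M x * h j (bd M x))%:E))%E.
    apply: ge0_integralD => //; first [by move=> x _; rewrite lee_fin mulr_ge0
      |exact/measurable_EFinP
      |by move=> x _; apply: sume_ge0 => j _; rewrite lee_fin mulr_ge0
      |by apply: emeasurable_sum => j; exact/measurable_EFinP].
  rewrite sE; congr (A + _)%E.
  by apply: eq_bigr => j _; exact: (sph_jac oM (mh j) (h0 j)).
have cJ (c : R) : 0 <= c -> (\int[sph]_x (c * jac M x)%:E = c%:E)%E.
  move=> c0; transitivity (\int[sph]_x (c%:E * (jac M x)%:E))%E.
    by apply: eq_integral => x _; rewrite EFinM.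
  rewrite ge0_integralZl_EFin ?J1 ?mule1//.
  - by move=> x _; rewrite lee_fin.
  - exact/measurable_EFinP.
have mcj (c : R) : measurable_fun setT (fun x => (c * jac M x)%:E).
  by apply/measurable_EFinP; exact: measurable_funM.
have up : (\int[sph]_x (T x)%:E <= (1 + d)%:E)%E.
  rewrite -[leRHS]cJ ?addr_ge0//; apply: le_integral_S2 => //.
  - exact: sph_S2C.
  - exact/measurable_EFinP.
  - by move=> x; rewrite lee_fin mulr_ge0// addr_ge0.
  - by move=> x /pw; rewrite lee_fin ler_norml mulrDl mul1r; lra.
(* With [d] on the larger side, only integrals of nonnegative functions are added and no extended
   real is subtracted. *)
have lo : (1 <= \int[sph]_x (T x)%:E + d%:E)%E.
  have DE : (\int[sph]_x ((T x)%:E + (d * jac M x)%:E) =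
      \int[sph]_x (T x)%:E + \int[sph]_x (d * jac M x)%:E)%E.
    apply: ge0_integralD => //; first [by move=> x _; rewrite lee_fin
      |by move=> x _; rewrite lee_fin mulr_ge0|exact/measurable_EFinP|exact: mcj].
  rewrite -[leLHS]J1 -(cJ d d0) -DE.
  apply: le_integral_S2 => //; first [exact: sph_S2C|exact/measurable_EFinP
    |by apply: emeasurable_funD => //; exact/measurable_EFinP
    |by move=> x; rewrite -EFinD lee_fin addr_ge0// mulr_ge0
    |by move=> x /pw; rewrite -EFinD lee_fin ler_norml; lra].
have finA : A \is a fin_num.
  rewrite ge0_fin_numE; last by apply: integral_ge0 => x _; rewrite lee_fin mulr_ge0.
  apply: (@le_lt_trans _ _ (\int[sph]_x (jac M x)%:E)%E); last by rewrite J1 ltry.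
  apply: le_integral_S2 => //; first exact: sph_S2C.
  - exact/measurable_EFinP.
  - exact/measurable_EFinP.
  - by move=> x; rewrite lee_fin mulr_ge0.
  - by move=> x _; rewrite lee_fin ler_piMr//; case/andP : (f01 x).
have finB j : (\int[sph]_x (h j x)%:E)%E \is a fin_num.
  rewrite ge0_fin_numE; last by apply: integral_ge0 => x _; rewrite lee_fin.
  apply: (@le_lt_trans _ _ (\int[sph]_x (1 : R)%:E)%E); last by rewrite integral_one sph_setT ltry.
  apply: le_integral_S2 => //; first exact: sph_S2C.
  - exact/measurable_EFinP.
  - by move=> x; rewrite lee_fin.
  - by move=> x _; rewrite lee_fin; case/andP : (h01 j x).
have TF : (\int[sph]_x (T x)%:E)%E = (fine A + \sum_(j <- r) fine (\int[sph]_x (h j x)%:E)%E)%:E.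
  rewrite TE EFinD fineK// -sumEFin; congr (_ + _)%E.
  by apply: eq_bigr => j _; rewrite fineK.
by move: up lo; rewrite TF -EFinD !lee_fin ler_norml; lra.
Qed.

End jacobian.

(** * Exact relations in the limit *)

Section limit_measures.
Context {R : realType}.
Local Notation R3 := (R * R * R)%type.
Variable N : seq letter -> 'M[R]_4.
Hypothesis oN : forall w, olor (N w).
Hypothesis N_mul : forall u v, N (freered (u ++ v)) = N u *m N v.
Hypothesis sumN : exists C : R, forall ws : seq (seq letter), uniq ws -> all reduced ws ->
    \sum_(w <- ws) (N w i3 i3 ^+ 64)^-1 <= C.

Lemma equivariant_measures (k : nat) :
  exists nu : k.-tuple letter -> {measure set R3 -> \bar R},
  [/\ forall E, measurable E -> sph E = (\sum_p nu p E)%E,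
      forall p : k.-tuple letter, ~~ reduced p -> nu p setT = 0%E,
      forall p, nu p (~` S2) = 0%E &
      forall g (p : k.-tuple letter), relation_k g p ->
      (\int[nu p]_x (jac (N g) x)%:E + \sum_(p' | Sset g p p') nu p' setT = 1)%E].
Proof.
have dl (n : nat) : 0 < n.+1%:R^-1 :> R by rewrite invr_gt0 ltr0n.
have ex (n : nat) := approximate_densities oN N_mul sumN k (dl n).
have [f Hf] := choice ex.
have mf n p : measurable_fun setT (f n p) by case: (Hf n).
have f0 n p x : 0 <= f n p x by case: (Hf n).
have f1 n x : \sum_p f n p x = 1 by case: (Hf n).
have f01 n p x : 0 <= f n p x <= 1.
  by rewrite f0 -(f1 n x) (bigD1 p)//= lerDl sumr_ge0.
(* [U] refines [\oo], so errors that vanish at infinity also vanish along [U]. *)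
have [U [UU HU]] : exists U : set_system nat, UltraFilter U /\ \oo `<=` U.
  exact: ultraFilterLemma.
have PU : ProperFilter U := ultra_proper.
have [nu [nuE nu1 nul]] := ultralimit_measures UU mf f0 (@sph_setT R) f1.
have ulim (u : nat -> R) (l l' : R) : u @ U --> l -> u @ U --> l' -> l = l'.
  move=> h h'; have e1 : lim (u @ U) = l by apply: cvg_lim => //.
  have e2 : lim (u @ U) = l' by apply: cvg_lim => //.
  by rewrite -e1 e2.
have fin p : nu p setT \is a fin_num.
  by rewrite ge0_fin_numE// (le_lt_trans (nu1 p))// ltry.
have mass p : (fun n => fine (\int[sph]_x (f n p x)%:E)%E) @ U --> fine (nu p setT).
  have c : (fun n => fine (\int[sph]_x (cst (1 : R) x * f n p x)%:E)%E) @ U -->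
      fine (\int[nu p]_x (cst (1 : R) x)%:E)%E.
    by apply: (nul p (cst 1) 1) => [|x]; [exact: measurable_cst|rewrite /= ler01 lexx].
  rewrite -(integral_one (nu p)) (_ : (fun n => fine _) =
    (fun n => fine (\int[sph]_x (cst (1 : R) x * f n p x)%:E)%E)); first exact: c.
  by apply/funext => n; congr fine; apply: eq_integral => x _; rewrite /= mul1r.
exists nu; split => //.
- move=> p np; rewrite -(fineK (fin p)); congr EFin.
  apply: (ulim _ _ _ (mass p)).
  rewrite (_ : (fun n => _) = cst 0); first exact: cvg_cst.
  apply/funext => n; rewrite integral0_eq// => x _.
  by case: (Hf n) => _ _ _ /(_ p x np) ->.
- move=> p; apply/eqP; rewrite -measure_le0 -(@sph_S2C R) nuE; last first.
    by apply: measurableC; exact: measurable_S2.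
  by rewrite (bigD1 p)//= leeDl// sume_ge0.
move=> g p rgp; pose r := [seq p' <- index_enum {: k.-tuple letter} | Sset g p p'].
have mj := measurable_jac (N g).
have c1 := nul p _ _ mj (fun x => jac_bounds x (oN g)).
have FU : Filter U by exact: filter_filter.
have c2 : (fun n => \sum_(p' <- r) fine (\int[sph]_x (f n p' x)%:E)%E) @ U -->
    \sum_(p' <- r) fine (nu p' setT).
  exact: (cvg_sumr FU mass).
have c4 : (fun n => fine (\int[sph]_x (jac (N g) x * f n p x)%:E)%E +
    \sum_(p' <- r) fine (\int[sph]_x (f n p' x)%:E)%E) @ U --> (1 : R).
  apply/cvgrPdist_le => e e0; apply: HU.
  have := near_infty_natSinv_lt (PosNum e0); apply: filterS => n /= hn.
  rewrite distrC; apply: le_trans (ltW hn).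
  apply: (cocycle_estimate (oN g) (mf n p) (mf n) (f01 n p) (f01 n) (ltW (dl n))) => x x1.
  by rewrite big_filter; case: (Hf n) => _ _ _ _ /(_ g p rgp x x1).
have e : fine (\int[nu p]_x (jac (N g) x)%:E)%E + \sum_(p' <- r) fine (nu p' setT) = 1.
  by apply: (ulim _ _ _ _ c4); apply: cvgD; [exact: c1|exact: c2].
have finS : (\sum_(p' | Sset g p p') nu p' setT = (\sum_(p' <- r) fine (nu p' setT))%:E)%E.
  by rewrite big_filter -sumEFin; apply: eq_bigr => p' _; rewrite fineK.
(* The limit relates real parts only; boundedness of [jac] gives the finiteness that lifts it to
   extended reals. *)
have finJ : (\int[nu p]_x (jac (N g) x)%:E)%E \is a fin_num.
  rewrite ge0_fin_numE; last first.
    by apply: integral_ge0 => x _; rewrite lee_fin; case/andP : (jac_bounds x (oN g)).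
  pose C := (4 * N g i3 i3) ^+ 2.
  apply: (@le_lt_trans _ _ (\int[nu p]_x (cst C%:E x))%E); last first.
    by rewrite integral_cst// -(fineK (fin p)) -EFinM ltry.
  apply: ge0_le_integral => //.
  - by move=> x _; rewrite lee_fin; case/andP : (jac_bounds x (oN g)).
  - exact/measurable_EFinP.
  - by move=> x _; rewrite lee_fin; case/andP : (jac_bounds x (oN g)).
by rewrite finS -(fineK finJ) -EFinD e.
Qed.

End limit_measures.

(** * Transport back to the base point [z0] *)

Theorem theorem3p4 (R : realType) (xi eta : 'M[R]_4) (k : nat) (z0 : 'cV[R]_4) :
  kleinian xi eta ->
  free_on xi eta ->
  geom_infinite (Gamma xi eta) ->
  no_parabolic (Gamma xi eta) ->
  (2 <= k)%N ->
  H3 z0 ->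
  exists nu : k.-tuple letter -> {measure set (R * R * R)%type -> \bar R},
    (forall p : k.-tuple letter, reduced p -> nu p (~` S2) = 0%E) /\
    (forall E : set (R * R * R)%type, measurable E ->
       Az z0 E = (\sum_(p : k.-tuple letter | reduced p) nu p E)%E) /\
    (forall (g : seq letter) (p : k.-tuple letter), relation_k g p ->
       (\int[nu p]_(x in S2) ((lam (word_mx xi eta g) z0 x) ^+ 2)%:E
        = 1 - \sum_(p' : k.-tuple letter | Sset g p p') nu p' S2)%E).
Proof.
move=> [/lorentz_olor oxi [/lorentz_olor oeta disc]] fr _ _ _ Hz.
have ob := olor_boost Hz; set b := boost z0 in ob.
have [nu0 [nuE nuR nuS nuJ]] := equivariant_measures (olor_conj_word oxi oeta ob)
  (conj_word_mul oxi oeta ob) (conj_word_sum_bounded oxi oeta ob disc fr) k.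
have mb : measurable_fun [set: (R * R * R)%type] (bd b : (R * R * R)%type -> (R * R * R)%type).
  exact: measurable_bd.
have mpre (E : set (R * R * R)%type) : measurable E -> measurable (bd b @^-1` E).
  by move=> mE; have := mb measurableT _ mE; rewrite setTI.
have mS := @measurable_S2 R; have mSC := measurableC mS.
(* The measures found for the conjugated group are moved by [bd (boost z0)], exactly as [Az z0] is
   obtained from [sigma0]. *)
pose nu p := measure_function_pushforward__canonical__measure_function_Measure (nu0 p) mb
  : {measure set (R * R * R)%type -> \bar R}.
have nuSC p : nu p (~` S2) = 0%E.
  apply: (subset_measure0 (mpre _ mSC) mSC _ (nuS p)) => x /= h xS; apply: h.
  exact: bd_S2.
have nuS2 p : nu p S2 = nu0 p setT.
  rewrite -[setT](setUv (bd b @^-1` S2)) measureU0//; first exact: mpre.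
  - exact: measurableC (mpre _ mS).
  - exact: nuSC.
exists nu; split; [by move=> p _; exact: nuSC|split].
  move=> E mE; rewrite /Az sigma0E; last exact: mpre.
  rewrite nuE; last exact: mpre.
  rewrite (bigID (fun p : k.-tuple letter => reduced p)) /= [X in (_ + X)%E]big1 ?adde0//.
  move=> p np; exact: (subset_measure0 (mpre _ mE) measurableT _ (nuR _ np)).
move=> g p rgp; under [X in (_ - X)%E]eq_bigr do rewrite nuS2.
have J1 := nuJ g p rgp; set S := (\sum_(p' | _) nu0 p' setT)%E in J1 *.
set W := word_mx xi eta g; have oW : olor W := olor_word_mx oxi oeta g.
have oB := olor_invmx ob; have oBW := olor_mul oB oW.
pose L x : R := (kap (invmx b) x / kap (invmx b *m W) x) ^+ 2.
have mL : measurable_fun setT (L : (R * R * R)%type -> R).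
  apply: measurable_funX; apply: measurable_funM; first exact: measurable_kap.
  by apply: (measurableT_comp (@measurable_inv R)); exact: measurable_kap.
have mLE : measurable_fun setT (EFin \o L) by exact/measurable_EFinP.
have -> : (\int[nu p]_(x in S2) ((lam W z0 x) ^+ 2)%:E = \int[nu p]_(x in S2) (EFin \o L) x)%E.
  by apply: eq_integral => x /set_mem xS; rewrite lamE.
rewrite integral_S2//.
have -> : (\int[nu p]_x (EFin \o L) x = \int[nu0 p]_x (L (bd b x))%:E)%E.
  apply: (etrans (ge0_integral_pushforward mb (nu0 p) measurableT mLE _)) => //.
  by move=> x _; rewrite /= lee_fin sqr_ge0.
(* Cocycle rule for [kap]: at [bd b x] the numerator is [(kap b x)^-1], and the denominator times
   [kap b x] is [kap] of the conjugated word at [x]. *)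
have -> : (\int[nu0 p]_x (L (bd b x))%:E = \int[nu0 p]_x (jac (conj_word xi eta b g) x)%:E)%E.
  apply: eq_integral_S2 => //.
  - by apply/measurable_EFinP; exact: (measurableT_comp mL mb).
  - by apply/measurable_EFinP; exact: measurable_jac.
  - move=> x xS; rewrite /L /jac sretract_id// /conj_word -/W (kap_mul _ ob xS).
    have u0 := kap_gt0 ob xS.
    have -> : kap (invmx b) (bd b x) = (kap b x)^-1.
      by apply: (mulfI (lt0r_neq0 u0)); rewrite kap_inv// mulfV ?gt_eqF.
    by rewrite -exprVn invfM.
have S0 : (0 <= S)%E by apply: sume_ge0.
(* Subtraction of [S] cancels its addition only when [S] is finite. *)
have finS : S \is a fin_num.
  rewrite ge0_fin_numE//; apply: (@le_lt_trans _ _ 1%E); last exact: ltry.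
  rewrite -J1 leeDr//; apply: integral_ge0 => y _.
  by rewrite lee_fin invr_ge0 sqr_ge0.
by rewrite -J1 addeK.
Qed.
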